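(* Let $n\geqslant 1$ be an integer and $p>1$. Let $b\in C^1([0,\infty))\cap L^\infty((0,\infty))$ and $m\in C([0,\infty))$ be real-valued, put $B(t):=\int_0^t b(\tau)\,\mathrm{d}\tau$ and $V(t):=m(t)-\frac12 b'(t)-\frac14[b(t)]^2$, and assume $V\in L^1((0,\infty))$. Suppose that $(u_0,u_1)\in H^1(\mathbb{R}^n)\times L^2(\mathbb{R}^n)$ are nonnegative and compactly supported, not both identically zero, with $\operatorname{supp}u_0\cup\operatorname{supp}u_1\subset B_R$ for some $R>0$. Define $$\mathcal{H}_p(t):=\int_1^t \mathrm{e}^{-\frac{p-1}{2}B(s)}(1+s)^{-\frac{p-1}{p_{\mathrm{Gla}}(n)-1}}\,\mathrm{d}s,\qquad t\geqslant 1,$$ where the exponent of $(1+s)$ is understood as $0$ when $n=1$. If $$\lim_{t\to\infty}\mathcal{H}_p(t)=\infty,$$ then there is a constant $C=C(n,p,b,m,R,u_0,u_1)>0$, independent of $\varepsilon$, such that for every $\varepsilon>0$ and every local in-time energy solution $u$, with lifespan $T_\varepsilon$, to $$\begin{cases}u_{tt}-\Delta u+b(t)u_t+m(t)u=|u_t|^p, & x\in\mathbb{R}^n,\ t>0,\\ u(0,x)=\varepsilon u_0(x),\ u_t(0,x)=\varepsilon u_1(x), & x\in\mathbb{R}^n,\end{cases}$$ one has $T_\varepsilon<\infty$ and, more precisely, $$T_\varepsilon\leqslant \mathcal{H}_p^{-1}\big(C\varepsilon^{-(p-1)}\big).$$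
   Context: $B_r$ denotes the open ball in $\mathbb{R}^n$ centered at the origin with radius $r$. The Glassey exponent is $p_{\mathrm{Gla}}(d):=1+\frac{2}{d-1}$ for real $d>1$, and $p_{\mathrm{Gla}}(1):=\infty$ (so for $n\geqslant 2$ the exponent $-\frac{p-1}{p_{\mathrm{Gla}}(n)-1}$ equals $-\frac{(n-1)(p-1)}{2}$). Energy solution. Let $T>0$. A function $u\in C([0,T),H^1(\mathbb{R}^n))\cap C^1([0,T),L^2(\mathbb{R}^n))$ with $u_t\in L^p_{\mathrm{loc}}([0,T)\times\mathbb{R}^n)$ is called a local in-time energy solution on $[0,T)$ if $\operatorname{supp}u(t,\cdot)\subset B_{R+t}$ for every $t\in[0,T)$, the initial conditions $u(0,\cdot)=\varepsilon u_0$, $u_t(0,\cdot)=\varepsilon u_1$ hold in $H^1\times L^2$, and for every $t\in[0,T)$ and every $\Phi\in C_0^\infty([0,T)\times\mathbb{R}^n)$, $$\int_{\mathbb{R}^n}u_t(t,x)\Phi(t,x)\,\mathrm{d}x-\varepsilon\int_{\mathbb{R}^n}u_1(x)\Phi(0,x)\,\mathrm{d}x-\int_0^t\!\int_{\mathbb{R}^n}u_t\Phi_s\,\mathrm{d}x\,\mathrm{d}s+\int_0^t\!\int_{\mathbb{R}^n}\nabla u\cdot\nabla\Phi\,\mathrm{d}x\,\mathrm{d}s+\int_0^t\!\int_{\mathbb{R}^n}\big(b(s)u_t+m(s)u\big)\Phi\,\mathrm{d}x\,\mathrm{d}s=\int_0^t\!\int_{\mathbb{R}^n}|u_t|^p\Phi\,\mathrm{d}x\,\mathrm{d}s.$$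 The lifespan $T_\varepsilon\in(0,\infty]$ of $u$ is its maximal continuation time within this class of energy solutions; $u$ is regarded as defined on $[0,T_\varepsilon)$. Since the integrand of $\mathcal{H}_p$ is continuous and strictly positive, when $\mathcal{H}_p(t)\to\infty$ the function $\mathcal{H}_p:[1,\infty)\to[0,\infty)$ is a strictly increasing continuous bijection with $\mathcal{H}_p(1)=0$, and $\mathcal{H}_p^{-1}:[0,\infty)\to[1,\infty)$ denotes its inverse. *)

(* Defs.v *)
From HB Require Import structures.
From mathcomp Require Import all_boot all_order all_algebra.
From mathcomp Require Import all_classical all_reals all_analysis.

Set Implicit Arguments.
Unset Strict Implicit.
Unset Printing Implicit Defensive.
Import Order.TTheory GRing.Theory Num.Theory.
Import numFieldNormedType.Exports.
Local Open Scope classical_set_scope.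
Local Open Scope ring_scope.

(* Borel sigma-algebra of R^n = 'rV[R]_n, generated by the coordinates (as the
   library does for n.-tuple T). *)
Definition rV_display : measure_display -> measure_display.
Proof. exact. Qed.

Section rV_measurable.
Context {R : realType} {n : nat}.

Definition rV_coord (i : 'I_n) (x : 'rV[R]_n) : R := x ord0 i.

Let rV_measurable0 : g_sigma_preimage rV_coord set0.
Proof. exact: sigma_algebra0. Qed.

Let rV_measurableC A :
  g_sigma_preimage rV_coord A -> g_sigma_preimage rV_coord (~` A).
Proof. exact: sigma_algebraC. Qed.

Let rV_measurable_bigcup (F : (set 'rV[R]_n)^nat) :
  (forall i, g_sigma_preimage rV_coord (F i)) ->
  g_sigma_preimage rV_coord (\bigcup_i F i).
Proof. exact: sigma_algebra_bigcup. Qed.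

HB.instance Definition _ := @isMeasurable.Build
  (rV_display default_measure_display) 'rV[R]_n (g_sigma_preimage rV_coord)
  rV_measurable0 rV_measurableC rV_measurable_bigcup.

Lemma measurable_rV_coord (i : 'I_n) : measurable_fun setT (rV_coord i).
Proof.
move=> _ Y mY; rewrite setTI; apply: sub_sigma_algebra => /=.
rewrite -bigcup_seq/=; exists i => /=; first by rewrite mem_index_enum.
by exists Y => //; rewrite setTI.
Qed.

Lemma measurable_fun_rV d (T : measurableType d) (f : T -> 'rV[R]_n) :
  (forall i, measurable_fun setT (rV_coord i \o f)) -> measurable_fun setT f.
Proof.
move=> mf _ A mA; rewrite setTI.
pose G : set (set 'rV[R]_n) := [set B | measurable (f @^-1` B)].
suff : (measurable : set (set 'rV[R]_n)) `<=` G by exact.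
apply: smallest_sub.
  split; first by rewrite /G/= preimage_set0.
    by move=> B; rewrite /G/= setTD preimage_setC; exact: measurableC.
  by move=> F mF; rewrite /G/= preimage_bigcup; exact: bigcupT_measurable.
move=> B; rewrite -bigcup_seq => -[i _ [Y mY <-]].
by rewrite /G/= setTI -comp_preimage -[X in measurable X]setTI; exact: mf.
Qed.

End rV_measurable.

(* n-dimensional Lebesgue measure: leb R 0 is the unit mass on the one-point
   space, leb R n.+1 the image of lebesgue_measure \x leb R n under
   (a, x) |-> (a, x_0, ..., x_(n-1)). *)
Section leb_step.
Context {R : realType} {n : nat}.
Variable mu : {sigma_finite_measure set 'rV[R]_n -> \bar R}.

Definition rV_cons (z : R * 'rV[R]_n) : 'rV[R]_n.+1 :=
  \row_i if unlift ord0 i is Some j then z.2 ord0 j else z.1.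

Definition rV_uncons (x : 'rV[R]_n.+1) : R * 'rV[R]_n :=
  (x ord0 ord0, \row_j x ord0 (lift ord0 j)).

Lemma rV_consK : cancel rV_cons rV_uncons.
Proof.
move=> [a x]; rewrite /rV_cons /rV_uncons; congr pair.
  by rewrite mxE unlift_none.
by apply/rowP => j; rewrite !mxE liftK.
Qed.

Lemma measurable_rV_cons : measurable_fun setT rV_cons.
Proof.
apply: measurable_fun_rV => i; case: (unliftP ord0 i) => [j|] ->.
- rewrite (_ : _ \o _ = rV_coord j \o snd).
    exact: (measurableT_comp (measurable_rV_coord j) measurable_snd).
  by apply/funext => z; rewrite /= /rV_coord mxE liftK.
- rewrite (_ : _ \o _ = fst); first exact: measurable_fst.
  by apply/funext => z; rewrite /= /rV_coord mxE unlift_none.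
Qed.

Lemma measurable_rV_uncons : measurable_fun setT rV_uncons.
Proof.
apply/measurable_fun_pair; first exact: (measurable_rV_coord ord0).
apply: measurable_fun_rV => j.
rewrite (_ : _ \o _ = rV_coord (lift ord0 j)); first exact: measurable_rV_coord.
by apply/funext => x; rewrite /= /rV_coord mxE.
Qed.

Definition leb_step : set 'rV[R]_n.+1 -> \bar R :=
  pushforward (@lebesgue_measure R \x mu)%E rV_cons.

Let leb_step0 : leb_step set0 = 0%E.
Proof. by rewrite /leb_step /pushforward preimage_set0 measure0. Qed.

Let leb_step_ge0 A : (0 <= leb_step A)%E.
Proof. exact: (measure_ge0 (@lebesgue_measure R \x mu)%E). Qed.

Let leb_step_sigma_additive : semi_sigma_additive leb_step.
Proof.
move=> F mF tF mUF; rewrite /leb_step /pushforward preimage_bigcup.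
have mpre A : measurable A -> measurable (rV_cons @^-1` A).
  by move=> mA; rewrite -[X in measurable X]setTI; exact: measurable_rV_cons.
apply: (@measure_semi_sigma_additive _ _ _ (@lebesgue_measure R \x mu)%E).
- by move=> k; apply: mpre.
- apply/trivIsetP => i j _ _ ij; rewrite -preimage_setI.
  by move/trivIsetP : tF => /(_ _ _ _ _ ij) ->//; rewrite preimage_set0.
- by rewrite -preimage_bigcup; exact: mpre.
Qed.

HB.instance Definition _ := isMeasure.Build _ _ _ leb_step
  leb_step0 leb_step_ge0 leb_step_sigma_additive.

Let leb_step_sigma_finite : sigma_finite setT leb_step.
Proof.
have /sigma_finiteP[F [TF ndF Foo]] := sigma_finiteT (@lebesgue_measure R).
have /sigma_finiteP[G [TG ndG Goo]] := sigma_finiteT mu.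
exists (fun k => rV_uncons @^-1` (F k `*` G k)).
  rewrite -preimage_bigcup (_ : \bigcup_k _ = setT) ?preimage_setT//.
  apply/seteqP; split => // -[a x] _.
  have [k _ Fka] : (\bigcup_k F k) a by rewrite -TF.
  have [l _ Glx] : (\bigcup_k G k) x by rewrite -TG.
  exists (maxn k l) => //; split => /=.
  - by move: a Fka; exact/subsetPset/ndF/leq_maxl.
  - by move: x Glx; exact/subsetPset/ndG/leq_maxr.
move=> k; have [mF Fk] := Foo k; have [mG Gk] := Goo k; split.
  rewrite -[X in measurable X]setTI; apply: measurable_rV_uncons => //.
  exact: measurableX.
rewrite /leb_step /pushforward -comp_preimage.
rewrite (_ : rV_uncons \o rV_cons = id); last exact/funext/rV_consK.
by rewrite preimage_id product_measure1E// lte_mul_pinfty// ge0_fin_numE.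
Qed.

HB.instance Definition _ := Measure_isSigmaFinite.Build _ _ _ leb_step
  leb_step_sigma_finite.

End leb_step.

Fixpoint leb (R : realType) (n : nat) :
    {sigma_finite_measure set 'rV[R]_n -> \bar R} :=
  match n with
  | 0 => [the {sigma_finite_measure set 'rV[R]_0 -> \bar R} of \d_(0 : 'rV[R]_0)]
  | k.+1 => [the {sigma_finite_measure set 'rV[R]_k.+1 -> \bar R} of
               leb_step (leb R k)]
  end.

Section function_spaces.
Context {R : realType} {n : nat}.
Implicit Types (f : 'rV[R]_n -> R) (g : 'I_n -> 'rV[R]_n -> R).

(* Open Euclidean ball; the norm of 'rV[R]_n is the sup norm. *)
Definition eball (r : R) : set 'rV[R]_n :=
  [set x | Num.sqrt (\sum_(i < n) x ord0 i ^+ 2) < r].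

(* Support of (the class of) a measurable function: the complement of the
   largest open set on which it vanishes almost everywhere. *)
Definition ess_support f : set 'rV[R]_n :=
  ~` \bigcup_(O in [set O : set 'rV[R]_n |
       open O /\ {ae leb R n, forall x, O x -> f x = 0}]) O.

(* Iterated directional derivatives of all orders exist and are differentiable;
   in finite dimension this is C^infty. *)
Definition smooth (V : normedModType R) (f : V -> R) :=
  forall (s : seq V) (x : V),
    differentiable (foldr (fun v h => 'D_v h) f s) x.

Definition unit_vec (i : 'I_n) : 'rV[R]_n := delta_mx ord0 i.

Definition test_fun (phi : 'rV[R]_n -> R) :=
  smooth phi /\ compact (closure [set x | phi x != 0]).

Definition is_weak_grad f g := forall (i : 'I_n) phi, test_fun phi ->
  \int[leb R n]_x (f x * 'D_(unit_vec i) phi x) =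
  - \int[leb R n]_x (g i x * phi x).

Definition L2 f := f \in Lfun (leb R n) 2%:E.

Definition L2norm f : \bar R := 'N[leb R n]_2%:E [EFin \o f].

(* A weak gradient with L^2 components (a.e. unique), 0 if there is none. *)
Definition wgrad f : 'I_n -> 'rV[R]_n -> R :=
  xget (fun=> fun=> 0) [set g | (forall i, L2 (g i)) /\ is_weak_grad f g].

Definition H1 f :=
  L2 f /\ exists g, (forall i, L2 (g i)) /\ is_weak_grad f g.

Definition H1norm f : \bar R :=
  ((L2norm f ^+ 2 + \sum_(i < n) L2norm (wgrad f i) ^+ 2) `^ 2^-1)%E.

End function_spaces.

Section energy_solutions.
Context {R : realType} {n : nat}.
Implicit Types (T : \bar R) (u ut v : R -> 'rV[R]_n -> R) (t s : R).

(* [0, T), with T possibly +oo *)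
Definition time_dom T : set R := [set t | 0 <= t /\ (t%:E < T)%E].

Definition time_continuous (N : ('rV[R]_n -> R) -> \bar R) T u :=
  forall t, time_dom T t ->
    N (u s \- u t) @[s --> within (time_dom T) (nbhs t)] --> 0%E.

Definition in_C_H1 T u :=
  (forall t, time_dom T t -> H1 (u t)) /\ time_continuous H1norm T u.

(* u : [0, T) -> L^2 is C^1 with derivative ut (one-sided at 0). *)
Definition in_C1_L2 T u ut :=
  [/\ forall t, time_dom T t -> L2 (u t) /\ L2 (ut t),
      forall t, time_dom T t ->
        L2norm (fun x => (u (t + h) x - u t x) / h - ut t x)
          @[h --> within [set h | time_dom T (t + h)] 0^'] --> 0%E
    & time_continuous L2norm T ut].

Definition in_Lp_loc (p : R) T (w : R -> 'rV[R]_n -> R) :=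
  measurable_fun (time_dom T `*` setT) (fun z : R * 'rV[R]_n => w z.1 z.2) /\
  forall K : set (R * 'rV[R]_n), compact K -> K `<=` time_dom T `*` setT ->
    (\int[@lebesgue_measure R \x leb R n]_(z in K)
       (`|w z.1 z.2| `^ p)%:E < +oo)%E.

(* C_0^infty([0, T) x R^n): restrictions of smooth functions on R x R^n whose
   support in [0, T) x R^n is contained in a compact subset of it; nothing is
   required at t = 0. *)
Definition spacetime_test T (Phi : R * 'rV[R]_n -> R) :=
  smooth Phi /\
  exists K : set (R * 'rV[R]_n),
    [/\ compact K, K `<=` time_dom T `*` setT &
        forall z, (time_dom T `*` setT) z -> ~ K z -> Phi z = 0].

Definition dt (Phi : R * 'rV[R]_n -> R) (s : R) (x : 'rV[R]_n) : R :=
  'D_((1, 0) : R * 'rV[R]_n) Phi (s, x).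

Definition dx (i : 'I_n) (Phi : R * 'rV[R]_n -> R) (s : R) (x : 'rV[R]_n) : R :=
  'D_((0, unit_vec i) : R * 'rV[R]_n) Phi (s, x).

Definition weak_form (p eps : R) (b m : R -> R) (u1 : 'rV[R]_n -> R)
    u ut (t : R) (Phi : R * 'rV[R]_n -> R) : Prop :=
  \int[leb R n]_x (ut t x * Phi (t, x))
  - eps * \int[leb R n]_x (u1 x * Phi (0, x))
  - \int[lebesgue_measure]_(s in `[0, t])
      \int[leb R n]_x (ut s x * dt Phi s x)
  + \int[lebesgue_measure]_(s in `[0, t])
      \int[leb R n]_x (\sum_(i < n) wgrad (u s) i x * dx i Phi s x)
  + \int[lebesgue_measure]_(s in `[0, t])
      \int[leb R n]_x ((b s * ut s x + m s * u s x) * Phi (s, x))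
  = \int[lebesgue_measure]_(s in `[0, t])
      \int[leb R n]_x (`|ut s x| `^ p * Phi (s, x)).

(* Energy solution on [0, T) of
     u_tt - Laplacian u + b(t) u_t + m(t) u = |u_t|^p,
     u(0) = eps u0, u_t(0) = eps u1,
   with supp u(t) in the ball of radius r + t.  The time derivative ut is taken
   to be a representative that is jointly measurable in (t, x). *)
Definition energy_solution (p r eps : R) (b m : R -> R)
    (u0 u1 : 'rV[R]_n -> R) T u : Prop :=
  (0 < T)%E /\ in_C_H1 T u /\
  exists ut,
    in_C1_L2 T u ut /\
    in_Lp_loc p T ut /\
    (forall t, time_dom T t -> ess_support (u t) `<=` eball (r + t)) /\
    {ae leb R n, forall x, u 0 x = eps * u0 x} /\
    {ae leb R n, forall x, ut 0 x = eps * u1 x} /\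
    (forall t Phi, time_dom T t -> spacetime_test T Phi ->
       weak_form p eps b m u1 u ut t Phi).

(* Supremum of the times up to which the energy solution u on [0, T) can be
   continued as an energy solution. *)
Definition lifespan (p r eps : R) (b m : R -> R)
    (u0 u1 : 'rV[R]_n -> R) T u : \bar R :=
  ereal_sup [set T' | (T <= T')%E /\
    exists v, energy_solution p r eps b m u0 u1 T' v /\
      forall t, time_dom T t -> {ae leb R n, forall x, v t x = u t x}].

End energy_solutions.

Section coefficients.
Context {R : realType}.
Implicit Types (b m : R -> R) (d p t : R).

(* C^1([0, +oo)), with a one-sided derivative at 0 *)
Definition C1_half_line b := exists db : R -> R,
  (forall t, 0 <= t ->
     (b (t + h) - b t) / h @[h --> within [set h | 0 <= t + h] 0^'] --> db t) /\
  {within `[0, +oo[, continuous db}.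

Definition B_int b t : R := \int[lebesgue_measure]_(s in `[0, t]) b s.

(* derive1 is the two-sided derivative; V is only considered for t > 0 *)
Definition V_pot b m t : R := m t - derive1 b t / 2 - b t ^+ 2 / 4.

Definition p_Gla d : \bar R := if d == 1 then +oo%E else (1 + 2 / (d - 1))%:E.

(* (p - 1) / (p_Gla(n) - 1), which is 0 for n = 1 since (+oo)^-1 = 0 *)
Definition Gla_exponent (n : nat) p : R :=
  fine ((p - 1)%:E / (p_Gla n%:R - 1))%E.

Definition H_p (n : nat) p b t : R :=
  \int[lebesgue_measure]_(s in `[1, t])
    (expR (- ((p - 1) / 2) * B_int b s) * (1 + s) `^ (- Gla_exponent n p)).

Definition H_p_inv (n : nat) p b : R -> R :=
  'pinv_(fun=> 1) `[1, +oo[ (H_p n p b).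

End coefficients.

(* Main.v *)
Require Import Defs.
From HB Require Import structures.
From mathcomp Require Import all_boot all_order all_algebra.
From mathcomp Require Import all_classical all_reals all_analysis.
From mathcomp Require Import measurable_realfun ess_sup_inf ring lra.
Set Implicit Arguments.
Unset Strict Implicit.
Unset Printing Implicit Defensive.
Import Order.TTheory GRing.Theory Num.Theory.
Import numFieldNormedType.Exports.
Local Open Scope classical_set_scope.
Local Open Scope ring_scope.

(** Test the equation against the plane wave [e^(k x_0)], truncated outside the
    ball [B_(r+t)] that supports the solution.  Its integral over [B_(r+t)] is
    at most [C e^(kt) (1+t)^((n-1)/2)], the growth of the usual spherical average
    of plane waves, while [U(t) = \int u Psi] satisfies
    [U'' + b U' + (m - k^2) U = \int |u_t|^p Psi].
    With [w = e^(B/2 - kt)] and [alpha = w (U' + (b/2 + k) U)], the substitution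
    behind the potential [V] turns this into
    [alpha(t) - alpha(s) >= \int_s^t (w \int |u_t|^p Psi - w V U)].
    Since [V] is integrable, a large frequency [k] makes the potential term at
    most a tenth of [max alpha], forces [w U' >= alpha / 10] for [t >= 1], and
    makes [alpha(0)] positive, of size [eps].  By Jensen,
    [alpha(t) >= c eps + c \int_1^t h alpha^p] where [h] is the integrand of
    [H_p], and this bounds [H_p(t)] by [C eps^(-(p-1))] as long as the solution
    exists. *)

(** * Blow-up of a differential inequality *)

(** With [y = e^(B/2) U] the tested equation reads [y'' - k^2 y = e^(B/2) \int |u_t|^p Psi - V y].
    The left side factors as [(d/dt - k)(d/dt + k) y], and [alpha = e^(-kt) (y' + k y)] integrates
    the outer factor, so [U] enters its derivative only through [V]. The frequency [k] depends on
    the coefficients alone: [alpha 0] is then linear in [eps], and integrating [r' >= c h r^p]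
    produces the power [eps^(-(p-1))].

    Two obstacles shape the argument. The source is only integrable in time, so [P = U'] satisfies
    an integral identity and offers no derivative to work with; the source is replaced by a
    continuous minorant [K], and the weighted inequality is drawn from the monotonicity of [P - S]
    with [S] differentiable. No sign of [u] or [u_t] is known at positive times, so [alpha] is
    compared with the maximum of its own modulus.

    The truncation radius [r + tau] grows with the time horizon, while the constants must not: the
    source at time [s] is estimated on [B_(r+s)], and for the data, supported in [B_r], the
    truncation radius is brought back to [r]. *)

Section calculus.
Context {R : realType}.
Implicit Types (f g : R -> R) (a b s t : R).

Lemma derive_ge0_le f f' a b : (forall x, a <= x <= b -> {for x, continuous f}) ->
  (forall x, a < x < b -> is_derive x 1 f (f' x)) ->
  (forall x, a < x < b -> 0 <= f' x) ->
  forall s t, a <= s -> s <= t -> t <= b -> f s <= f t.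
Proof.
move=> cf df f0 s t sa st tb.
move: (st); rewrite le_eqVlt => /predU1P[->|{}st]; first exact: lexx.
have [||d dst E] := @MVT R f f' s t st.
- move=> x; rewrite in_itv/= => /andP[sx xt]; apply: df.
  by rewrite (le_lt_trans sa sx) (lt_le_trans xt tb).
- apply: continuous_in_subspaceT => x; rewrite inE/= in_itv/= => /andP[sx xt].
  by apply: cf; lra.
move: dst; rewrite in_itv/= => /andP[sd dt].
rewrite -subr_ge0 E mulr_ge0//; first by apply: f0; lra.
by lra.
Qed.

(* The defect of [A] from monotonicity is quadratic on short intervals, so it vanishes under subdivision. *)
Lemma nondecreasing_of_defect (A Q : R -> R) (L : R) a b : 0 <= L ->
  (forall s t, a <= s -> s <= t -> t <= b -> Q s <= Q t) ->
  (forall s t, a <= s -> s <= t -> t <= b ->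
     - (L * (t - s) * (Q t - Q s)) <= A t - A s) ->
  forall s t, a <= s -> s <= t -> t <= b -> A s <= A t.
Proof.
move=> L0 Qm dA s t sa st tb.
(* Over [N+1] equal steps of length [h] the defects telescope to [L h (Q t - Q s)]. The bound is
   kept multiplied by [N+1], so that the Archimedean property contradicts [A t < A s]. *)
have key (N : nat) : - (L * (t - s) * (Q t - Q s)) <= N.+1%:R * (A t - A s).
  pose h := (t - s) / N.+1%:R.
  have h0 : 0 <= h by rewrite divr_ge0// subr_ge0.
  have tE : t = s + N.+1%:R * h by rewrite /h mulrC divfK ?pnatr_eq0//; lra.
  have H (j : nat) : (j <= N.+1)%N ->
      - (L * h * (Q (s + j%:R * h) - Q s)) <= A (s + j%:R * h) - A s.
    elim: j => [_|j IH jN]; first by rewrite !mul0r addr0 !subrr mulr0 oppr0.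
    have {}IH := IH (ltnW jN).
    have e : s + j.+1%:R * h = s + j%:R * h + h by rewrite -natr1; ring.
    have jh0 : 0 <= j%:R * h by rewrite mulr_ge0.
    have jt : s + j.+1%:R * h <= t.
      by rewrite [leRHS]tE lerD2l ler_wpM2r// ler_nat.
    have := dA (s + j%:R * h) (s + j.+1%:R * h).
    rewrite e in jt *.
    have -> : s + j%:R * h + h - (s + j%:R * h) = h by ring.
    move=> H1; have {H1} := H1 ltac:(lra) ltac:(lra) (le_trans jt tb).
    lra.
  have := H N.+1 (leqnn _); rewrite -tE.
  have -> : L * (t - s) * (Q t - Q s) = N.+1%:R * (L * h * (Q t - Q s)).
    have -> : t - s = N.+1%:R * h by move: tE; set x := _ * h; lra.
    by ring.
  by move=> H'; rewrite -mulrN; apply: ler_wpM2l => //; rewrite ler0n.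
rewrite leNgt; apply/negP => At.
have d0 : 0 < A s - A t by rewrite subr_gt0.
have [N Nd] : exists N : nat, L * (t - s) * (Q t - Q s) / (A s - A t) < N%:R.
  by exists (Num.trunc (L * (t - s) * (Q t - Q s) / (A s - A t))).+1; exact: truncnS_gt.
have := key N; rewrite -[A t - A s]opprB mulrN lerN2.
apply/negP; rewrite -ltNge.
rewrite ltr_pdivrMr// in Nd; apply: (lt_le_trans Nd).
by rewrite ler_pM2r// ler_nat.
Qed.

End calculus.

(** * Monotonicity of the weighted quantity without a derivative of [P] *)

Section weighted.
Context {R : realType}.
Implicit Types s t x : R.
Variables (U P b m v B K S I : R -> R) (k tau : R).
Hypotheses (cU : continuous U) (cP : continuous P) (cb : continuous b).
Hypotheses (cB : continuous B) (cS : continuous S) (cI : continuous I).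
Let w t := expR (B t / 2 - k * t).
Let alpha t := w t * (P t + (b t / 2 + k) * U t).
Hypothesis dU : forall t, 0 < t < tau -> is_derive t 1 U (P t).
Hypothesis dB : forall t, 0 < t < tau -> is_derive t 1 B (b t).
(** The definition [v = m - b'/2 - b^2/4] of the potential, solved for [b']. *)
Hypothesis db : forall t, 0 < t < tau ->
  is_derive t 1 b (2 * (m t - v t) - b t ^+ 2 / 2).
Hypothesis dS : forall t, 0 < t < tau ->
  is_derive t 1 S (K t - b t * P t - (m t - k ^+ 2) * U t).
Hypothesis dI : forall t, 0 < t < tau ->
  is_derive t 1 I (w t * K t - w t * v t * U t).
(** Increment form of [P' >= K - b P - (m - k^2) U], which is what an integral identity yields for a
    merely continuous [P]. *)
Hypothesis PS : forall s t, 0 <= s -> s <= t -> t <= tau ->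
  S t - S s <= P t - P s.

Let cw : continuous w.
Proof.
move=> t; apply: (@continuous_comp _ _ _ (fun t => B t / 2 - k * t) expR).
  apply: cvgB; first by apply: cvgMl; exact: cB.
  by apply: cvgMr; exact: cvg_id.
exact: continuous_expR.
Qed.

Let dw t : 0 < t < tau -> is_derive t 1 w (w t * (b t / 2 - k)).
Proof.
move=> t0; have ? := dB t0.
rewrite /w; apply: is_derive_eq.
rewrite ?scaler0 /GRing.scale/=; ring.
Qed.

(** With [Q = P - S] nondecreasing and [J] differentiable, [alpha - I = w Q + J] and [J' = - w' Q],
    so formally [d(alpha - I) = w dQ >= 0]. As [Q] need not be differentiable, the product rule is
    replaced by a defect bound on each subinterval. *)
Lemma weighted_le s t : 0 <= s -> s <= t -> t <= tau ->
  I t - I s <= alpha t - alpha s.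
Proof.
pose Q t := P t - S t.
pose J t := w t * (S t + (b t / 2 + k) * U t) - I t.
pose A t := alpha t - I t.
have Qm x y : 0 <= x -> x <= y -> y <= tau -> Q x <= Q y.
  by move=> x0 xy yt; have := PS x0 xy yt; rewrite /Q; lra.
have cJ : continuous J.
  move=> x; apply: cvgB; last exact: cI.
  apply: cvgM; first exact: cw.
  apply: cvgD; first exact: cS.
  apply: cvgM; last exact: cU.
  by apply: cvgD; [apply: cvgMl; exact: cb|exact: cvg_cst].
have dJ x : 0 < x < tau -> is_derive x 1 J (- (w x * (b x / 2 - k) * Q x)).
  move=> x0; have ? := dw x0; have ? := dU x0; have ? := db x0.
  have ? := dS x0; have ? := dI x0.
  rewrite /J; apply: is_derive_eq.
  rewrite ?scaler0 /GRing.scale/= /Q; by field.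
move=> s0 st tt.
have tau0 : 0 <= tau := le_trans s0 (le_trans st tt).
have [c _ cmax] : exists2 c, c \in `[0, tau] &
    forall x, x \in `[0, tau] -> `|w x * (b x / 2 - k)| <= `|w c * (b c / 2 - k)|.
  apply: (EVT_max tau0); apply: continuous_subspaceT => x.
  apply: (@continuous_comp _ _ _ (fun x => w x * (b x / 2 - k)) Num.norm);
    last exact: norm_continuous.
  apply: cvgM; first exact: cw.
  by apply: cvgD; [apply: cvgMl; exact: cb|exact: cvg_cst].
(* [L] is the maximum of [|w'|] on [[0, tau]]. *)
set L := `|w c * _| in cmax.
suff : A s <= A t by rewrite /A; lra.
apply: (@nondecreasing_of_defect _ A Q L 0 tau) => //; first by rewrite /L.
move=> {s t s0 st tt} s t s0 st tt.
have AE x : A x = w x * Q x + J x by rewrite /A /alpha /Q /J; ring.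
(* Freezing [Q] at [s] writes [A t - A s] as [w t (Q t - Q s)] plus the increment of [J + Q s w].
   The latter has derivative [w' (Q s - Q x) >= - L (Q t - Q s)], which the linear term of [M]
   compensates. *)
pose M x := J x + Q s * w x + L * (Q t - Q s) * x.
suff MM : M s <= M t.
  have : 0 <= w t * (Q t - Q s).
    by rewrite mulr_ge0 ?expR_ge0// subr_ge0; exact: Qm.
  by rewrite !AE; move: MM; rewrite /M; lra.
apply: (@derive_ge0_le _ M (fun x => w x * (b x / 2 - k) * (Q s - Q x) + L * (Q t - Q s)) s t) => //.
- move=> x _; apply: cvgD; last by apply: cvgMr; exact: cvg_id.
  by apply: cvgD; [exact: cJ|apply: cvgMr; exact: cw].
- move=> x xst; have x0 : 0 < x < tau by lra.
  have ? := dJ _ x0; have ? := dw x0.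
  rewrite /M; apply: is_derive_eq.
  rewrite ?scaler0 /GRing.scale/=; ring.
- move=> x xst. 
  have Qx1 : Q s <= Q x by apply: Qm; lra.
  have Qx2 : Q x <= Q t by apply: Qm; lra.
  have := cmax x; rewrite in_itv/= => /(_ ltac:(lra)); rewrite ler_norml => /andP[_ H].
  have L0 : 0 <= L by rewrite /L.
  have : w x * (b x / 2 - k) * (Q x - Q s) <= L * (Q t - Q s).
    apply: (@le_trans _ _ (L * (Q x - Q s))); first by apply: ler_wpM2r => //; lra.
    by apply: ler_wpM2l => //; lra.
  lra.
Qed.

End weighted.

(** * Lower bounds for [alpha] and comparison with [r' = c h r^p] *)

Section blowup.
Context {R : realType}.
Implicit Types s t x : R.
Variables (U P b v w alpha K I h Ih H Nv : R -> R) (k p c Vtot tau : R).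
Hypotheses (cU : continuous U) (cP : continuous P) (cb : continuous b).
Hypotheses (cw : continuous w) (cI : continuous I) (cIh : continuous Ih).
Hypotheses (cH : continuous H) (cNv : continuous Nv).
Hypothesis w_gt0 : forall t, 0 < w t.
Hypothesis alphaE : forall t, alpha t = w t * (P t + (b t / 2 + k) * U t).
Hypotheses (tau1 : 1 <= tau) (k30 : 30 <= k) (p1 : 1 < p) (c0 : 0 < c).
Hypothesis bk : forall t, 0 <= t <= tau -> `|b t| <= k.
Hypothesis dU : forall t, 0 < t < tau -> is_derive t 1 U (P t).
Hypothesis dw : forall t, 0 < t < tau -> is_derive t 1 w (w t * (b t / 2 - k)).
Hypothesis dI : forall t, 0 < t < tau ->
  is_derive t 1 I (w t * K t - w t * v t * U t).
Hypothesis dIh : forall t, 0 < t < tau -> is_derive t 1 Ih (h t * `|alpha t| `^ p).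
Hypothesis dH : forall t, 0 < t < tau -> is_derive t 1 H (h t).
Hypothesis dNv : forall t, 0 < t < tau -> is_derive t 1 Nv `|v t|.
Hypothesis aI : forall s t, 0 <= s -> s <= t -> t <= tau ->
  I t - I s <= alpha t - alpha s.
Hypotheses (w0 : w 0 = 1) (U0 : 0 <= U 0) (P0 : 0 <= P 0).
Hypothesis a0 : 0 < alpha 0.
Hypotheses (NvV : Nv tau - Nv 0 <= Vtot) (Vk : 25 * Vtot <= k).
Hypothesis h0 : forall t, 0 < t < tau -> 0 <= h t.
Hypothesis K0 : forall t, 0 < t < tau -> 0 <= K t.
Hypothesis Kh : forall t, 1 <= t < tau -> 0 <= alpha t ->
  alpha t / 10 <= w t * P t -> c * h t * `|alpha t| `^ p <= w t * K t.

Let calpha : continuous alpha.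
Proof.
have -> : alpha = fun t => w t * (P t + (b t / 2 + k) * U t) by apply/funext.
move=> x; apply: cvgM; first exact: cw.
apply: cvgD; first exact: cP.
apply: cvgM; last exact: cU.
by apply: cvgD; [apply: cvgMl; exact: cb|exact: cvg_cst].
Qed.

Let Nv_le s t : 0 <= s -> s <= t -> t <= tau -> Nv s <= Nv t.
Proof.
apply: (@derive_ge0_le _ Nv (fun t => `|v t|)) => //.
by move=> x _; exact: cNv.
Qed.

(** [|b 0| <= k] gives [b 0 / 2 + k >= k / 2]. This trades [U 0] for [alpha 0], hence for the
    maximum of [|alpha|], in the estimates below. *)
Let U0a : (k / 2) * U 0 <= alpha 0.
Proof.
rewrite alphaE w0 mul1r.
have := bk (t := 0); rewrite lexx (le_trans ler01 tau1) => /(_ isT).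
rewrite ler_norml => /andP[b1 _].
have : 0 <= (k / 2 + b 0 / 2) * U 0 by rewrite mulr_ge0//; lra.
by move: P0; lra.
Qed.

(* [e^(kt) e^(B/2) U] has derivative [e^(2kt) alpha]. *)
Let wU_bound t beta : 0 <= t -> t <= tau ->
  (forall s, 0 <= s <= t -> `|alpha s| <= beta) ->
  `|w t * U t| <= expR (- (2 * k * t)) * U 0 + beta / (2 * k).
Proof.
move=> t0 tt ab.
have kp : 0 < k by move: k30; lra.
pose E x := expR (2 * k * x).
have Ep x : 0 < E x by exact: expR_gt0.
have cE : continuous E.
  move=> x; apply: (@continuous_comp _ _ _ ( *%R (2 * k)) expR).
    exact: mulrl_continuous.
  exact: continuous_expR.
have dE x : is_derive x 1 E (2 * k * E x).
  rewrite /E; apply: is_derive_eq.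
  rewrite ?scaler0 /GRing.scale/=; ring.
pose Y x := E x * (w x * U x).
have cY : continuous Y.
  by move=> x; apply: cvgM; [exact: cE|apply: cvgM; [exact: cw|exact: cU]].
have dY x : 0 < x < tau -> is_derive x 1 Y (E x * alpha x).
  move=> xt; have ? := dU xt; have ? := dw xt; have ? := dE x.
  rewrite /Y; apply: is_derive_eq.
  rewrite ?scaler0 /GRing.scale/= alphaE.
  move: (E x) (w x) (U x) (P x) (b x) => e0 w0' u0 p0 b0; by field.
have b0 : 0 <= beta.
  by apply: (le_trans _ (ab 0 _)) => //; rewrite lexx.
have E0 : E 0 = 1 by rewrite /E mulr0 expR0.
have EV x : expR (- (2 * k * x)) * E x = 1 by rewrite /E -expRD addNr expR0.
have YE x : Y x = E x * (w x * U x) by [].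
clearbody Y E.
(* [beta / (2 k) E] is a primitive of [beta E], which dominates [|Y'| = E |alpha|]; both signs of
   [Y] are compared with it. *)
have upper : Y t <= U 0 + beta / (2 * k) * E t.
  have : beta / (2 * k) * E 0 - Y 0 <= beta / (2 * k) * E t - Y t.
    apply: (@derive_ge0_le _ (fun x => beta / (2 * k) * E x - Y x)
      (fun x => E x * (beta - alpha x)) 0 t _ _ _ 0 t (lexx _) t0 (lexx _)).
    - move=> x _; apply: cvgB; last exact: cY.
      by apply: cvgMr; exact: cE.
    - move=> x xt; have ? : is_derive x 1 Y (E x * alpha x) by apply: dY; lra.
      apply: is_derive_eq; rewrite ?scaler0 /GRing.scale/=; field.
      by rewrite gt_eqF.
    - move=> x xt; rewrite mulr_ge0 ?(ltW (Ep _))//.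
      have : `|alpha x| <= beta by apply: ab; lra.
      by rewrite ler_norml => /andP[_]; lra.
  rewrite E0 (YE 0) E0 w0 !mul1r.
  have : 0 <= beta / (2 * k) by rewrite divr_ge0//; lra.
  lra.
have lower : - (U 0 + beta / (2 * k) * E t) <= Y t.
  have : beta / (2 * k) * E 0 + Y 0 <= beta / (2 * k) * E t + Y t.
    apply: (@derive_ge0_le _ (fun x => beta / (2 * k) * E x + Y x)
      (fun x => E x * (beta + alpha x)) 0 t _ _ _ 0 t (lexx _) t0 (lexx _)).
    - move=> x _; apply: cvgD; last exact: cY.
      by apply: cvgMr; exact: cE.
    - move=> x xt; have ? : is_derive x 1 Y (E x * alpha x) by apply: dY; lra.
      apply: is_derive_eq; rewrite ?scaler0 /GRing.scale/=; field.
      by rewrite gt_eqF.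
    - move=> x xt; rewrite mulr_ge0 ?(ltW (Ep _))//.
      have : `|alpha x| <= beta by apply: ab; lra.
      by rewrite ler_norml => /andP[]; lra.
  rewrite E0 (YE 0) E0 w0 !mul1r.
  have : 0 <= beta / (2 * k) by rewrite divr_ge0//; lra.
  by move: U0; lra.
have -> : w t * U t = (E t)^-1 * Y t by rewrite YE mulKf// gt_eqF.
rewrite normrM gtr0_norm ?invr_gt0//.
rewrite mulrC ler_pdivrMr// mulrDl.
have -> : expR (- (2 * k * t)) * U 0 * E t = U 0.
  by rewrite mulrAC EV mul1r.
by rewrite ler_norml upper lower.
Qed.

(** The factor 5: [U 0 <= 2 alpha 0 / k <= 4 beta / (2 k)] by [U0a], and [wU_bound] adds one more
    [beta / (2 k)]. *)
Let wU_bound0 t beta : 0 <= t -> t <= tau ->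
  (forall s, 0 <= s <= t -> `|alpha s| <= beta) ->
  `|w t * U t| <= 5 * beta / (2 * k).
Proof.
move=> t0 tt ab; have kp : 0 < k by move: k30; lra.
apply: (le_trans (wU_bound t0 tt ab)).
have : expR (- (2 * k * t)) * U 0 <= 1 * U 0.
  by rewrite ler_wpM2r// expR_le1 oppr_le0 mulr_ge0//; lra.
have : alpha 0 <= beta by apply: (le_trans (ler_norm _)); apply: ab; rewrite lexx.
rewrite mul1r => ab0 UU; apply: (le_trans (lerD UU (lexx _))).
rewrite -(ler_pM2r (_ : 0 < 2 * k)); last by lra.
rewrite mulrDl !divfK; last 2 first.
- by rewrite gt_eqF//; lra.
- by rewrite gt_eqF//; lra.
by move: U0a; lra.
Qed.

(* The forcing is nonnegative and the potential term is dominated by [theta beta], [theta <= 1/10]. *)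
Let alpha_incr beta s t : 0 <= s -> s <= t -> t <= tau ->
  (forall x, 0 <= x <= t -> `|alpha x| <= beta) ->
  - (beta / 10) <= alpha t - alpha s.
Proof.
move=> s0 st tt ab; have kp : 0 < k by move: k30; lra.
have b0 : 0 <= beta by apply: le_trans (ab t _); rewrite // lexx (le_trans s0).
pose d := 5 * beta / (2 * k).
have d0 : 0 <= d by rewrite /d divr_ge0// mulr_ge0//; lra.
(* [Nv] is a primitive of [|v|], so adding [d Nv] absorbs the potential term of [I'], because
   [|w U| <= d]. *)
have IN : I s + d * Nv s <= I t + d * Nv t.
  apply: (@derive_ge0_le _ (fun x => I x + d * Nv x)
      (fun x => w x * K x - w x * v x * U x + d * `|v x|) 0 t _ _ _ s t s0 st (lexx _)).
  - by move=> x _; apply: cvgD; [exact: cI|apply: cvgMr; exact: cNv].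
  - move=> x xt; have xtau : 0 < x < tau by lra.
    have ? := dI xtau; have ? := dNv xtau.
    by apply: is_derive_eq; rewrite ?scaler0 /GRing.scale/=; ring.
  - move=> x xt; have xtau : 0 < x < tau by lra.
    have wK : 0 <= w x * K x by apply: mulr_ge0; [exact: ltW|exact: K0].
    have wU : `|w x * U x| <= d.
      apply: wU_bound0; [lra|lra|move=> y yx; apply: ab; lra].
    have : `|v x * (w x * U x)| <= d * `|v x|.
      by rewrite normrM mulrC ler_wpM2r.
    rewrite ler_norml => /andP[_ H1].
    have -> : w x * v x * U x = v x * (w x * U x) by ring.
    lra.
have H1 := aI s0 st tt.
have N1 : Nv t - Nv s <= Vtot.
  have := @Nv_le 0 s (lexx _) s0 (le_trans st tt).
  have := @Nv_le t tau (le_trans s0 st) tt (lexx _).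
  by move: NvV; lra.
(* The 25 in [Vk] is made for this product: [5 beta / (2 k)] times [k / 25] is [beta / 10]. *)
have : d * (Nv t - Nv s) <= beta / 10.
  apply: (@le_trans _ _ (d * (k / 25))).
    by apply: ler_wpM2l => //; move: Vk; lra.
  rewrite /d; have -> : 5 * beta / (2 * k) * (k / 25) = beta / 10.
    by field; rewrite gt_eqF.
  exact: lexx.
lra.
Qed.

(** Take for [beta] the maximum of [|alpha|] on [[0, t]], attained at [c']. From [alpha 0 > 0] the
    function loses at most [beta / 10] up to [c'], which excludes [alpha c' = - beta]; hence
    [alpha c' = beta], and at most another [beta / 10] is lost between [c'] and [t]. *)
Let alpha_ge t : 0 <= t -> t <= tau -> exists beta,
  [/\ forall x, 0 <= x <= t -> `|alpha x| <= beta, 0 < beta &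
      9 / 10 * beta <= alpha t].
Proof.
move=> t0 tt.
have [c' ct cmax] : exists2 c, c \in `[0, t] &
    forall x, x \in `[0, t] -> `|alpha x| <= `|alpha c|.
  apply: (EVT_max t0); apply: continuous_subspaceT => x.
  apply: (@continuous_comp _ _ _ alpha Num.norm); last exact: norm_continuous.
  exact: calpha.
have ab x : 0 <= x <= t -> `|alpha x| <= `|alpha c'|.
  by move=> xt; apply: cmax; rewrite in_itv.
have /andP[c0' c't] : 0 <= c' <= t by move: ct; rewrite in_itv.
have ba : alpha 0 <= `|alpha c'|.
  by apply: (le_trans (ler_norm _)); apply: ab; rewrite lexx.
have I1 := alpha_incr c0' c't tt ab.
have I2 : - (`|alpha c'| / 10) <= alpha c' - alpha 0.
  apply: alpha_incr => //; first exact: le_trans tt.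
  by move=> x xc; apply: ab; lra.
have A0 := a0.
exists `|alpha c'|; split => //; first exact: lt_le_trans ba.
move: I1 I2 ba; case: (lerP 0 (alpha c')) => [/ger0_norm ->|ac]; first lra.
by rewrite (ltr0_norm ac); lra.
Qed.

(** In [w P = alpha - (b/2 + k) w U] the last term is at most [3k/2 (U 0 / 60 + beta / (2k)) <=
    (1/20 + 3/4) beta], and [alpha >= 9/10 beta] leaves exactly [beta / 10]. The time [t >= 1] and
    [k >= 30] are what make [e^(-2kt) <= 1/60]. *)
Let alpha_wP t : 1 <= t -> t <= tau -> alpha t / 10 <= w t * P t.
Proof.
move=> t1 tt; have kp := k30.
have t0 : 0 <= t by lra.
have [beta [ab b0 ba]] := alpha_ge t0 tt.
have -> : w t * P t = alpha t - (b t / 2 + k) * (w t * U t).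
  by rewrite alphaE; ring.
have atb : alpha t <= beta.
  by apply: (le_trans (ler_norm _)); apply: ab; rewrite lexx t0.
have : `|b t| <= k by apply: bk; rewrite t0.
rewrite ler_norml => /andP[b1 b2].
have e60 : expR (- (2 * k * t)) <= 1 / 60.
  rewrite expRN -div1r ler_pdivrMr ?expR_gt0//.
  have := expR_ge1Dx (2 * k * t).
  have : 30 * 1 <= k * t by apply: ler_pM.
  lra.
have wU : w t * U t <= 1 / 60 * U 0 + beta / (2 * k).
  apply: (le_trans (ler_norm _)); apply: (le_trans (wU_bound t0 tt ab)).
  by rewrite lerD2r ler_wpM2r.
have ab0 : alpha 0 <= beta.
  by apply: (le_trans (ler_norm _)); apply: ab; rewrite lexx.
have : (b t / 2 + k) * (w t * U t) <= (3 / 2 * k) * (1 / 60 * U 0 + beta / (2 * k)).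
  apply: (@le_trans _ _ ((b t / 2 + k) * (1 / 60 * U 0 + beta / (2 * k)))).
    by apply: ler_wpM2l => //; lra.
  apply: ler_wpM2r; last by lra.
  by rewrite addr_ge0 ?divr_ge0//; [rewrite mulr_ge0|lra|lra].
have -> : (3 / 2 * k) * (1 / 60 * U 0 + beta / (2 * k)) =
    1 / 20 * ((k / 2) * U 0) + 3 / 4 * beta.
  by field; rewrite gt_eqF//; lra.
move: U0a; lra.
Qed.

(** Since [r <= alpha], [r' = c/2 h alpha^p >= c/2 h r^p], so [- r^(1-p) - (p-1) c/2 H] is
    nondecreasing on [[1, tau]]. Discarding [r(tau)^(1-p) >= 0] leaves the value of [r^(1-p)] at 1
    as the bound. *)
Lemma blowup_bound : H tau - H 1 <= (alpha 0 / 4) `^ (1 - p) / ((p - 1) * (c / 2)).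
Proof.
have A0 := a0; have p1' := p1; have c0' := c0.
(* The constants leave room: [alpha t >= alpha 1 + c (Ih t - Ih 1) - beta / 10] with
   [beta <= 10/9 alpha t] and [alpha 1 >= 9/10 alpha 0] give [alpha t >= 81/100 alpha 0 + 9/10 c (Ih
   t - Ih 1)]. *)
pose r t := alpha 0 / 4 + c / 2 * (Ih t - Ih 1).
have tau0 : 0 < tau by move: tau1; lra.
have Ih_le s t : 1 <= s -> s <= t -> t <= tau -> Ih s <= Ih t.
  apply: (@derive_ge0_le _ Ih (fun t => h t * `|alpha t| `^ p) 1 tau).
  - by move=> x _; exact: cIh.
  - by move=> x xt; apply: dIh; lra.
  - by move=> x xt; rewrite mulr_ge0 ?powR_ge0// h0//; lra.
have r_gt0 t : 1 <= t -> t <= tau -> 0 < r t.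
  move=> t1 tt; rewrite /r ltr_pwDl ?divr_gt0// mulr_ge0 ?subr_ge0 ?Ih_le//.
  by lra.
have r_le t : 1 <= t -> t <= tau -> r t <= alpha t.
  move=> t1 tt; have t0 : 0 <= t by lra.
  have [beta [ab b0 ba]] := alpha_ge t0 tt.
  pose d := 5 * beta / (2 * k).
  have kp : 0 < k by move: k30; lra.
  have d0 : 0 <= d by rewrite /d divr_ge0// mulr_ge0//; lra.
  have IN : I 1 - c * Ih 1 + d * Nv 1 <= I t - c * Ih t + d * Nv t.
    apply: (@derive_ge0_le _ (fun x => I x - c * Ih x + d * Nv x)
      (fun x => w x * K x - w x * v x * U x - c * (h x * `|alpha x| `^ p) + d * `|v x|) 1 t _ _ _ 1 t (lexx _) t1 (lexx _)).
    - move=> x _; apply: cvgD; last by apply: cvgMr; exact: cNv.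
      by apply: cvgB; [exact: cI|apply: cvgMr; exact: cIh].
    - move=> x xt; have xtau : 0 < x < tau by lra.
      have ? := dI xtau; have ? := dNv xtau; have ? := dIh xtau.
      by apply: is_derive_eq; rewrite ?scaler0 /GRing.scale/=; ring.
    - move=> x xt; have xtau : 0 < x < tau by lra.
      have wK : c * h x * `|alpha x| `^ p <= w x * K x.
        apply: Kh; [lra| |apply: alpha_wP; lra].
        have [||bx [_ bx0 bxa]] := @alpha_ge x; lra.
      have wU : `|w x * U x| <= d.
        apply: wU_bound0; [lra|lra|move=> y yx; apply: ab; lra].
      have : `|v x * (w x * U x)| <= d * `|v x|.
        by rewrite normrM mulrC ler_wpM2r.
      rewrite ler_norml => /andP[_ H1].
      have -> : w x * v x * U x = v x * (w x * U x) by ring.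
      lra.
  have H1 := aI ler01 t1 tt.
  have N1 : Nv t - Nv 1 <= Vtot.
    have := @Nv_le 0 1 (lexx _) ler01 tau1.
    have := @Nv_le t tau t0 tt (lexx _).
    by move: NvV; lra.
  have : d * (Nv t - Nv 1) <= beta / 10.
    apply: (@le_trans _ _ (d * (k / 25))).
      by apply: ler_wpM2l => //; move: Vk; lra.
    rewrite /d; have -> : 5 * beta / (2 * k) * (k / 25) = beta / 10.
      by field; rewrite gt_eqF.
    exact: lexx.
  have ab0 : alpha 0 <= beta.
    by apply: (le_trans (ler_norm _)); apply: ab; rewrite lexx.
  have [b1 [ab1 b10 ba1]] := alpha_ge ler01 tau1.
  have a01 : alpha 0 <= b1.
    by apply: (le_trans (ler_norm _)); apply: ab1; rewrite lexx ler01.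
  have : 0 <= c * (Ih t - Ih 1).
    by rewrite mulr_ge0 ?subr_ge0 ?Ih_le// ltW.
  rewrite /r; lra.
have cr : continuous r.
  by move=> x; apply: cvgD; [exact: cvg_cst|apply: cvgMr; apply: cvgB; [exact: cIh|exact: cvg_cst]].
have : - (r 1 `^ (1 - p)) - (p - 1) * (c / 2) * H 1 <=
       - (r tau `^ (1 - p)) - (p - 1) * (c / 2) * H tau.
  apply: (@derive_ge0_le _ (fun x => - (r x `^ (1 - p)) - (p - 1) * (c / 2) * H x)
    (fun x => (p - 1) * (c / 2) * h x * (r x `^ (- p) * `|alpha x| `^ p - 1)) 1 tau _ _ _ 1 tau (lexx _) tau1 (lexx _)).
  - move=> x xt; have cN : {for x, continuous ((fun y : R => - (y `^ (1 - p))) \o r)}.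
      apply: continuous_comp; first exact: cr.
      apply: differentiable_continuous; apply/derivable1_diffP; apply: derivableN.
      by apply: derivable_powR; rewrite in_itv/= andbT r_gt0//; lra.
    apply: cvgB; first exact: cN.
    by apply: cvgMr; exact: cH.
  - move=> x xt; have xtau : 0 < x < tau by lra.
    have ? := dIh xtau; have ? := dH xtau.
    have rx : 0 < r x by apply: r_gt0; lra.
    have dr : is_derive x 1 r (c / 2 * (h x * `|alpha x| `^ p)).
      by rewrite /r; apply: is_derive_eq; rewrite ?scaler0 /GRing.scale/=; ring.
    have : is_derive x 1 (@powR R ^~ (1 - p) \o r)
        ((1 - p) * r x `^ (1 - p - 1) * (c / 2 * (h x * `|alpha x| `^ p))).
      by apply: is_derive1_comp; exact: is_derive1_powR.
    have -> : 1 - p - 1 = - p by ring.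
    move=> ?; have -> : (fun x : R => - (r x `^ (1 - p)) - (p - 1) * (c / 2) * H x) =
      (fun x : R => - ((@powR R ^~ (1 - p) \o r) x) - (p - 1) * (c / 2) * H x) by [].
    by apply: is_derive_eq; rewrite ?scaler0 /GRing.scale/=; ring.
  - move=> x xt; rewrite mulr_ge0//.
      rewrite mulr_ge0//; first by rewrite mulr_ge0//; lra.
      by apply: h0; lra.
    have rx : 0 < r x by apply: r_gt0; lra.
    rewrite powRN subr_ge0 ler_pdivlMl ?powR_gt0// mulr1.
    have ra : r x <= `|alpha x| by apply: le_trans (ler_norm _); apply: r_le; lra.
    by apply: ge0_ler_powR; rewrite ?nnegrE ?(ltW rx)//; lra.
have -> : r 1 = alpha 0 / 4 by rewrite /r subrr mulr0 addr0.
have := powR_ge0 (r tau) (1 - p).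
have pc : 0 < (p - 1) * (c / 2) by rewrite mulr_gt0//; lra.
rewrite ler_pdivlMr//; lra.
Qed.

End blowup.

(** * Smooth cutoffs *)

Section Ck.
Context {R : realType}.

(** [smooth] quantifies over lists of directions, which suits neither products nor composition.
    Recursion on the order of differentiability turns the Leibniz and quotient rules into plain
    inductions. *)
Fixpoint Ck (V : normedModType R) (n : nat) (f : V -> R) : Prop :=
  (forall x, differentiable f x) /\
  if n is n'.+1 then forall v, Ck n' ('D_v f : V -> R) else True.

Section basic.
Variable V : normedModType R.
Implicit Types (f g : V -> R) (n : nat).

Lemma CkW n f : Ck n.+1 f -> Ck n f.
Proof.
elim: n f => [f [df _]|n IH f [df Df]]; first by split.
by split => // v; exact: IH (Df v).
Qed.

Lemma smooth_Ck f : smooth f -> forall n, Ck n f.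
Proof.
move=> sf n; elim: n f sf => [f sf|n IH f sf]; split => //; try exact: (sf [::]).
move=> v; apply: IH => s x.
(* [foldr] differentiates along the last entry of the list first, so the new direction is appended
   at the end. *)
by have := sf (rcons s v) x; rewrite foldr_rcons.
Qed.

Lemma Ck_smooth f : (forall n, Ck n f) -> smooth f.
Proof.
move=> Cf s; move: (Cf (size s)) => {Cf}.
elim/last_ind: s f => [f [df _] //|s v IH f].
by rewrite size_rcons foldr_rcons => -[_ /(_ v)]; exact: IH.
Qed.

Lemma smooth_derive f v : smooth f -> smooth ('D_v f : V -> R).
Proof.
move=> sf; apply: Ck_smooth => n.
by have [_] := smooth_Ck sf n.+1; exact.
Qed.

Lemma smooth_differentiable f x : smooth f -> differentiable f x.
Proof. by move=> sf; exact: (sf [::]). Qed.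

Lemma Ck_cst n (a : R) : Ck n (cst a : V -> R).
Proof.
elim: n a => [|n IH] a; split => //; try (by move=> x; exact: differentiable_cst).
move=> v; rewrite (_ : 'D_v _ = cst 0); first exact: IH.
by apply/funext => x; rewrite derive_cst.
Qed.

Lemma CkD n f g : Ck n f -> Ck n g -> Ck n (f \+ g).
Proof.
elim: n f g => [|n IH] f g [df Cf] [dg Cg]; split => //;
  try (by move=> x; exact: differentiableD).
move=> v; rewrite (_ : 'D_v _ = 'D_v f \+ 'D_v g).
  by apply: IH; [exact: Cf|exact: Cg].
by apply/funext => x; rewrite deriveD//; exact: diff_derivable.
Qed.

Lemma CkM n f g : Ck n f -> Ck n g -> Ck n (f \* g).
Proof.
elim: n f g => [|n IH] f g [df Cf] [dg Cg]; split => //;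
  try (by move=> x; exact: differentiableM).
move=> v; rewrite (_ : 'D_v _ = (f \* 'D_v g) \+ (g \* 'D_v f)); last first.
  by apply/funext => x; rewrite deriveM//; exact: diff_derivable.
by apply: CkD; apply: IH; [apply: CkW; split|exact: Cg|apply: CkW; split|exact: Cf].
Qed.

Lemma CkV n f : (forall x, f x != 0) -> Ck n f -> Ck n (fun x => (f x)^-1).
Proof.
move=> f0.
have dV x : differentiable f x -> differentiable (fun x => (f x)^-1) x.
  by move=> df; exact: (@differentiableV _ _ f x).
elim: n => [|n IH] [df Cf]; split => //; try (by move=> x; exact: dV).
move=> v; rewrite (_ : 'D_v _ =
    cst (-1) \* (((fun x => (f x)^-1) \* (fun x => (f x)^-1)) \* 'D_v f)); last first.
  apply/funext => x; rewrite (@deriveV _ _ f x v)//; last exact: diff_derivable.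
  by rewrite /GRing.scale/= mulN1r mulNr -expr2 exprVn.
have Cf' : Ck n f by apply: CkW; split.
by apply: CkM; [exact: Ck_cst|apply: CkM; [apply: CkM; exact: IH|exact: Cf]].
Qed.

End basic.

(** For affine [phi] with linear part [l], the difference quotients of [f \o phi] along [v] are
    literally those of [f] along [l v]; the identity of derivatives needs no chain rule. *)
Lemma Ck_comp (V W : normedModType R) n (f : W -> R) (phi l : V -> W) :
  (forall x, differentiable phi x) ->
  (forall (h : R) v x, phi (h *: v + x) = h *: l v + phi x) ->
  Ck n f -> Ck n (f \o phi).
Proof.
move=> dphi phiE; elim: n f => [|n IH] f [df Cf]; split => //;
  try (by move=> x; apply: (@differentiable_comp _ _ _ _ phi f x); [exact: dphi|exact: df]).
move=> v; rewrite (_ : 'D_v _ = ('D_(l v) f \o phi)).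
  by apply: IH; exact: Cf.
apply/funext => x; rewrite /derive /=; congr (lim _).
rewrite (_ : (fun h => _) = (fun h : R => h^-1 *: (f (h *: l v + phi x) - f (phi x))))//.
by apply/funext => h /=; rewrite phiE.
Qed.

Section smooth.
Variable V : normedModType R.
Implicit Types (f g : V -> R).

Lemma smooth_cst (a : R) : smooth (cst a : V -> R).
Proof. by apply: Ck_smooth => n; exact: Ck_cst. Qed.

Lemma smoothD f g : smooth f -> smooth g -> smooth (f \+ g).
Proof. by move=> sf sg; apply: Ck_smooth => n; apply: CkD; exact: smooth_Ck. Qed.

Lemma smoothM f g : smooth f -> smooth g -> smooth (f \* g).
Proof. by move=> sf sg; apply: Ck_smooth => n; apply: CkM; exact: smooth_Ck. Qed.

Lemma smoothV f : (forall x, f x != 0) -> smooth f -> smooth (fun x => (f x)^-1).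
Proof. by move=> f0 sf; apply: Ck_smooth => n; apply: CkV => //; exact: smooth_Ck. Qed.

Lemma smooth_prod (I : finType) (F : I -> V -> R) :
  (forall i, smooth (F i)) -> smooth (fun x => \prod_i F i x).
Proof.
move=> sF; elim: (index_enum I) => [|i s IH].
  rewrite (_ : (fun x => _) = cst 1); first exact: smooth_cst.
  by apply/funext => x; rewrite big_nil.
rewrite (_ : (fun x => _) = F i \* (fun x => \prod_(j <- s) F j x)).
  exact: smoothM.
by apply/funext => x; rewrite big_cons.
Qed.

End smooth.

Lemma smooth_comp (V W : normedModType R) (f : W -> R) (phi l : V -> W) :
  (forall x, differentiable phi x) ->
  (forall (h : R) v x, phi (h *: v + x) = h *: l v + phi x) ->
  smooth f -> smooth (f \o phi).
Proof. by move=> d E sf; apply: Ck_smooth => n; apply: (Ck_comp d E); exact: smooth_Ck. Qed.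

Lemma smooth_fst (V W : normedModType R) (f : V -> R) :
  smooth f -> smooth (fun z : V * W => f z.1).
Proof.
apply: (smooth_comp (phi := fst) (l := fst)) => // x.
have fst_lin : linear (fst : V * W -> V) by [].
pose fl := GRing.isLinear.Build _ _ _ _ _ fst_lin.
pose fL : {linear (V * W)%type -> V} := HB.pack (fst : V * W -> V) fl.
have -> : fst = fL by [].
by apply: linear_differentiable => y; exact: cvg_fst.
Qed.

Lemma smooth_snd (V W : normedModType R) (f : W -> R) :
  smooth f -> smooth (fun z : V * W => f z.2).
Proof.
apply: (smooth_comp (phi := snd) (l := snd)) => // x.
have snd_lin : linear (snd : V * W -> W) by [].
pose fl := GRing.isLinear.Build _ _ _ _ _ snd_lin.
pose fL : {linear (V * W)%type -> W} := HB.pack (snd : V * W -> W) fl.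
have -> : snd = fL by [].
by apply: linear_differentiable => y; exact: cvg_snd.
Qed.

Lemma smooth_coord n (i : 'I_n) (f : R -> R) :
  smooth f -> smooth (fun x : 'rV[R]_n => f (x ord0 i)).
Proof.
apply: (smooth_comp (phi := fun x : 'rV[R]_n => x ord0 i : R)
  (l := fun x : 'rV[R]_n => x ord0 i : R)).
  by move=> x; exact: differentiable_coord.
by move=> h v x; rewrite !mxE.
Qed.

Lemma smooth_affine (a c : R) (f : R -> R) :
  smooth f -> smooth (fun x : R => f (a * x + c)).
Proof.
apply: (smooth_comp (phi := fun x : R => a * x + c) (l := fun x : R => a * x)).
  by move=> x; apply: differentiableD.
by move=> h v x; rewrite /GRing.scale/=; ring.
Qed.

Lemma smooth_expR (k : R) : smooth (fun x : R => expR (k * x)).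
Proof.
have dE (x : R) : is_derive x 1 (fun x : R => expR (k * x)) (k * expR (k * x)).
  by apply: is_derive_eq; rewrite ?scaler0 /GRing.scale/=; ring.
have df (x : R) : differentiable (fun x : R => expR (k * x)) x.
  by apply/derivable1_diffP; have [] := dE x.
apply: Ck_smooth => n; elim: n => [|n IH]; split => // v.
rewrite (_ : 'D_v _ = cst (v * k) \* (fun x : R => expR (k * x))).
  by apply: CkM => //; exact: Ck_cst.
apply/funext => x; rewrite deriveE//.
rewrite -[v in LHS]mulr1 -[v * 1]/(v *: 1) linearZ/= -deriveE// derive_val.
by rewrite /GRing.scale/= mulrA.
Qed.

End Ck.

(** * Flat functions and one-dimensional cutoffs *)

Section cutoff.
Context {R : realType}.
Implicit Types (x h a b : R) (j n : nat).

(** The classical [e^(-1/x)] is [flat 0]. The powers [x^(-j)] are carried along because the span of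
    the family is stable under differentiation, as [is_derive_flat] shows. *)
Definition flat j x : R := if 0 < x then x ^- j * expR (- x^-1) else 0.

Lemma flat_ge0 j x : 0 <= flat j x.
Proof.
rewrite /flat; case: ifPn => // x0.
by rewrite mulr_ge0 ?expR_ge0// invr_ge0 exprn_ge0// ltW.
Qed.

Lemma flat_gt0 j x : 0 < x -> 0 < flat j x.
Proof.
by move=> x0; rewrite /flat x0 mulr_gt0 ?expR_gt0// invr_gt0 exprn_gt0.
Qed.

Lemma flat_le0 j x : x <= 0 -> flat j x = 0.
Proof. by move=> x0; rewrite /flat ltNge x0. Qed.

(** A single term of the series of [e^(1/x)] beats [x^(-j)] by two orders; quadratic vanishing is
    enough for the derivative at 0 to be 0. *)
Lemma flat_le j x : flat j x <= (j.+2)`!%:R * x ^+ 2.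
Proof.
have [x0|x0] := ltP 0 x; last first.
  by rewrite flat_le0// mulr_ge0// sqr_ge0.
rewrite /flat x0 expRN -invfM -div1r ler_pdivrMr; last first.
  by rewrite mulr_gt0 ?expR_gt0// exprn_gt0.
have := @expR_ge1Dxn R x^-1 j.+1; rewrite invr_ge0 (ltW x0) => /(_ isT).
move=> le; have {}le : (x^-1) ^+ j.+2 / j.+2`!%:R <= expR x^-1 by lra.
have F0 : 0 < j.+2`!%:R :> R by rewrite ltr0n fact_gt0.
have xj : 0 < x ^+ j.+2 by rewrite exprn_gt0.
rewrite ler_pdivrMr// exprVn in le.
have : 1 <= x ^+ j.+2 * (expR x^-1 * j.+2`!%:R).
  by rewrite -(ler_pM2l xj) divff ?gt_eqF in le.
by rewrite !exprS; lra.
Qed.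

Lemma is_derive_flat j x :
  is_derive x 1 (flat j) (flat j.+2 x - j%:R * flat j.+1 x).
Proof.
have [x0|x0|->] := ltgtP x 0.
- apply: (@near_eq_is_derive _ _ _ (cst 0)).
    near=> y; rewrite flat_le0//; near: y.
    by apply: filterS (lt_nbhsl x0) => y; exact: ltW.
  rewrite !flat_le0 ?ltW// mulr0 subr0.
  exact: is_derive_cst.
- have xn : x != 0 by rewrite gt_eqF.
  have [V [VE dV]] : exists V : R -> R, (forall y, V y = y^-1) /\
      is_derive x 1 V (- x ^- 2).
    exists (fun y => y^-1); split => //.
    have -> : - x ^- 2 = - x ^- 2 *: (1 : R) by rewrite /GRing.scale/= mulr1.
    exact: is_deriveV.
  apply: (@near_eq_is_derive _ _ _ (fun y : R => V y ^+ j * expR (- V y))).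
    near=> y; rewrite /flat ifT ?VE ?exprVn//; near: y.
    exact: lt_nbhsr.
  have dX : is_derive x 1 (fun y => V y ^+ j) ((j%:R * V x ^+ j.-1) *: - x ^- 2).
    rewrite (_ : (fun y => V y ^+ j) = V ^+ j); first exact: is_deriveX.
    by apply/funext => y; rewrite exprfctE.
  have dN : is_derive x 1 (fun y => expR (- V y)) (expR (- V x) * (x ^- 2)).
    apply: (@is_derive1_comp _ expR (- V)).
    by rewrite -[x ^- 2]opprK; exact: is_deriveN.
  apply: is_derive_eq; rewrite VE /flat x0 /GRing.scale/= -!exprVn.
  clear dX; case: j => [|j]; rewrite ?expr0 ?mulr0n ?mul0r ?mulr0 ?exprS /=; ring.
- rewrite !flat_le0// mulr0 subr0.
  have : (fun h => h^-1 *: (flat j (h *: 1 + 0) - flat j 0)) @ (0 : R)^' --> (0 : R).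
    apply/cvgr0Pnorm_lt => e e0; near=> h.
    have h0 : h != 0 by near: h; exact: nbhs_dnbhs_neq.
    rewrite (flat_le0 j (lexx 0)) subr0 addr0 /GRing.scale/= mulr1 normrM normfV.
    rewrite (ger0_norm (flat_ge0 _ _)) ltr_pdivrMl ?normr_gt0//.
    apply: (le_lt_trans (flat_le _ _)).
    have F0 : 0 < j.+2`!%:R :> R by rewrite ltr0n fact_gt0.
    rewrite -[h ^+ 2]real_normK ?num_real// expr2 mulrCA ltr_pM2l ?normr_gt0//.
    rewrite mulrC -ltr_pdivlMr//; near: h.
    by apply: dnbhs0_lt; rewrite divr_gt0.
  move=> H; split.
    by apply/cvg_ex; exists 0.
  by apply/cvg_lim.
Unshelve. all: by end_near. Qed.

Lemma smooth_flat j : smooth (flat j).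
Proof.
have df i x : differentiable (flat i) x.
  by apply/derivable1_diffP; have [] := is_derive_flat i x.
apply: Ck_smooth => n; elim: n j => [|n IH] j; split => // v.
rewrite (_ : 'D_v _ = cst v \* (flat j.+2 \+ (cst (- j%:R) \* flat j.+1))).
  apply: CkM; first exact: Ck_cst.
  by apply: CkD => //; apply: CkM => //; exact: Ck_cst.
apply/funext => x; rewrite deriveE//.
rewrite -[v in LHS]mulr1 -[v * 1]/(v *: 1) linearZ/= -deriveE//.
have /(@derive_val _ _ _ _ _ _ _) -> := is_derive_flat j x.
by rewrite /GRing.scale/= mulNr.
Qed.

Definition smooth_step x : R := flat 0 x / (flat 0 x + flat 0 (1 - x)).

Lemma smooth_step_den_gt0 x : 0 < flat 0 x + flat 0 (1 - x).
Proof.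
have [x0|x0] := ltP 0 x; first by rewrite ltr_pwDl ?flat_gt0// flat_ge0.
by rewrite ltr_wpDl ?flat_ge0// flat_gt0//; lra.
Qed.

Lemma smooth_step_ge0 x : 0 <= smooth_step x.
Proof. by rewrite divr_ge0 ?flat_ge0// ltW// smooth_step_den_gt0. Qed.

Lemma smooth_step_le1 x : smooth_step x <= 1.
Proof.
by rewrite ler_pdivrMr ?smooth_step_den_gt0// mul1r lerDl flat_ge0.
Qed.

Lemma smooth_step0 x : x <= 0 -> smooth_step x = 0.
Proof. by move=> x0; rewrite /smooth_step flat_le0// mul0r. Qed.

Lemma smooth_step1 x : 1 <= x -> smooth_step x = 1.
Proof.
move=> x1; rewrite /smooth_step [flat 0 (1 - x)]flat_le0; last by lra.
by rewrite addr0 divff// gt_eqF// flat_gt0//; lra.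
Qed.

Lemma smooth_smooth_step : smooth smooth_step.
Proof.
apply: (@smoothM _ _ (flat 0)); first exact: smooth_flat.
apply: smoothV; first by move=> x; rewrite gt_eqF// smooth_step_den_gt0.
apply: smoothD; first exact: smooth_flat.
rewrite (_ : (fun x : R => _) = (fun x => flat 0 (-1 * x + 1))).
  exact/smooth_affine/smooth_flat.
by apply/funext => x; congr flat; ring.
Qed.

Definition cutoff a b x : R :=
  smooth_step ((b - x) / (b - a)) * smooth_step ((b + x) / (b - a)).

Lemma smooth_cutoff a b : smooth (cutoff a b).
Proof.
apply: smoothM.
  rewrite (_ : (fun x : R => _) = (fun x => smooth_step (- (b - a)^-1 * x + b / (b - a)))).
    exact/smooth_affine/smooth_smooth_step.
  by apply/funext => x; congr smooth_step; ring.
rewrite (_ : (fun x : R => _) = (fun x => smooth_step ((b - a)^-1 * x + b / (b - a)))).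
  exact/smooth_affine/smooth_smooth_step.
by apply/funext => x; congr smooth_step; ring.
Qed.

Lemma cutoff_ge0 a b x : 0 <= cutoff a b x.
Proof. by rewrite mulr_ge0 ?smooth_step_ge0. Qed.

Lemma cutoff_le1 a b x : cutoff a b x <= 1.
Proof. by rewrite mulr_ile1 ?smooth_step_ge0 ?smooth_step_le1. Qed.

Lemma cutoff1 a b x : a < b -> `|x| <= a -> cutoff a b x = 1.
Proof.
move=> ab; rewrite ler_norml => /andP[x1 x2].
by rewrite /cutoff !smooth_step1 ?mulr1// ler_pdivlMr ?mul1r; lra.
Qed.

Lemma cutoff0 a b x : a < b -> b <= `|x| -> cutoff a b x = 0.
Proof.
move=> ab; rewrite /cutoff ler_normr => /orP[xb|xb].
  by rewrite [smooth_step ((b - x) / _)]smooth_step0 ?mul0r// pmulr_lle0 ?invr_gt0; lra.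
by rewrite [smooth_step ((b + x) / _)]smooth_step0 ?mulr0// pmulr_lle0 ?invr_gt0; lra.
Qed.

End cutoff.

(** * Lebesgue measure on row vectors *)

Section rV_borel.
Context {R : realType} {n : nat}.
Implicit Types (x y : 'rV[R]_n) (f : 'rV[R]_n -> R).

(** A countable base of the topology, needed because the sigma-algebra is generated by the
    coordinates and not by the open sets. *)
Definition rat_cube (z : 'rV[rat]_n * nat) : set 'rV[R]_n :=
  [set x | forall i, ball (ratr (z.1 ord0 i) : R) z.2.+1%:R^-1 (x ord0 i)].

Lemma measurable_rat_cube z : measurable (rat_cube z).
Proof.
rewrite (_ : rat_cube z = \bigcap_(i in [set: 'I_n])
    (rV_coord i @^-1` ball (ratr (z.1 ord0 i) : R) z.2.+1%:R^-1)).
  apply: fin_bigcap_measurable => // i _.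
  rewrite -[X in measurable X]setTI; apply: measurable_rV_coord => //.
  by apply: open_measurable; exact: ball_open.
by apply/seteqP; split => x /= H; [move=> i _; exact: H|move=> i; exact: (H i I)].
Qed.

Lemma rat_cube_in (A : set 'rV[R]_n) x : open A -> A x ->
  exists z, rat_cube z x /\ rat_cube z `<=` A.
Proof.
move=> oA Ax; have /nbhs_ballP[e /= e0 eA] : nbhs x A by apply: open_nbhs_nbhs.
have [N Ne] : exists N : nat, N.+1%:R^-1 < e / 2 :> R.
  exists (Num.trunc (e / 2)^-1); rewrite invf_plt ?posrE ?ltr0n ?divr_gt0//.
  exact: truncnS_gt.
have /choice[q qP] : forall i : 'I_n, exists q : rat,
    ball (ratr q : R) N.+1%:R^-1 (x ord0 i).
  move=> i; have : x ord0 i < x ord0 i + N.+1%:R^-1 by rewrite ltrDl invr_gt0 ltr0n.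
  move=> /rat_in_itvoo[q]; rewrite in_itv/= => /andP[q1 q2]; exists q.
  by rewrite /ball/= gtr0_norm ?subr_gt0// ltrBlDl.
exists (\row_i q i, N); split => [i/=|y yq]; first by rewrite mxE.
apply: eA; split => // i j; rewrite (ord1 i).
have := yq j; rewrite /= mxE => yqj; have := qP j.
move: Ne yqj; set d := _^-1 => Ne; rewrite /ball/= !ltr_norml => /andP[? ?] /andP[? ?].
by apply/andP; split; lra.
Qed.

(** Keep the rational cubes that lie inside some member of [F]; indices that code no such cube give
    the empty set. *)
Lemma lindelof_rV (F : set (set 'rV[R]_n)) : (forall A, F A -> open A) ->
  exists G : (set 'rV[R]_n)^nat,
    [/\ forall k, measurable (G k),
        forall k, G k = set0 \/ exists2 A, F A & G k `<=` A &
        \bigcup_(A in F) A = \bigcup_k G k].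
Proof.
move=> oF.
pose G k : set 'rV[R]_n := if unpickle k is Some z then
  if `[< exists2 A, F A & rat_cube z `<=` A >] then rat_cube z else set0 else set0.
have GP k : G k = set0 \/ exists z, G k = rat_cube z /\ exists2 A, F A & G k `<=` A.
  rewrite /G; case: (unpickle k) => [z|]; last by left.
  by case: ifPn => [/asboolP H|_]; [right; exists z|left].
exists G; split => [k|k|].
- by have [->|[z [-> _]]] := GP k; [exact: measurable0|exact: measurable_rat_cube].
- by have [->|[z [_ H]]] := GP k; [left|right].
- apply/seteqP; split => x.
    move=> [A FA Ax]; have [z [zx zA]] := rat_cube_in (oF _ FA) Ax.
    exists (pickle z) => //; rewrite /G pickleK ifT//.
    by apply/asboolP; exists A.
  move=> [k _]; have [->//|[z [_ [A FA GA]]]] := GP k.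
  by move=> /GA Ax; exists A.
Qed.

Lemma open_measurable_rV (A : set 'rV[R]_n) : open A -> measurable A.
Proof.
move=> oA; have [|G [mG _ AG]] := @lindelof_rV [set A]; first by move=> _ ->.
rewrite bigcup_set1 in AG; rewrite AG.
exact: bigcupT_measurable.
Qed.

Lemma continuous_measurable_rV f : continuous f -> measurable_fun setT f.
Proof.
move=> /continuousP cf; apply: (measurability _ (RGenOpens.measurableE R)).
move=> _ [_ [a [b ->] <-]]; rewrite setTI.
by apply: open_measurable_rV; apply: cf; exact: interval_open.
Qed.

(** The complement of [ess_support f] is an arbitrary union of open sets on which [f] vanishes
    almost everywhere. Reducing it to countably many pieces makes the union of the exceptional sets
    negligible. *)
Lemma ess_support_ae f (A : set 'rV[R]_n) : ess_support f `<=` A ->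
  {ae leb R n, forall x, ~ A x -> f x = 0}.
Proof.
move=> fA.
have [|G [mG GF EG]] := @lindelof_rV [set O : set 'rV[R]_n |
       open O /\ {ae leb R n, forall x, O x -> f x = 0}]; first by move=> O [].
have NG k : (leb R n).-negligible (G k `&` [set x | f x != 0]).
  have [->|[D [_ ae0] GO]] := GF k; last have [N [mN N0 NO]] := ae0.
    by rewrite set0I; exact: negligible_set0.
  exists N; split => // x [/GO Dx /= fx]; apply: NO => /= H.
  by move: fx; rewrite (H Dx) eqxx.
have : (leb R n).-negligible (\bigcup_k (G k `&` [set x | f x != 0])).
  exact: negligible_bigcup.
apply: negligibleS => x /= /not_implyP[Ax fx].
have : (\bigcup_(O in [set O : set 'rV[R]_n |
       open O /\ {ae leb R n, forall x, O x -> f x = 0}]) O) x.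
  apply: contrapT => H; apply: Ax; apply: fA; exact: H.
rewrite EG => -[k _ Gk]; exists k => //; split => //.
exact/eqP.
Qed.

End rV_borel.

Section leb_box.
Context {R : realType}.
Implicit Types (s rho k : R).

Lemma measurable_box n s : measurable [set x : 'rV[R]_n | forall i, `|x ord0 i| <= s].
Proof.
rewrite (_ : mkset _ = \bigcap_(i in [set: 'I_n]) (rV_coord i @^-1` `[- s, s])).
  apply: fin_bigcap_measurable => // i _.
  by rewrite -[X in measurable X]setTI; apply: measurable_rV_coord.
apply/seteqP; split => x /= H.
  by move=> i _ /=; rewrite in_itv/= -ler_norml; exact: H.
by move=> i; have := H i I; rewrite /= in_itv/= -ler_norml.
Qed.

Lemma leb_box n s : 0 <= s ->
  leb R n [set x : 'rV[R]_n | forall i, `|x ord0 i| <= s] = ((2 * s) ^+ n)%:E.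
Proof.
move=> s0; elim: n => [|n IH].
  rewrite /= (_ : mkset _ = setT); first by rewrite expr0 diracT.
  by apply/seteqP; split => // x _ [].
rewrite [LHS]/= /leb_step /pushforward.
rewrite (_ : _ @^-1` _ = `[- s, s] `*` [set x : 'rV[R]_n | forall i, `|x ord0 i| <= s]).
  rewrite product_measure1E//=; last exact: measurable_box.
  rewrite [X in (_ * X)%E](_ : _ = ((2 * s) ^+ n)%:E)//.
  rewrite lebesgue_measure_itv/= lte_fin.
  have [ss|ss] := ltP (- s) s.
    by rewrite -EFinD -EFinM exprS; congr (_%:E); ring.
  have -> : s = 0 by lra.
  by rewrite mul0e mulr0 exprS mul0r.
apply/seteqP; split => [[a x] /= H|[a x] /= [Ha Hx] i].
  split; first by have := H ord0; rewrite mxE unlift_none in_itv/= -ler_norml.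
  by move=> i; have := H (lift ord0 i); rewrite mxE liftK.
rewrite mxE; case: unliftP => [j|] _; first exact: Hx.
by rewrite in_itv/= -ler_norml in Ha.
Qed.

Lemma measurable_eball n rho : measurable (@eball R n rho).
Proof.
have mN : measurable_fun setT (fun x : 'rV[R]_n => Num.sqrt (\sum_(i < n) x ord0 i ^+ 2)).
  apply: measurableT_comp.
    by apply: measurable_realfun.continuous_measurable_fun; exact: sqrt_continuous.
  by apply: measurable_sum => i; apply: measurable_funX; exact: measurable_rV_coord.
have := mN measurableT `]-oo, rho[%classic (measurable_itv _); rewrite setTI.
rewrite [X in measurable X -> _](_ : _ = eball rho)//.
Qed.

Lemma eball_coord n rho (x : 'rV[R]_n) : eball rho x -> forall i, `|x ord0 i| < rho.
Proof.
move=> xr i; apply: le_lt_trans xr; rewrite -sqrtr_sqr ler_sqrt; last first.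
  by apply: sumr_ge0 => j _; exact: sqr_ge0.
by rewrite (bigD1 i)//= lerDl; apply: sumr_ge0 => j _; exact: sqr_ge0.
Qed.

(** The slice of the ball at [x_0 = a] is enclosed in a cube instead of a ball: only the power of
    [rho^2 - a^2] matters, and volumes of cubes are explicit. *)
Lemma eball_cons n rho a (y : 'rV[R]_n) : eball rho (rV_cons (a, y)) ->
  `|a| < rho /\ forall i, `|y ord0 i| <= Num.sqrt (rho ^+ 2 - a ^+ 2).
Proof.
move=> H; have := eball_coord H ord0; rewrite mxE unlift_none /= => ar; split => // i.
rewrite -sqrtr_sqr ler_wsqrtr//.
have r0 : 0 <= rho by apply: le_trans (ltW ar).
move: H; rewrite /eball/= => H.
have : \sum_(i < n.+1) (rV_cons (a, y)) ord0 i ^+ 2 <= rho ^+ 2.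
  have S0 : 0 <= \sum_(i < n.+1) (rV_cons (a, y)) ord0 i ^+ 2.
    by apply: sumr_ge0 => j _; exact: sqr_ge0.
  by rewrite -[leLHS]sqr_sqrtr// ler_sqr ?nnegrE ?sqrtr_ge0// ltW.
rewrite big_ord_recl mxE unlift_none /= (bigD1 i)//= mxE liftK /=.
have : 0 <= \sum_(i0 < n | i0 != i) (rV_cons (a, y)) ord0 (lift ord0 i0) ^+ 2.
  by apply: sumr_ge0 => j _; exact: sqr_ge0.
by lra.
Qed.

(** Here [n] is the dimension of the slices, so the ball has dimension [n+1] and the growth
    [rho^(n/2)] is the one of the Glassey exponent. The factor [n! e] comes from
    [y^n <= n! e^y <= n! e^(1 + y^2)]. *)
Definition ball_const n rho : R :=
  n`!%:R * expR 1 * (2 * Num.sqrt (2 * rho)) ^+ n.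

Lemma ball_const_ge0 n rho : 0 <= ball_const n rho.
Proof.
rewrite /ball_const; apply: mulr_ge0; first by rewrite mulr_ge0 ?expR_ge0.
by rewrite exprn_ge0// mulr_ge0 ?sqrtr_ge0.
Qed.

(* [sqrt (rho^2 - a^2) <= sqrt (2 rho) sqrt (rho - a)] *)
Lemma slice_bound n rho k a : 2 <= k -> `|a| < rho ->
  expR (k * a) * (2 * Num.sqrt (rho ^+ 2 - a ^+ 2)) ^+ n <=
  ball_const n rho * expR (k * rho) * expR (a - rho).
Proof.
move=> k2; rewrite ltr_norml => /andP[a1 a2].
pose y := Num.sqrt (rho - a).
have y0 : 0 <= y by exact: sqrtr_ge0.
have y2 : y ^+ 2 = rho - a by rewrite sqr_sqrtr//; lra.
have sq : Num.sqrt (rho ^+ 2 - a ^+ 2) <= Num.sqrt (2 * rho) * y.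
  rewrite /y -sqrtrM; last by lra.
  by rewrite ler_wsqrtr//; nra.
have yn : y ^+ n <= n`!%:R * expR (1 + (rho - a)).
  have yb : y <= 1 + (rho - a) by rewrite -y2; nra.
  have F0 : 0 < n`!%:R :> R by rewrite ltr0n fact_gt0.
  apply: (@le_trans _ _ (n`!%:R * expR y)); last first.
    by apply: ler_wpM2l; [exact: ltW|rewrite ler_expR].
  rewrite -ler_pdivrMl// mulrC.
  case: n {F0} => [|n]; first by rewrite expr0 fact0 divr1 -expR0 ler_expR.
  by have := expR_ge1Dxn n y0; lra.
apply: (@le_trans _ _ (expR (k * a) * ((2 * Num.sqrt (2 * rho)) ^+ n * (n`!%:R * expR (1 + (rho - a)))))).
  rewrite ler_wpM2l ?expR_ge0//.
  apply: (@le_trans _ _ ((2 * Num.sqrt (2 * rho) * y) ^+ n)).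
    by apply: lerXn2r; rewrite ?nnegrE ?mulr_ge0 ?sqrtr_ge0// -mulrA ler_wpM2l.
  by rewrite exprMn ler_wpM2l// exprn_ge0// mulr_ge0 ?sqrtr_ge0.
rewrite /ball_const expRD.
set X := (2 * _) ^+ n; set F := n`!%:R; set e := expR 1.
have X0 : 0 <= X by rewrite exprn_ge0// mulr_ge0 ?sqrtr_ge0.
have -> : expR (k * a) * (X * (F * (e * expR (rho - a)))) =
  F * e * X * (expR (k * a) * expR (rho - a)) by ring.
rewrite -[leRHS]mulrA ler_wpM2l//.
  by rewrite !mulr_ge0 ?expR_ge0.
(* The exponents compare because [2 (rho - a) <= k (rho - a)]. *)
rewrite -!expRD ler_expR; nra.
Qed.

(** Tonelli over the slices and [slice_bound] leave the integral of [e^(a - rho)] over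
    [[- rho, rho]], which is at most 1: the mass sits within bounded distance of the pole
    [a = rho]. *)
Lemma exp_eball_le n rho k : 0 < rho -> 2 <= k ->
  (\int[leb R n.+1]_(x in eball rho) (expR (k * x ord0 ord0))%:E <=
   (ball_const n rho * expR (k * rho))%:E)%E.
Proof.
move=> rho0 k2.
have mg : measurable_fun setT (fun x : 'rV[R]_n.+1 => (expR (k * x ord0 ord0))%:E).
  apply/measurable_EFinP; apply: measurableT_comp; first exact: measurable_expR.
  by apply: measurable_funM => //; exact: measurable_rV_coord.
rewrite integral_mkcond.
set g := _ \_ _.
have g0 x : (0 <= g x)%E by rewrite /g patchE; case: ifP => // _; rewrite lee_fin expR_ge0.
have mg' : measurable_fun setT g.
  apply/(measurable_restrictT _ _).1; first exact: measurable_eball.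
  exact: measurable_funTS.
have -> : (\int[leb R n.+1]_x g x =
    \int[(@lebesgue_measure R \x leb R n)]_z (g \o rV_cons) z)%E.
  rewrite -[in RHS](preimage_setT (rV_cons : R * 'rV[R]_n -> _)).
  by rewrite -ge0_integral_pushforward//; exact: measurable_rV_cons.
have mgc : measurable_fun setT (g \o (rV_cons : R * 'rV[R]_n -> _)).
  by apply: measurableT_comp => //; exact: measurable_rV_cons.
rewrite fubini_tonelli1//; last by move=> x; exact: g0.
pose h a := ball_const n rho * expR (k * rho) * expR (a - rho).
have h0 a : 0 <= h a.
  by rewrite /h; apply: mulr_ge0; rewrite ?expR_ge0// mulr_ge0 ?expR_ge0// ball_const_ge0.
have dh (a : R) : is_derive a 1 h (h a).
  by rewrite /h; apply: is_derive_eq; rewrite ?scaler0 /GRing.scale/=; ring.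
have ch : continuous h.
  move=> a; apply: differentiable_continuous; apply/derivable1_diffP.
  by have [] := dh a.
pose J : set R := `[- rho, rho]%classic.
have inner a : (fubini_F (leb R n) (g \o rV_cons) a <= ((EFin \o h) \_ J) a)%E.
  rewrite /fubini_F patchE.
  have [ar|ar] := ltP `|a| rho; last first.
    rewrite integral0_eq; first by case: ifP => // _; rewrite lee_fin.
    move=> y _; rewrite /g /= patchE; case: ifPn => //; rewrite inE.
    by move=> /eball_cons[]; rewrite ltNge ar.
  rewrite ifT; last by rewrite inE /J /= in_itv/= -ler_norml ltW.
  pose A := [set y : 'rV[R]_n | forall i, `|y ord0 i| <= Num.sqrt (rho ^+ 2 - a ^+ 2)].
  apply: (@le_trans _ _ (\int[leb R n]_(y in A) (cst (expR (k * a))%:E) y)%E).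
    rewrite [leRHS]integral_mkcond; apply: ge0_le_integral => //.
    - by move=> y _; exact: g0.
    - exact: (@measurable_fun_pair2 _ _ _ _ _ _ _ a mgc).
    - apply/(measurable_restrictT _ _).1; first exact: measurable_box.
      exact: measurable_cst.
    - move=> y _; rewrite /g /= !patchE; case: ifPn => yr.
        rewrite ifT; first by rewrite mxE unlift_none.
        by move: yr; rewrite !inE => /eball_cons[].
      by case: ifP => // _; rewrite lee_fin expR_ge0.
  rewrite integral_cst; last exact: measurable_box.
  rewrite [X in (_ * X)%E](_ : _ = ((2 * Num.sqrt (rho ^+ 2 - a ^+ 2)) ^+ n)%:E).
    by rewrite -EFinM lee_fin; exact: slice_bound.
  by rewrite -leb_box ?sqrtr_ge0.
apply: (@le_trans _ _ (\int[lebesgue_measure]_a ((EFin \o h) \_ J) a)%E).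
  apply: ge0_le_integral => //.
  - by move=> a _; apply: integral_ge0 => y _; exact: g0.
  - by apply: measurable_fun_fubini_tonelli_F => //; move=> x; exact: g0.
  - apply/(measurable_restrictT _ _).1; first exact: measurable_itv.
    apply/measurable_EFinP; apply: measurable_funTS.
    exact: measurable_realfun.continuous_measurable_fun.
  - by move=> a _; exact: inner.
apply: (@le_trans _ _ (\int[lebesgue_measure]_(a in J) (h a)%:E)%E).
  by rewrite [leRHS]integral_mkcond.
rewrite /J (@continuous_FTC2 _ h h)//.
- rewrite -EFinB lee_fin {1}/h subrr expR0 mulr1.
  by have := h0 (- rho); lra.
- by lra.
- exact: continuous_subspaceT.
- split.
  + by move=> x _; have [] := dh x.
  + exact/cvg_at_right_filter/ch.
  + exact/cvg_at_left_filter/ch.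
- by move=> x _; rewrite derive1E; have [] := dh x.
Qed.

End leb_box.

(** * Pairings and one-sided calculus *)

Section plane_wave_pairing.
Context {R : realType} {n : nat}.
Implicit Types (f g w : 'rV[R]_n -> R).
Local Notation mu := (leb R n).

Lemma L2_measurable f : L2 f -> measurable_fun setT f.
Proof. by move=> /andP[/set_mem]. Qed.

Lemma L2_norm_lty f : L2 f -> (L2norm f < +oo)%E.
Proof. by move=> /andP[_ /set_mem]. Qed.

Lemma L2I f : measurable_fun setT f -> (L2norm f < +oo)%E -> L2 f.
Proof. by move=> mf ff; apply/andP; split; apply/mem_set. Qed.

Lemma L2_lin (a : R) f g : L2 f -> L2 g -> L2 (fun x => a * f x + g x).
Proof.
move=> Lf Lg.
have p1 : (1 <= 2%:E :> \bar R)%E by rewrite lee_fin ler1n.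
exact: ((Lfun_submod_closed mu p1).2 a f g Lf Lg).
Qed.

Lemma L2_norm_fin f : L2 f -> (fine (L2norm f))%:E = L2norm f.
Proof.
move=> Lf; rewrite fineK// ge0_fin_numE; first exact: L2_norm_lty.
exact: Lnorm_ge0.
Qed.

Lemma L2norm_ge0 f : 0 <= fine (L2norm f).
Proof. by apply: fine_ge0; exact: Lnorm_ge0. Qed.

Lemma L2_cauchy_schwarz f g : L2 f -> L2 g ->
  (\int[mu]_x `|(f x * g x)%:E| <= L2norm f * L2norm g)%E.
Proof.
move=> Lf Lg.
have := @hoelder _ _ _ mu f g 2 2 (L2_measurable Lf) (L2_measurable Lg).
rewrite Lnorm1; apply => //; lra.
Qed.

Lemma L2M_integrable f g : L2 f -> L2 g ->
  mu.-integrable setT (fun x => (f x * g x)%:E).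
Proof.
move=> Lf Lg; apply/integrableP; split.
  apply/measurable_EFinP; apply: measurable_funM; exact: L2_measurable.
apply: (le_lt_trans (L2_cauchy_schwarz Lf Lg)).
by rewrite -(L2_norm_fin Lf) -(L2_norm_fin Lg) -EFinM ltry.
Qed.

Definition pairing f w : R := \int[mu]_x (w x * f x).

Lemma pair_le f w : L2 f -> L2 w ->
  `|pairing f w| <= fine (L2norm f) * fine (L2norm w).
Proof.
move=> Lf Lw; rewrite /pairing.
apply: (le_trans (le_normr_Rintegral measurableT (L2M_integrable Lw Lf))).
rewrite -lee_fin EFinM L2_norm_fin// L2_norm_fin// muleC /Rintegral fineK.
  exact: L2_cauchy_schwarz.
rewrite ge0_fin_numE; last by apply: integral_ge0.
apply: (le_lt_trans (L2_cauchy_schwarz Lw Lf)).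
by rewrite -(L2_norm_fin Lf) -(L2_norm_fin Lw) -EFinM ltry.
Qed.

Lemma pair_lin f w v (a : R) : L2 f -> L2 w -> L2 v ->
  pairing f (fun x => a * w x + v x) = a * pairing f w + pairing f v.
Proof.
move=> Lf Lw Lv; rewrite /pairing -RintegralZl//; last exact: L2M_integrable.
rewrite -RintegralD//.
- by apply: eq_Rintegral => x _; ring.
- have La : L2 (fun x => a * w x).
    have := L2_lin a Lw (L2_lin (-1) Lw Lw).
    by under eq_fun do rewrite mulN1r addNr addr0.
  have := L2M_integrable La Lf.
  by under eq_fun do rewrite -mulrA.
- exact: L2M_integrable.
Qed.

Lemma pair_ae f g w : measurable_fun setT f -> measurable_fun setT g ->
  measurable_fun setT w ->
  {ae mu, forall x, w x * f x = w x * g x} -> pairing f w = pairing g w.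
Proof.
move=> mf mg mw fg; rewrite /pairing /Rintegral; congr fine.
apply: ae_eq_integral => //; try by apply/measurable_EFinP; exact: measurable_funM.
by apply: filterS fg => x /= -> _.
Qed.

Lemma pair_cvg0 (F : set_system R) {FF : Filter F} f (w : R -> 'rV[R]_n -> R) :
  L2 f -> (\forall s \near F, L2 (w s)) -> L2norm (w s) @[s --> F] --> 0%E ->
  pairing f (w s) @[s --> F] --> (0 : R).
Proof.
move=> Lf Lw w0; apply/cvgr0Pnorm_lt => e e0.
(* Adding 1 avoids a division by zero when [f] has zero norm. *)
pose C := fine (L2norm f) + 1.
have C0 : 0 < C by have := L2norm_ge0 f; rewrite /C; lra.
have : \forall s \near F, (L2norm (w s) < (e / C)%:E)%E.
  have eC : 0 < e / C by rewrite divr_gt0.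
  exact: w0 (nbhs_open_ereal_lt (f := fun=> e / C) eC).
move=> H; near=> s.
have Ls : L2 (w s) by near: s.
have : (L2norm (w s) < (e / C)%:E)%E by near: s.
rewrite -(L2_norm_fin Ls) lte_fin ltr_pdivlMr// => lt.
apply: le_lt_trans lt; apply: (le_trans (pair_le Lf Ls)).
rewrite mulrC ler_wpM2l ?L2norm_ge0// /C; lra.
Unshelve. all: by end_near. Qed.

End plane_wave_pairing.

Section one_sided.
Context {R : realType}.
Implicit Types (f : R -> R) (D : set R) (t l : R).

Lemma quotient_cvg f D t l :
  (f (t + h) - f t) / h @[h --> within [set h | D (t + h)] 0^'] --> l ->
  f s @[s --> within D (nbhs t)] --> f t.
Proof.
move=> fl; apply/cvgrPdist_lt => e e0.
have : \forall h \near within [set h | D (t + h)] (0 : R)^',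
    `|(f (t + h) - f t) / h| < `|l| + 1.
  move/cvgrPdist_lt : fl => /(_ 1 ltr01); apply: filterS => h.
  move=> H; have := ler_distD l 0 ((f (t + h) - f t) / h).
  rewrite !sub0r !normrN; lra.
rewrite near_withinE => -[d /= d0 H].
pose C := `|l| + 1.
have C0 : 0 < C by rewrite /C; have := normr_ge0 l; lra.
near=> s; have Ds : D s by near: s; exact: withinT.
have [->|st] := eqVneq s t; first by rewrite subrr normr0.
have st0 : s - t != 0 by rewrite subr_eq0.
have std : `|s - t| < Order.min d (e / C).
  rewrite distrC; near: s.
  have m0 : 0 < Order.min d (e / C) by rewrite lt_min d0 divr_gt0.
  by apply: cvg_within; exact: nbhsx_ballx.
move: std; rewrite lt_min => /andP[sd se].
have := H (s - t); rewrite /= sub0r normrN => /(_ sd st0).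
rewrite [t + _]addrC subrK => /(_ Ds).
rewrite normrM normfV ltr_pdivrMr ?normr_gt0// => H1.
rewrite distrC (lt_le_trans H1)//.
by rewrite mulrC -ler_pdivlMr// ltW.
Unshelve. all: by end_near. Qed.

Lemma quotient_derive f D t l : nbhs t D ->
  (f (t + h) - f t) / h @[h --> within [set h | D (t + h)] 0^'] --> l ->
  is_derive t 1 f l.
Proof.
move=> tD fl.
have fl' : h^-1 *: (f (h *: 1 + t) - f t) @[h --> (0 : R)^'] --> l.
  apply/cvgrPdist_lt => e e0; move/cvgrPdist_lt : fl => /(_ e e0).
  have D0 : \forall h \near (0 : R)^', D (t + h).
    apply: cvg_within; move/nbhs_ballP : tD => [d /= d0 dD].
    exists d => // h /=; rewrite sub0r normrN => hd; apply: dD.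
    by rewrite /ball/= opprD addrA subrr sub0r normrN.
  rewrite near_withinE => H; near=> h.
  rewrite /GRing.scale/= mulr1 [h + t]addrC mulrC.
  have Dh : D (t + h) by near: h.
  by move: Dh; near: h.
split; first by apply/cvg_ex; exists l.
by apply/cvg_lim.
Unshelve. all: by end_near. Qed.

(** Composing with [clamp tau] extends a function on [[0, tau]] by constants. One-sided continuity
    at the endpoints becomes continuity on the line, and derivatives inside []0, tau[] are
    unchanged. *)
Definition clamp (tau t : R) : R := Order.max 0 (Order.min t tau).

Lemma clamp_itv tau t : 0 <= tau -> 0 <= clamp tau t <= tau.
Proof.
by move=> t0; rewrite /clamp le_max lexx /= ge_max t0 /= ge_min lexx orbT.
Qed.

Lemma clamp_id tau t : 0 <= t <= tau -> clamp tau t = t.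
Proof. by move=> /andP[t0 tt]; rewrite /clamp min_l// max_r. Qed.

Lemma continuous_clamp tau : continuous (clamp tau).
Proof.
move=> t; apply: (@continuous_max _ _ (cst 0) (fun t => Order.min t tau) t); first exact: cvg_cst.
by apply: (@continuous_min _ _ id (cst tau) t); [exact: cvg_id|exact: cvg_cst].
Qed.

Lemma continuous_comp_clamp f tau : 0 <= tau ->
  (forall t, 0 <= t <= tau -> f s @[s --> within `[0, tau] (nbhs t)] --> f t) ->
  continuous (f \o clamp tau).
Proof.
move=> t0 cf t; apply/cvgrPdist_lt => e e0.
have := cf _ (clamp_itv t t0) => /cvgrPdist_lt/(_ e e0).
rewrite near_withinE => H.
have H2 : \forall s \near t, `[0, tau]%classic (clamp tau s) ->
    `|f (clamp tau t) - f (clamp tau s)| < e := continuous_clamp H.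
apply: filterS H2 => s /=; apply.
by rewrite in_itv/= clamp_itv.
Qed.

Lemma is_derive_comp_clamp f tau t l : 0 < t < tau ->
  is_derive t 1 f l -> is_derive t 1 (f \o clamp tau) l.
Proof.
move=> /andP[t0 tt]; apply: near_eq_is_derive; near=> s.
rewrite /= clamp_id//; apply/andP; split; apply/ltW; near: s.
  exact: lt_nbhsr.
exact: lt_nbhsl.
Unshelve. all: by end_near. Qed.

(** For [t <= 0] the value is 0, not a signed integral; it is therefore a primitive of [f] only on
    [t > 0], though continuous everywhere. *)
Definition prim f t : R := \int[lebesgue_measure]_(s in `[0, t]) f s.

Lemma continuous_integrable_itv f a b : continuous f ->
  lebesgue_measure.-integrable `[a, b] (EFin \o f).
Proof.
move=> cf; apply: continuous_compact_integrable; first exact: segment_compact.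
exact: continuous_subspaceT.
Qed.

Lemma prim_le0 f t : t <= 0 -> prim f t = 0.
Proof.
rewrite le_eqVlt => /predU1P[->|t0]; rewrite /prim.
  by rewrite set_itv1 Rintegral_set1.
by rewrite set_itv_ge ?Rintegral_set0// bnd_simp -ltNge.
Qed.

Lemma is_derive_prim f t : continuous f -> 0 < t -> is_derive t 1 (prim f) (f t).
Proof.
move=> cf t0.
have [] := @continuous_FTC1_closed _ f 0 t (t + 1) _ _ t0 (cf t).
- by rewrite ltrDl.
- exact: continuous_integrable_itv.
by move=> df; rewrite derive1E => dE; split.
Qed.

Lemma continuous_prim f : continuous f -> continuous (prim f).
Proof.
move=> cf t.
(* Near [t], [prim f] agrees with its clamped version on [[0, |t| + 1]], for which continuity on a
   compact interval suffices. *)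
have tau0 : 0 <= `|t| + 1 by rewrite addr_ge0.
have H := @continuous_comp_clamp (prim f) _ tau0.
have {}H : continuous (prim f \o clamp (`|t| + 1)).
  apply: H => s s01.
  have /subspace_continuousP := @parameterized_integral_continuous _ 0 _ f tau0
    (continuous_integrable_itv _ _ cf).
  by apply; rewrite /= in_itv.
have nE : \forall s \near t, (prim f \o clamp (`|t| + 1)) s = prim f s.
  near=> s; rewrite /=.
  have [s0|s0] := leP s 0.
    rewrite /clamp min_l; last by lra.
    by rewrite max_l// prim_le0// prim_le0.
  rewrite clamp_id// (ltW s0)/=.
  apply: (@le_trans _ _ (t + 1)); last by rewrite lerD2r ler_norm.
  by apply/ltW; near: s; apply: lt_nbhsl; rewrite ltrDl.
have := H t; rewrite /continuous_at (nbhs_singleton nE) => H'.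
by apply: cvg_trans H'; exact: near_eq_cvg.
Unshelve. all: by end_near. Qed.

Lemma eq_prim f g t : (forall s, 0 <= s <= t -> f s = g s) -> prim f t = prim g t.
Proof.
by move=> fg; apply: eq_Rintegral => s; rewrite inE/= in_itv/=; exact: fg.
Qed.

End one_sided.

(** * Truncated plane waves *)

Section box_support.
Context {R : realType} {n : nat}.
Implicit Types (f : 'rV[R]_n -> R) (x v : 'rV[R]_n) (s : R).

Definition cbox s : set 'rV[R]_n := [set x | forall i, `|x ord0 i| <= s].

Lemma compact_cbox s : compact (cbox s).
Proof.
rewrite (_ : cbox s = [set x : 'rV[R]_n | forall i, `[- s, s]%classic (x ord0 i)]).
  by apply: (@rV_compact R n (fun=> `[- s, s]%classic)) => i; exact: segment_compact.
by apply/seteqP; split => x H i; have := H i; rewrite /= in_itv/= -ler_norml.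
Qed.

Lemma closed_cbox s : closed (cbox s).
Proof. by apply: compact_closed; [exact: norm_hausdorff|exact: compact_cbox]. Qed.

Lemma near_obox s x : (forall i, `|x ord0 i| < s) ->
  nbhs x [set y : 'rV[R]_n | forall i, `|y ord0 i| < s].
Proof.
move=> xs.
have := @filter_forall _ _ (fun (i : 'I_n) (y : 'rV[R]_n) => `|y ord0 i| < s) (nbhs x) _.
apply => i.
have cN : {for x, continuous (fun y : 'rV[R]_n => `|y ord0 i|)}.
  apply: (@continuous_comp _ _ _ (fun y : 'rV[R]_n => y ord0 i : R) Num.norm).
    exact: differentiable_continuous (differentiable_coord _ _ _).
  exact: norm_continuous.
exact: cN (lt_nbhsl (xs i)).
Qed.

Lemma near_cbox s x : (forall i, `|x ord0 i| < s) -> nbhs x (cbox s).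
Proof. by move=> xs; apply: filterS (near_obox xs) => y H i; exact: ltW. Qed.

Lemma derive_notin_cbox f s v : (forall x, ~ cbox s x -> f x = 0) ->
  forall x, ~ cbox s x -> 'D_v f x = 0.
Proof.
move=> f0 x xs; rewrite -[RHS](@derive_cst _ _ _ (0 : R) x v).
apply: near_eq_derive.
have : nbhs x (~` cbox s).
  by apply: open_nbhs_nbhs; split => //; apply: closed_openC; exact: closed_cbox.
by apply: filterS => y; exact: f0.
Qed.

Lemma test_fun_cbox f s : smooth f -> (forall x, ~ cbox s x -> f x = 0) ->
  test_fun f.
Proof.
move=> sf f0; split => //; apply: (subclosed_compact _ (@compact_cbox s)).
  exact: closed_closure.
have /closure_id -> := @closed_cbox s.
apply: closureS => x /= fx; apply: contrapT => xs.
by move: fx; rewrite f0// eqxx.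
Qed.

Lemma smooth_continuous f : smooth f -> continuous f.
Proof. by move=> sf x; exact/differentiable_continuous/smooth_differentiable. Qed.

Lemma cbox_bounded f s : 0 <= s -> continuous f ->
  (forall x, ~ cbox s x -> f x = 0) ->
  exists M : R, 0 <= M /\ forall x, `|f x| <= M.
Proof.
move=> s0 cf f0.
have c0 : cbox s !=set0 by exists 0 => i; rewrite mxE normr0.
have cN : {within cbox s, continuous (fun x => `|f x|)}.
  apply: continuous_subspaceT => x.
  by apply: (@continuous_comp _ _ _ f Num.norm); [exact: cf|exact: norm_continuous].
have [c _ cmax] := EVT_max_rV c0 (@compact_cbox s) cN.
exists `|f c|; split => // x.
have [xs|xs] := pselect (cbox s x); first by apply: cmax; rewrite inE.
by rewrite f0// normr0.
Qed.

Lemma L2_cbox f s : 0 <= s -> measurable_fun setT f ->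
  (forall x, ~ cbox s x -> f x = 0) ->
  (exists M : R, 0 <= M /\ forall x, `|f x| <= M) -> L2 f.
Proof.
move=> s0 mf f0 [M [M0 fM]].
apply: L2I => //; rewrite /L2norm unlock; apply: poweR_lty.
apply: (@le_lt_trans _ _ (\int[leb R n]_x ((cst (M ^+ 2)%:E) \_ (cbox s)) x)%E).
  apply: ge0_le_integral => //.
  - by move=> x _; exact: poweR_ge0.
  - apply: (measurableT_comp (measurable_poweR _)).
    by apply: measurableT_comp => //; exact/measurable_EFinP.
  - apply/(measurable_restrictT _ _).1; first exact: measurable_box.
    exact: measurable_cst.
  - move=> x _; rewrite patchE /=; case: ifPn => [_|].
      by rewrite lee_fin powR_mulrn// lerXn2r ?nnegrE.
    by rewrite notin_setE => xs; rewrite f0// normr0 powR0.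
rewrite -integral_mkcond integral_cst; last exact: measurable_box.
rewrite [X in (_ * X)%E](_ : _ = ((2 * s) ^+ n)%:E); last exact: leb_box.
by rewrite -EFinM ltry.
Qed.

Lemma L2_smooth_cbox f s : 0 <= s -> smooth f ->
  (forall x, ~ cbox s x -> f x = 0) -> L2 f.
Proof.
move=> s0 /smooth_continuous cf f0; apply: (L2_cbox s0) => //.
  exact: continuous_measurable_rV.
exact: cbox_bounded f0.
Qed.

End box_support.

Section bumpexp.
Context {R : realType} {n : nat}.
Implicit Types (k rho s : R) (x v : 'rV[R]_n.+1).

(** The cutoff acts on each coordinate, so its smoothness comes from one variable. It equals 1 on
    the box of half-side [rho], which contains the ball of radius [rho], and it keeps the function
    between 0 and the plane wave. *)
Definition bumpexp k rho x : R :=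
  expR (k * x ord0 ord0) * \prod_i cutoff rho (rho + 1) (x ord0 i).

Lemma smooth_bumpexp k rho : smooth (bumpexp k rho).
Proof.
apply: smoothM.
  exact: (@smooth_coord _ _ ord0 (fun y => expR (k * y)) (smooth_expR k)).
by apply: smooth_prod => i; apply: smooth_coord; exact: smooth_cutoff.
Qed.

Lemma bumpexp_ge0 k rho x : 0 <= bumpexp k rho x.
Proof.
by rewrite mulr_ge0 ?expR_ge0// prodr_ge0// => i _; exact: cutoff_ge0.
Qed.

Lemma bumpexp_le k rho x : bumpexp k rho x <= expR (k * x ord0 ord0).
Proof.
rewrite -[leRHS]mulr1 ler_wpM2l ?expR_ge0//.
apply: (@le_trans _ _ (\prod_(i < n.+1) (1 : R))); last by rewrite big1.
by apply: ler_prod => i _; rewrite cutoff_ge0 cutoff_le1.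
Qed.

Lemma bumpexpE k rho x : cbox rho x -> bumpexp k rho x = expR (k * x ord0 ord0).
Proof.
by move=> xr; rewrite /bumpexp big1 ?mulr1// => i _; rewrite cutoff1// ltrDl.
Qed.

Lemma bumpexp0 k rho x : ~ cbox (rho + 1) x -> bumpexp k rho x = 0.
Proof.
move=> /existsNP[i /negP]; rewrite -ltNge => xi.
rewrite /bumpexp (bigD1 i)//= cutoff0 ?mul0r ?mulr0//; last exact: ltW.
by rewrite ltrDl.
Qed.

Lemma derive_expR_coord k v x :
  'D_v (fun y : 'rV[R]_n.+1 => expR (k * y ord0 ord0)) x =
  k * v ord0 ord0 * expR (k * x ord0 ord0).
Proof.
pose F (y : 'rV[R]_n.+1) : R := expR (k * y ord0 ord0).
pose G (h : R) : R := expR (k * (h * v ord0 ord0 + x ord0 ord0)).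
have dG : is_derive (0 : R) 1 G (k * v ord0 ord0 * G 0).
  by rewrite /G; apply: is_derive_eq; rewrite ?scaler0 /GRing.scale/=; ring.
have G0 : G 0 = F x by rewrite /G mul0r add0r.
have := @derive_val _ _ _ _ _ _ _ dG; rewrite G0 => <-.
have E : (fun h : R => h^-1 *: ((F \o shift x) (h *: v) - F x)) =
         (fun h : R => h^-1 *: ((G \o shift 0) (h *: 1) - G 0)).
  apply/funext => h; rewrite G0 /F /G /= !mxE.
  have -> // : h *: (1 : R) + 0 = h by rewrite addr0 /GRing.scale/= mulr1.
by rewrite /derive -/F E.
Qed.

Lemma derive_bumpexp k rho v x : (forall i, `|x ord0 i| < rho) ->
  'D_v (bumpexp k rho) x = k * v ord0 ord0 * expR (k * x ord0 ord0).
Proof.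
move=> xr; rewrite -derive_expR_coord; apply: near_eq_derive.
by apply: filterS (near_cbox xr) => y; exact: bumpexpE.
Qed.

Lemma derive2_bumpexp k rho v x : (forall i, `|x ord0 i| < rho) ->
  'D_v ('D_v (bumpexp k rho)) x = (k * v ord0 ord0) ^+ 2 * expR (k * x ord0 ord0).
Proof.
move=> xr; rewrite expr2 -mulrA -derive_expR_coord.
set c := k * v ord0 ord0.
have sE := @smooth_coord R n.+1 ord0 (fun y => expR (k * y)) (smooth_expR k).
rewrite -[RHS](@deriveMr _ _ _ c); last exact/diff_derivable/smooth_differentiable.
apply: near_eq_derive; apply: filterS (near_obox xr) => y yr.
by rewrite (derive_bumpexp k v yr) mulrC.
Qed.

End bumpexp.

Section weak_gradient.
Context {R : realType} {n : nat}.
Implicit Types (k rho s : R) (w : 'rV[R]_n.+1 -> R).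

Lemma smooth_derive_bumpexp k rho (v : 'rV[R]_n.+1) :
  smooth ('D_v (bumpexp k rho) : 'rV[R]_n.+1 -> R).
Proof. exact/smooth_derive/smooth_bumpexp. Qed.

Lemma L2_bumpexp k rho : 0 <= rho -> L2 (@bumpexp R n k rho).
Proof.
move=> r0; apply: (@L2_smooth_cbox _ _ _ (rho + 1)); first lra.
  exact: smooth_bumpexp.
exact: bumpexp0.
Qed.

Lemma L2_derive_bumpexp k rho (v : 'rV[R]_n.+1) : 0 <= rho ->
  L2 ('D_v (bumpexp k rho) : 'rV[R]_n.+1 -> R).
Proof.
move=> r0; apply: (@L2_smooth_cbox _ _ _ (rho + 1)); first lra.
  exact: smooth_derive_bumpexp.
by apply: derive_notin_cbox; exact: bumpexp0.
Qed.

Lemma pair_sum (I : Type) (s : seq I) (f g : I -> 'rV[R]_n.+1 -> R) :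
  (forall i, L2 (f i)) -> (forall i, L2 (g i)) ->
  \int[leb R n.+1]_x (\sum_(i <- s) g i x * f i x) = \sum_(i <- s) pairing (f i) (g i).
Proof.
move=> Lf Lg.
suff [] : (leb R n.+1).-integrable setT (fun x => (\sum_(i <- s) g i x * f i x)%:E) /\
  \int[leb R n.+1]_x (\sum_(i <- s) g i x * f i x) = \sum_(i <- s) pairing (f i) (g i) by [].
elim: s => [|i s [IH1 IH2]].
  under eq_fun do rewrite big_nil.
  split; first exact: integrable0.
  by rewrite big_nil; under eq_Rintegral do rewrite big_nil; rewrite Rintegral_cst// mul0r.
have Li := L2M_integrable (Lg i) (Lf i).
split.
  under eq_fun do rewrite big_cons EFinD.
  exact: integrableD.
under eq_Rintegral do rewrite big_cons.
by rewrite RintegralD// IH2 big_cons.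
Qed.

(* On the support of [w] the test function is the plane wave [e^(k x_0)], an eigenfunction of the Laplacian. *)
Lemma weak_gradient_bumpexp k rho w : 0 <= rho -> H1 w ->
  {ae leb R n.+1, forall x, ~ eball rho x -> w x = 0} ->
  \int[leb R n.+1]_x (\sum_(i < n.+1) wgrad w i x * 'D_(unit_vec i) (bumpexp k rho) x) =
  - (k ^+ 2 * pairing (bumpexp k rho) w).
Proof.
move=> r0 [Lw ex] w0.
have [Lg wg] : (forall i, L2 (wgrad w i)) /\ is_weak_grad w (wgrad w).
  exact: (xgetPex (fun=> fun=> 0) ex).
pose D i : 'rV[R]_n.+1 -> R := 'D_(unit_vec i) (bumpexp k rho).
have LD i : L2 (D i) by exact: L2_derive_bumpexp.
rewrite (@pair_sum _ _ D (wgrad w))//.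
(* The weak gradient is tested against [D_i Psi], giving minus the pairing of [w] with
   [D_i D_i Psi]. On the ball carrying [w] this second derivative is [k^2 Psi] for the first
   coordinate and 0 for the others. *)
have H i : pairing (D i) (wgrad w i) = - ((i == ord0)%:R * k ^+ 2 * pairing (bumpexp k rho) w).
  have tD : test_fun (D i).
    apply: (@test_fun_cbox _ _ _ (rho + 1)); first exact: smooth_derive_bumpexp.
    by apply: derive_notin_cbox; exact: bumpexp0.
  have := wg i (D i) tD; rewrite -/(pairing (D i) (wgrad w i)) => /esym/eqP.
  rewrite eqr_oppLR => /eqP ->; congr (- _).
  pose c : R := (i == ord0)%:R * k ^+ 2.
  have Lb := @L2_bumpexp k rho r0.
  transitivity (pairing (fun x => c * bumpexp k rho x) w).
    apply: pair_ae.
    - apply: continuous_measurable_rV; apply: smooth_continuous.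
      exact/smooth_derive/smooth_derive_bumpexp.
    - by apply: measurable_funM => //; exact: L2_measurable.
    - exact: L2_measurable.
    apply: filterS w0 => x wx.
    have [xr|xr] := pselect (eball rho x); last by rewrite wx// !mul0r.
    congr (_ * _); have xb := eball_coord xr.
    rewrite derive2_bumpexp// bumpexpE; last by move=> j; exact/ltW/xb.
    rewrite /c /unit_vec mxE eqxx/= [ord0 == i]eq_sym.
    by case: (i == ord0); rewrite ?mulr1 ?mul1r// mulr0 !mul0r expr0n/= mul0r.
  rewrite /pairing -RintegralZl//; last exact: L2M_integrable.
  by apply: eq_Rintegral => x _; rewrite /c; ring.
rewrite (eq_bigr _ (fun i _ => H i)) big_ord_recl/= mul1r big1 ?addr0// => i _.
by rewrite !mul0r oppr0.
Qed.

End weak_gradient.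

Section spacetime.
Context {R : realType} {n : nat}.
Implicit Types (k rho s : R) (T : \bar R).

(** The time cutoff is constant 1 on [[- a, a]]. With [a] beyond the final time considered, the time
    derivative disappears from the weak form and nothing happens at [t = 0]. *)
Definition spacetime_bump a c k rho (z : R * 'rV[R]_n.+1) : R :=
  cutoff a c z.1 * bumpexp k rho z.2.

Lemma spacetime_test_bump T a c k rho : 0 < a -> a < c -> (c%:E < T)%E ->
  spacetime_test T (spacetime_bump a c k rho).
Proof.
move=> a0 ac cT; split.
  apply: (@smoothM _ _ (fun z : R * 'rV[R]_n.+1 => cutoff a c z.1)
    (fun z : R * 'rV[R]_n.+1 => bumpexp k rho z.2)).
    exact/smooth_fst/smooth_cutoff.
  exact/smooth_snd/smooth_bumpexp.
exists (`[0, c]%classic `*` cbox (rho + 1)); split.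
- apply: compact_setX; [exact: segment_compact|exact: compact_cbox].
- move=> [s x] [/= + _]; rewrite in_itv/= => /andP[s0 sc]; split => //; split => //.
  by apply: le_lt_trans cT; rewrite lee_fin.
- move=> [s x] [[/= s0 sT] _] /not_andP[] /=.
    rewrite in_itv/= s0/= => /negP; rewrite -ltNge => cs.
    by rewrite /spacetime_bump/= cutoff0 ?mul0r// ger0_norm// ltW.
  by move=> xb; rewrite /spacetime_bump/= bumpexp0 ?mulr0.
Qed.

Lemma dx_spacetime_bump a c k rho i s x : a < c -> `|s| <= a ->
  dx i (spacetime_bump a c k rho) s x = 'D_(unit_vec i) (bumpexp k rho) x.
Proof.
move=> ac sa; rewrite /dx /derive.
have -> // : (fun h : R => h^-1 *: ((spacetime_bump a c k rho \o shift (s, x))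
   (h *: (0, unit_vec i)) - spacetime_bump a c k rho (s, x))) =
  (fun h : R => h^-1 *: ((bumpexp k rho \o shift x) (h *: unit_vec i) - bumpexp k rho x)).
apply/funext => h; rewrite /spacetime_bump /= scaler0 add0r.
by rewrite cutoff1// !mul1r.
Qed.

Lemma dt_spacetime_bump a c k rho s x : a < c -> `|s| < a ->
  dt (spacetime_bump a c k rho) s x = 0.
Proof.
move=> ac sa; rewrite /dt.
transitivity ('D_(1, 0) (fun z : R * 'rV[R]_n.+1 => bumpexp k rho z.2) (s, x)).
  apply: near_eq_derive.
  have : \forall z \near (s, x), `|z.1| < a.
    have cN : {for (s, x), continuous (fun z : R * 'rV[R]_n.+1 => `|z.1|)}.
      apply: (@continuous_comp _ _ _ (fun z : R * 'rV[R]_n.+1 => z.1) (fun y : R => `|y|)).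
        exact: cvg_fst.
      exact: norm_continuous.
    exact: cN (lt_nbhsl sa).
  by apply: filterS => z za; rewrite /spacetime_bump cutoff1 ?mul1r// ltW.
rewrite /derive (_ : (fun h => _) = cst 0).
  exact: lim_cst.
by apply/funext => h /=; rewrite scaler0 add0r subrr scaler0.
Qed.

End spacetime.

(** * Energy solutions tested against plane waves *)

Section jensen.
Context {R : realType}.
Implicit Types (p A v : R).

(** The graph of [v^p] lies above its tangent line at [A]; this is Young's inequality for the pair
    [v], [A^(p-1)]. *)
Lemma powR_tangent p A v : 1 < p -> 0 <= A -> 0 <= v ->
  p * A `^ (p - 1) * v - (p - 1) * A `^ p <= v `^ p.
Proof.
move=> p1 A0 v0; pose q := p / (p - 1).
have q0 : 0 < q by rewrite divr_gt0; lra.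
have pq : p^-1 + q^-1 = 1.
  by rewrite /q; field; apply/andP; split; rewrite gt_eqF//; lra.
have := @conjugate_powR _ v (A `^ (p - 1)) p q v0 (powR_ge0 _ _) _ q0 pq.
move=> /(_ ltac:(lra)).
rewrite -powRrM (_ : (p - 1) * q = p); last first.
  by rewrite /q mulrC divfK// gt_eqF//; lra.
rewrite (_ : q^-1 = (p - 1) / p); last by rewrite /q invf_div.
move=> H.
have p0 : 0 < p by lra.
have : p * (v * A `^ (p - 1)) <= p * (v `^ p / p + A `^ p * ((p - 1) / p)).
  by rewrite ler_pM2l.
rewrite (_ : p * (v `^ p / p + A `^ p * ((p - 1) / p)) = v `^ p + (p - 1) * A `^ p).
  by move=> ?; lra.
by field; rewrite gt_eqF.
Qed.

(** Integrating the tangent-line inequality against [f] avoids normalising [f dx] to a probability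
    measure, and an upper bound [M] of its mass suffices. Here [f] will be the test function cut
    down to a smaller ball and [g] the full one. *)
Lemma weighted_jensen n (f g w : 'rV[R]_n -> R) p M : 1 < p -> 0 < M ->
  L2 f -> L2 w -> measurable_fun setT g ->
  (forall x, 0 <= f x) -> (forall x, f x <= g x) ->
  (\int[leb R n]_x (f x)%:E <= M%:E)%E ->
  (\int[leb R n]_x (`|w x| `^ p * g x)%:E < +oo)%E ->
  `|pairing f w| `^ p * M `^ (1 - p) <= \int[leb R n]_x (`|w x| `^ p * g x).
Proof.
move=> p1 M0 Lf Lw mg f0 fg fM wg.
have mf := L2_measurable Lf; have mw := L2_measurable Lw.
have mnw : measurable_fun setT (fun x => `|w x|) by exact: measurableT_comp.
have mwp : measurable_fun setT (fun x => `|w x| `^ p).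
  exact: (measurableT_comp (measurable_powR _)).
have g0 x : 0 <= g x by exact: le_trans (f0 x) (fg x).
have if_ : (leb R n).-integrable setT (EFin \o f).
  apply/integrableP; split; first exact/measurable_EFinP.
  apply: le_lt_trans (ltry M); apply: le_trans fM.
  by under eq_integral do rewrite /= ger0_norm//.
have iwg : (leb R n).-integrable setT (fun x => (`|w x| `^ p * g x)%:E).
  apply/integrableP; split; first by apply/measurable_EFinP; exact: measurable_funM.
  by under eq_integral do rewrite gee0_abs ?lee_fin ?mulr_ge0 ?powR_ge0//.
have iwf : (leb R n).-integrable setT (fun x => (`|w x| `^ p * f x)%:E).
  apply: le_integrable iwg => //.
    by apply/measurable_EFinP; exact: measurable_funM.
  move=> x _; rewrite !gee0_abs ?lee_fin ?mulr_ge0 ?powR_ge0//.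
  by rewrite ler_wpM2l ?powR_ge0.
have inwf : (leb R n).-integrable setT (fun x => (`|w x| * f x)%:E).
  rewrite (_ : (fun x => _) = abse \o (fun x => (w x * f x)%:E)).
    exact/integrable_abse/L2M_integrable.
  by apply/funext => x; rewrite /= normrM [`|f x|]ger0_norm.
(* This tangent point gives [p A^(p-1) (A M) - (p-1) A^p M = A^p M], which is the claimed lower
   bound. *)
pose A := `|pairing f w| / M.
have A0 : 0 <= A by rewrite divr_ge0// ltW.
have le1 : \int[leb R n]_x (`|w x| `^ p * f x) <= \int[leb R n]_x (`|w x| `^ p * g x).
  by apply: le_Rintegral => // x _; rewrite ler_wpM2l ?powR_ge0.
apply: le_trans le1.
have le2 : \int[leb R n]_x (p * A `^ (p - 1) * (`|w x| * f x) - (p - 1) * A `^ p * f x)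
   <= \int[leb R n]_x (`|w x| `^ p * f x).
  apply: le_Rintegral => //.
    rewrite [X in _.-integrable _ X](_ : _ = ((fun x => (p * A `^ (p - 1))%:E * (`|w x| * f x)%:E) \- (fun x => ((p - 1) * A `^ p)%:E * (f x)%:E))%E)//.
    by apply: integrableB => //; exact: integrableZl.
  move=> x _; have := powR_tangent p1 A0 (normr_ge0 (w x)).
  by move=> /(ler_wpM2r (f0 x)); rewrite mulrBl !mulrA.
apply: le_trans le2.
rewrite RintegralB//; last 2 first.
  exact: (integrableZl measurableT _ inwf).
  exact: (integrableZl measurableT _ if_).
rewrite RintegralZl// RintegralZl//.
have le3 : `|pairing f w| <= \int[leb R n]_x (`|w x| * f x).
  apply: (le_trans (le_normr_Rintegral measurableT (L2M_integrable Lw Lf))).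
  rewrite (@eq_Rintegral _ _ _ _ _ (fun x => `|w x| * f x))// => x _.
  by rewrite normrM [`|f _|]ger0_norm.
have le4 : \int[leb R n]_x f x <= M.
  by rewrite -lee_fin /Rintegral fineK ?integrable_fin_num.
have pA : 0 <= p * A `^ (p - 1) by rewrite mulr_ge0 ?powR_ge0//; lra.
have pA' : 0 <= (p - 1) * A `^ p by rewrite mulr_ge0 ?powR_ge0//; lra.
have := ler_wpM2l pA le3; have := ler_wpM2l pA' le4.
suff -> : `|pairing f w| `^ p * M `^ (1 - p) = p * A `^ (p - 1) * `|pairing f w| - (p - 1) * A `^ p * M by lra.
have PA : `|pairing f w| = A * M by rewrite /A divfK// gt_eqF.
rewrite PA powRM ?(ltW M0)//.
have Mp : M `^ p * M `^ (1 - p) = M.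
  rewrite -powRD; last by apply/implyP => _; rewrite gt_eqF.
  by rewrite addrC subrK powRr1// ltW.
have Ap : A `^ (p - 1) * A = A `^ p.
  by rewrite mulrC mulr_powRB1//; lra.
rewrite -[LHS]mulrA Mp -Ap; ring.
Qed.

End jensen.

(** * Scalar calculus of the pairings with [u] and [u_t] *)

Section C1_L2.
Context {R : realType} {n : nat}.
Variables (T : \bar R) (u ut : R -> 'rV[R]_n -> R).
Hypothesis uC1 : in_C1_L2 T u ut.
Implicit Types (f : 'rV[R]_n -> R) (t s : R).

Lemma C1_L2_quotient_L2 t h : time_dom T t -> time_dom T (t + h) ->
  L2 (fun x => (u (t + h) x - u t x) / h).
Proof.
move=> Tt Th; have [Lu _ _] := uC1.
have := L2_lin h^-1 (Lu _ Th).1 (L2_lin (- h^-1) (Lu _ Tt).1 (L2_lin (-1) (Lu _ Tt).1 (Lu _ Tt).1)).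
by congr (L2 _); apply/funext => x; ring.
Qed.

Lemma pair_quotient f t h : L2 f -> time_dom T t -> time_dom T (t + h) ->
  pairing f (fun x => (u (t + h) x - u t x) / h) =
  (pairing f (u (t + h)) - pairing f (u t)) / h.
Proof.
move=> Lf Tt Th; have [Lu _ _] := uC1.
rewrite (_ : (fun x => _) = (fun x => h^-1 * u (t + h) x + ((- h^-1) * u t x + 0 * u t x))); last first.
  by apply/funext => x; ring.
have L0 : L2 (fun x => 0 * u t x).
  have := L2_lin (-1) (Lu _ Tt).1 (Lu _ Tt).1.
  by congr (L2 _); apply/funext => x; ring.
rewrite pair_lin//; [|exact: (Lu _ Th).1|exact: (L2_lin _ (Lu _ Tt).1 L0)].
rewrite pair_lin//; last exact: (Lu _ Tt).1.
rewrite [pairing f (fun x => 0 * u t x)](_ : _ = 0); first by ring.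
rewrite /pairing; under eq_Rintegral do rewrite mul0r mul0r.
by rewrite Rintegral_cst// mul0r.
Qed.

Lemma pair_quotient_cvg f t : L2 f -> time_dom T t ->
  (pairing f (u (t + h)) - pairing f (u t)) / h
    @[h --> within [set h | time_dom T (t + h)] 0^'] --> pairing f (ut t).
Proof.
move=> Lf Tt; have [Lu uq _] := uC1.
have LutN : L2 (fun x => (-1) * ut t x + 0 * ut t x).
  apply: L2_lin; first exact: (Lu _ Tt).2.
  have := L2_lin (-1) (Lu _ Tt).2 (Lu _ Tt).2.
  by congr (L2 _); apply/funext => x; ring.
have Lw h : time_dom T (t + h) -> L2 (fun x => (u (t + h) x - u t x) / h - ut t x).
  move=> Th; have := L2_lin 1 (C1_L2_quotient_L2 Tt Th) LutN.
  by congr (L2 _); apply/funext => x; ring.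
have pE h : time_dom T (t + h) ->
  pairing f (fun x => (u (t + h) x - u t x) / h - ut t x) =
  (pairing f (u (t + h)) - pairing f (u t)) / h - pairing f (ut t).
  move=> Th; rewrite -pair_quotient//.
  rewrite (_ : (fun x => _ - ut t x) = (fun x => (-1) * ut t x + (u (t + h) x - u t x) / h)).
    rewrite pair_lin//; [by ring|exact: (Lu _ Tt).2|exact: C1_L2_quotient_L2].
  by apply/funext => x; ring.
have H : pairing f (fun x => (u (t + h) x - u t x) / h - ut t x)
    @[h --> within [set h | time_dom T (t + h)] 0^'] --> (0 : R).
  apply: pair_cvg0 => //; last exact: uq.
  by near=> h; apply: Lw; near: h; exact: withinT.
apply/cvgrPdist_lt => e e0.
have /cvgr0Pnorm_lt/(_ e e0) H' := H.
near=> h; have Th : time_dom T (t + h) by near: h; exact: withinT.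
rewrite distrC -pE//; near: h; exact: H'.
Unshelve. all: by end_near. Qed.

Lemma pair_ut_cvg f t : L2 f -> time_dom T t ->
  pairing f (ut s) @[s --> within (time_dom T) (nbhs t)] --> pairing f (ut t).
Proof.
move=> Lf Tt; have [Lu _ utc] := uC1.
have Ls s : time_dom T s -> L2 (ut s \- ut t).
  move=> Ts; have := L2_lin (-1) (Lu _ Tt).2 (Lu _ Ts).2.
  by congr (L2 _); apply/funext => x /=; ring.
have pE s : time_dom T s -> pairing f (ut s \- ut t) = pairing f (ut s) - pairing f (ut t).
  move=> Ts; rewrite (_ : ut s \- ut t = (fun x => (-1) * ut t x + ut s x)).
    by rewrite pair_lin//; [ring|exact: (Lu _ Tt).2|exact: (Lu _ Ts).2].
  by apply/funext => x /=; ring.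
have H : pairing f (ut s \- ut t) @[s --> within (time_dom T) (nbhs t)] --> (0 : R).
  apply: pair_cvg0 => //; last exact: utc.
  by near=> s; apply: Ls; near: s; exact: withinT.
apply/cvgrPdist_lt => e e0.
have /cvgr0Pnorm_lt/(_ e e0) H' := H.
near=> s; have Ts : time_dom T s by near: s; exact: withinT.
rewrite distrC -pE//; near: s; exact: H'.
Unshelve. all: by end_near. Qed.

(* Backward difference quotients are supported in the ball at time [t]. *)
Lemma pair_ut_restrict f t (E : set 'rV[R]_n) : L2 f -> measurable E -> 0 < t ->
  time_dom T t ->
  (forall s, 0 <= s <= t -> {ae leb R n, forall x, ~ E x -> u s x = 0}) ->
  pairing f (ut t) = pairing (f \_ E) (ut t).
Proof.
move=> Lf mE t0 Tt uE; have [Lu uq _] := uC1.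
have mf := L2_measurable Lf.
have mfE : measurable_fun setT (f \_ E).
  apply/(measurable_restrictT _ _).1 => //; exact: measurable_funTS.
have LfE : L2 (f \_ E).
  apply: L2I => //; apply: le_lt_trans (L2_norm_lty Lf).
  rewrite /L2norm unlock; apply: gt0_ler_poweR; rewrite ?invr_ge0//.
  - by rewrite in_itv/= leey andbT integral_ge0// => x _; exact: poweR_ge0.
  - by rewrite in_itv/= leey andbT integral_ge0// => x _; exact: poweR_ge0.
  apply: ge0_le_integral => //.
  - by move=> x _; exact: poweR_ge0.
  - apply: (measurableT_comp (measurable_poweR _)).
    by apply: measurableT_comp => //; exact/measurable_EFinP.
  - apply: (measurableT_comp (measurable_poweR _)).
    by apply: measurableT_comp => //; exact/measurable_EFinP.
  - move=> x _; rewrite /= patchE; case: ifPn => // _.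
    by rewrite normr0 powR0// lee_fin powR_ge0.
have pE s : 0 <= s <= t -> pairing f (u s) = pairing (f \_ E) (u s).
  move=> st; have Ts : time_dom T s.
    have [_ tT] := Tt; split; first by case/andP: st.
    by apply: le_lt_trans tT; rewrite lee_fin; case/andP: st.
  apply: pair_ae => //; first exact: L2_measurable (Lu _ Ts).1.
  apply: filterS (uE s st) => x ux; rewrite patchE; case: ifPn => //.
  by rewrite notin_setE => /ux ->; rewrite !mul0r.
apply/eqP; rewrite -subr_eq0 -normr_le0; apply/ler_addgt0Pl => e e0; rewrite addr0.
have e2 : 0 < e / 2 by rewrite divr_gt0.
have /cvgrPdist_lt/(_ _ e2) H1 := pair_quotient_cvg Lf Tt.
have /cvgrPdist_lt/(_ _ e2) H2 := pair_quotient_cvg LfE Tt.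
have : \forall h \near within [set h | time_dom T (t + h)] (0 : R)^',
    `|pairing f (ut t) - (pairing f (u (t + h)) - pairing f (u t)) / h| < e / 2 /\
    `|pairing (f \_ E) (ut t) - (pairing (f \_ E) (u (t + h)) - pairing (f \_ E) (u t)) / h| < e / 2.
  exact: filterI H1 H2.
rewrite near_withinE => -[d /= d0 H].
(* The bound [d / 2] keeps [h] where both quotients are close to their limits, and the bound [t]
   keeps [t + h] in the time interval. *)
pose h := - Order.min (d / 2) t.
have h1 : 0 < Order.min (d / 2) t by rewrite lt_min t0 divr_gt0.
have h2 : Order.min (d / 2) t <= d / 2 by rewrite ge_min lexx.
have h3 : Order.min (d / 2) t <= t by rewrite ge_min lexx orbT.
have [tT0 tT] := Tt.
have Th : time_dom T (t + h).
  split; first by rewrite /h; lra.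
  by apply: le_lt_trans tT; rewrite lee_fin /h; lra.
have [||//|] := H h.
- by rewrite /= sub0r normrN /h normrN gtr0_norm//; lra.
- by rewrite /h oppr_eq0 gt_eqF.
rewrite -!pE; [|by rewrite /h; lra..].
rewrite !ltr_norml => /andP[? ?] /andP[? ?].
by rewrite ler_norml; apply/andP; split; lra.
Qed.

End C1_L2.

(** * The tested equation and its source term *)

Section energy.
Context {R : realType} {n : nat}.
Variables (p r eps : R) (b m : R -> R) (u1 : 'rV[R]_n.+1 -> R).
Variables (T : \bar R) (u ut : R -> 'rV[R]_n.+1 -> R) (k tau : R).
Hypotheses (p1 : 1 < p) (r0 : 0 < r) (tau0 : 0 < tau) (tauT : (tau%:E < T)%E).
Hypotheses (uH1 : in_C_H1 T u) (uC1 : in_C1_L2 T u ut) (uLp : in_Lp_loc p T ut).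
Hypothesis usupp : forall t, time_dom T t -> ess_support (u t) `<=` eball (r + t).
Hypothesis uweak : forall t Phi, time_dom T t -> spacetime_test T Phi ->
  weak_form p eps b m u1 u ut t Phi.

Let rho := r + tau.
Let Psi := bumpexp k rho : 'rV[R]_n.+1 -> R.
Let U t := pairing Psi (u t).
Let P t := pairing Psi (ut t).
Let N s := \int[leb R n.+1]_x (`|ut s x| `^ p * Psi x).

Let LPsi : L2 Psi.
Proof. by apply: L2_bumpexp; rewrite /rho addr_ge0// ltW. Qed.

Lemma time_dom_le t : 0 <= t <= tau -> time_dom T t.
Proof.
by move=> /andP[t0 tt]; split => //; apply: le_lt_trans tauT; rewrite lee_fin.
Qed.

Lemma u_outside t : 0 <= t <= tau ->
  {ae leb R n.+1, forall x, ~ eball (r + t) x -> u t x = 0}.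
Proof. by move=> tt; apply: ess_support_ae; exact/usupp/time_dom_le. Qed.

Lemma eball_le (s t : R) : s <= t -> @eball R n.+1 s `<=` eball t.
Proof. by move=> st x; rewrite /eball/= => H; exact: lt_le_trans H st. Qed.

Lemma u_outside_rho t : 0 <= t <= tau ->
  {ae leb R n.+1, forall x, ~ eball rho x -> u t x = 0}.
Proof.
move=> tt; apply: filterS (u_outside tt) => x H xr; apply: H => xs; apply: xr.
by apply: eball_le xs; rewrite /rho lerD2l; case/andP: tt.
Qed.

Lemma energy_identity t : 0 <= t <= tau ->
  P t - eps * pairing Psi u1 + prim (fun s => - (k ^+ 2 * U s)) t +
  prim (fun s => b s * P s + m s * U s) t = prim N t.
Proof.
move=> tt; have [Lu _ _] := uC1; have tau0' := tau0; have r0' := r0.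
have [c tc cT] : exists2 c, tau < c & (c%:E < T)%E.
  case: T tauT => [T'|_|//]; last by exists (tau + 1); rewrite ?ltry// ltrDl.
  by rewrite lte_fin => ?; exists ((tau + T') / 2); rewrite ?lte_fin; lra.
(* The plateau of the time cutoff must reach strictly beyond [tau], so that the time derivative of
   the test function vanishes up to and including [tau]. *)
pose a := (tau + c) / 2.
have ac : a < c by rewrite /a; lra.
have ta : tau < a by rewrite /a; lra.
have a0 : 0 < a by lra.
have := uweak (time_dom_le tt) (@spacetime_test_bump R n T a c k rho a0 ac cT).
have PhiE s x : 0 <= s <= tau -> spacetime_bump a c k rho (s, x) = Psi x.
  move=> /andP[s0 st]; rewrite /spacetime_bump/= cutoff1 ?mul1r//.
  by rewrite ger0_norm//; lra.
have st0 s : s \in `[0, t]%classic -> 0 <= s <= tau.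
  rewrite inE/= in_itv/= => /andP[s0 st].
  by rewrite s0 (le_trans st)//; case/andP: tt.
rewrite /weak_form.
rewrite (_ : \int[leb R n.+1]_x (ut t x * _) = P t); last first.
  by apply: eq_Rintegral => x _; rewrite PhiE.
rewrite (_ : \int[leb R n.+1]_x (u1 x * _) = pairing Psi u1); last first.
  by apply: eq_Rintegral => x _; rewrite PhiE// lexx ltW.
rewrite (_ : \int[lebesgue_measure]_(s in `[0, t]) \int[leb R n.+1]_x (ut s x * _) = 0); last first.
  rewrite (@eq_Rintegral _ _ _ _ _ (cst 0)); first by rewrite Rintegral_cst// mul0r.
  move=> s /st0 /andP[s0 st]; rewrite (@eq_Rintegral _ _ _ _ _ (cst 0)).
    by rewrite Rintegral_cst// mul0r.
  by move=> x _; rewrite dt_spacetime_bump ?mulr0// ger0_norm//; lra.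
rewrite subr0.
rewrite (_ : \int[lebesgue_measure]_(s in `[0, t]) \int[leb R n.+1]_x (\sum_(i < n.+1) _) =
  prim (fun s => - (k ^+ 2 * U s)) t); last first.
  apply: eq_Rintegral => s /st0 ss.
  rewrite -(weak_gradient_bumpexp k (rho := rho)); last 3 first.
  - by rewrite /rho; lra.
  - by have [H _] := uH1; apply: H; exact: time_dom_le.
  - exact: u_outside_rho.
  apply: eq_Rintegral => x _; apply: eq_bigr => i _.
  by rewrite dx_spacetime_bump// ger0_norm; case/andP: ss => //; lra.
rewrite (_ : \int[lebesgue_measure]_(s in `[0, t]) \int[leb R n.+1]_x ((b s * _ + _) * _) =
  prim (fun s => b s * P s + m s * U s) t); last first.
  apply: eq_Rintegral => s /st0 ss; have Ts := time_dom_le ss.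
  have L0 : L2 (fun x => m s * u s x + 0 * u s x).
    apply: L2_lin; first exact: (Lu _ Ts).1.
    have := L2_lin (-1) (Lu _ Ts).1 (Lu _ Ts).1.
    by congr (L2 _); apply/funext => x; ring.
  have <- : pairing Psi (fun x => m s * u s x + 0 * u s x) = m s * U s.
    rewrite /pairing -RintegralZl//; last first.
      by apply: L2M_integrable => //; exact: (Lu _ Ts).1.
    by apply: eq_Rintegral => x _; ring.
  rewrite -pair_lin//; last exact: (Lu _ Ts).2.
  by apply: eq_Rintegral => x _; rewrite PhiE//; ring.
move=> ->; apply: eq_Rintegral => s /st0 ss.
by apply: eq_Rintegral => x _; rewrite PhiE.
Qed.

Let F (z : R * 'rV[R]_n.+1) : R := `|ut z.1 z.2| `^ p * Psi z.2.
Let D : set (R * 'rV[R]_n.+1) := `[0, tau]%classic `*` setT.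

Let mPsi : measurable_fun setT Psi.
Proof. by apply: continuous_measurable_rV; apply: smooth_continuous; exact: smooth_bumpexp. Qed.

Let mD : measurable D.
Proof. by apply: measurableX => //; exact: measurable_itv. Qed.

Let mT : measurable (time_dom T `*` [set: 'rV[R]_n.+1]).
Proof.
apply: measurableX => //; case: T => [T'||].
- rewrite (_ : time_dom _ = `[0, T'[%classic); first exact: measurable_itv.
  by apply/seteqP; split => t; rewrite /time_dom/= in_itv/= lte_fin => /andP.
- rewrite (_ : time_dom _ = `[0, +oo[%classic); first exact: measurable_itv.
  by apply/seteqP; split => t; rewrite /time_dom/= in_itv/= ltry andbT => // -[].
- rewrite (_ : time_dom _ = set0); first exact: measurable0.
  by apply/seteqP; split => // t [].
Qed.

Let itv_time_dom t : `[0, tau]%classic t -> time_dom T t.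
Proof. by rewrite /= in_itv/=; exact: time_dom_le. Qed.

Let mF : measurable_fun D F.
Proof.
apply: measurable_funM; last first.
  by apply: measurable_funTS; exact: measurableT_comp measurable_snd.
apply: (measurableT_comp (measurable_powR _)).
apply: measurableT_comp => //.
by apply: measurable_funS uLp.1 => // -[s x] /= [ss _];
  split => //; exact: itv_time_dom.
Qed.

Let G := (EFin \o F) \_ D.

Let G0 z : (0 <= G z)%E.
Proof.
rewrite /G patchE; case: ifPn => // _.
by rewrite lee_fin mulr_ge0 ?powR_ge0 ?bumpexp_ge0.
Qed.

Let mG : measurable_fun setT G.
Proof. by apply/(measurable_restrictT _ _).1 => //; exact/measurable_EFinP. Qed.

(** [Psi] vanishes outside a compact box and is at most [e^(|k| (rho + 1))] on it, so the local
    [L^p] bound on [u_t] applies. *)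
Let intG : (\int[@lebesgue_measure R \x leb R n.+1]_z G z < +oo)%E.
Proof.
pose K : set (R * 'rV[R]_n.+1) := `[0, tau]%classic `*` cbox (rho + 1).
have cK : compact K by apply: compact_setX; [exact: segment_compact|exact: compact_cbox].
have KT : K `<=` time_dom T `*` setT.
  by move=> [s x] /= [ss _]; split => //; exact: itv_time_dom.
have mK : measurable K by apply: measurableX; [exact: measurable_itv|exact: measurable_box].
have iK := uLp.2 K cK KT.
pose M := expR (`|k| * (rho + 1)).
have : (M%:E * \int[@lebesgue_measure R \x leb R n.+1]_(z in K) (`|ut z.1 z.2| `^ p)%:E < +oo)%E.
  by rewrite lte_mul_pinfty// lee_fin expR_ge0.
apply: le_lt_trans.
have mut : measurable_fun K (fun z => (`|ut z.1 z.2| `^ p)%:E).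
  apply/measurable_EFinP; apply: (measurableT_comp (measurable_powR _)).
  by apply: measurableT_comp => //; apply: measurable_funS uLp.1.
rewrite -ge0_integralZl//; last by rewrite lee_fin expR_ge0.
rewrite [leRHS]integral_mkcond; apply: ge0_le_integral => //.
- apply/(measurable_restrictT _ _).1 => //.
  exact: measurable_funeM.
- move=> [s x] _; rewrite /G !patchE; case: ifPn => [sD|sD].
    case: ifPn => [|/negP xK].
      rewrite inE => -[_ /= xb].
      rewrite /F /= -EFinM lee_fin mulrC ler_wpM2r ?powR_ge0//.
      apply: (le_trans (bumpexp_le _ _ _)); rewrite ler_expR.
      apply: (le_trans (ler_norm _)); rewrite normrM ler_wpM2l//.
    rewrite /F /= /Psi bumpexp0 ?mulr0// => xb; apply: xK.
    by move: sD; rewrite !inE => -[].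
  by case: ifPn => // _; rewrite mule_ge0// lee_fin ?expR_ge0 ?powR_ge0.
Qed.

Let nE s : 0 <= s <= tau -> fubini_F (leb R n.+1) G s = (\int[leb R n.+1]_x (F (s, x))%:E)%E.
Proof.
move=> ss; apply: eq_integral => x _; rewrite /G patchE ifT// inE; split => //=.
Qed.

Let iG : lebesgue_measure.-integrable setT (fubini_F (leb R n.+1) G).
Proof.
apply/integrableP; split.
  by apply: measurable_fun_fubini_tonelli_F.
under eq_integral.
  move=> s _; rewrite gee0_abs; last by apply: integral_ge0.
  over.
by rewrite -fubini_tonelli1.
Qed.

Lemma source_integrable : lebesgue_measure.-integrable `[0, tau] (EFin \o N).
Proof.
have iGs : lebesgue_measure.-integrable `[0, tau] (fubini_F (leb R n.+1) G).
  by apply: integrableS iG.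
pose n' (s : R) : \bar R := (\int[leb R n.+1]_x (F (s, x))%:E)%E.
have iN : lebesgue_measure.-integrable `[0, tau] n'.
  apply: eq_integrable iGs => //.
  by move=> s; rewrite inE/= in_itv/= => ss; rewrite nE.
have mn' := measurable_int _ iN.
apply: le_integrable iN => //.
  apply/measurable_EFinP; exact: (measurableT_comp (fine_measurable measurableT) mn').
(* [fine] sends an infinite value to 0, so [|N| <= n'] holds at every [s]. *)
move=> s _ /=; rewrite /N /Rintegral -/(n' s).
by case: (n' s) => [x||] //=; rewrite normr0 leey.
Qed.

(** Only for almost every [s] is the space integral finite; elsewhere [N s] could be the default
    value 0. Cutting [Psi] down to [B_(r+s)] before applying Jensen makes the growth factor depend
    on [s] instead of [tau]; this uses the support of [u_t], known for [s > 0] by backward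
    quotients. *)
Lemma source_ge : 30 <= k -> {ae lebesgue_measure, forall s : R, 0 < s <= tau ->
  `|P s| `^ p * (ball_const n (r + s) * expR (k * (r + s))) `^ (1 - p) <= N s}.
Proof.
move=> k30; have tau0' := tau0; have r0' := r0.
have := integrable_ae measurableT iG; apply: filterS => s /= H ss.
have ss' : 0 <= s <= tau by case/andP: ss => /ltW -> ->.
have {}H := H I; rewrite nE// in H.
have [s0 st] := andP ss.
have mE := @measurable_eball R n.+1 (r + s).
rewrite /P (@pair_ut_restrict _ _ _ _ _ uC1 Psi s (eball (r + s)))//; last 2 first.
- exact: time_dom_le.
- move=> s' /andP[s'0 s's]; have s't : 0 <= s' <= tau by rewrite s'0 (le_trans s's).
  apply: filterS (u_outside s't) => x Hx xr; apply: Hx => xs; apply: xr.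
  by apply: eball_le xs; rewrite lerD2l.
have [Lu _ _] := uC1.
have f0 x : 0 <= (Psi \_ (eball (r + s))) x.
  by rewrite patchE; case: ifP => // _; exact: bumpexp_ge0.
have fg x : (Psi \_ (eball (r + s))) x <= Psi x.
  by rewrite patchE; case: ifP => // _; exact: bumpexp_ge0.
have mf : measurable_fun setT (Psi \_ (eball (r + s))).
  by apply/(measurable_restrictT _ _).1 => //; exact: measurable_funTS.
apply: weighted_jensen => //.
- rewrite mulr_gt0 ?expR_gt0// /ball_const; apply: mulr_gt0.
    by rewrite mulr_gt0 ?expR_gt0// ltr0n fact_gt0.
  by rewrite exprn_gt0// mulr_gt0// sqrtr_gt0; lra.
- apply: (@L2_cbox _ _ _ (rho + 1)) => //; first by rewrite /rho; lra.
    move=> x xr; apply/le_anti; rewrite f0 andbT.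
    by apply: (le_trans (fg x)); rewrite /Psi bumpexp0.
  have [M [M0 HM]] := cbox_bounded (s := rho + 1) ltac:(rewrite /rho; lra) (smooth_continuous (@smooth_bumpexp R n k rho)) (@bumpexp0 R n k rho).
  exists M; split => // x; rewrite ger0_norm//; apply: (le_trans (fg x)).
  by apply: le_trans (HM x); exact: ler_norm.
- exact: (Lu _ (time_dom_le ss')).2.
- apply: le_trans (exp_eball_le n _ _); [|lra|lra].
  rewrite [leRHS]integral_mkcond; apply: ge0_le_integral => //.
  + by move=> x _; rewrite lee_fin.
  + exact/measurable_EFinP.
  + apply/(measurable_restrictT _ _).1 => //; apply: measurable_funTS.
    apply/measurable_EFinP; apply: measurableT_comp; first exact: measurable_expR.
    by apply: measurable_funM => //; exact: measurable_rV_coord.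
  + move=> x _; rewrite !patchE; case: ifP => // _.
    by rewrite lee_fin bumpexp_le.
- by move: H; rewrite ge0_fin_numE// integral_ge0// => x _; rewrite lee_fin mulr_ge0 ?powR_ge0 ?bumpexp_ge0.
Qed.

End energy.

(** * Powers, weights and comparison of primitives *)

Section real_aux.
Context {R : realType}.
Implicit Types (p k r s t x : R) (f g : R -> R).

Lemma continuous_norm_powR p : 0 < p -> continuous (fun x : R => `|x| `^ p).
Proof.
move=> p0 x; have [->|x0] := eqVneq x 0.
  rewrite /continuous_at normr0 powR0 ?gt_eqF//; apply/cvgr0Pnorm_lt => e e0.
  pose d := e `^ p^-1.
  have d0 : 0 < d by rewrite powR_gt0.
  have ed : e = d `^ p by rewrite -powRrM mulVf ?powRr1 ?ltW// gt_eqF.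
  have : \forall y \near (0 : R), `|y| < d by exact: nbhs0_lt.
  apply: filterS => y yd; rewrite ger0_norm ?powR_ge0// ed.
  by apply: gt0_ltr_powR => //; rewrite ?nnegrE ?powR_ge0.
apply: (@continuous_comp R R R (fun y : R => `|y|) (fun y : R => y `^ p)).
  exact: norm_continuous.
apply: differentiable_continuous; apply/derivable1_diffP.
by apply: derivable_powR; rewrite in_itv/= andbT normr_gt0.
Qed.

Lemma expR_powR x p : expR x `^ p = expR (p * x).
Proof. by rewrite /powR gt_eqF ?expR_gt0// expRK. Qed.

Lemma sqrt_exprn x n : 0 <= x -> Num.sqrt x ^+ n = x `^ (n%:R / 2).
Proof.
by move=> x0; rewrite -powR12_sqrt// -powR_mulrn ?powR_ge0// -powRrM mulrC.
Qed.

Lemma ball_const_gt0 n rho : 0 < rho -> 0 < @ball_const R n rho.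
Proof.
move=> r0; rewrite /ball_const; apply: mulr_gt0.
  by rewrite mulr_gt0 ?expR_gt0// ltr0n fact_gt0.
by rewrite exprn_gt0// mulr_gt0// sqrtr_gt0 mulr_gt0.
Qed.

(** It comes down to [r + s <= (r + 1) (1 + s)] under the square root. *)
Lemma ball_const_le n r s : 0 < r -> 0 <= s ->
  ball_const n (r + s) <= ball_const n (r + 1) * (1 + s) `^ (n%:R / 2).
Proof.
move=> r0 s0; rewrite -sqrt_exprn; last lra.
rewrite /ball_const -!mulrA ler_wpM2l//.
rewrite ler_wpM2l ?expR_ge0// -exprMn.
apply: lerXn2r; rewrite ?nnegrE ?mulr_ge0 ?sqrtr_ge0//.
rewrite -mulrA ler_wpM2l// -sqrtrM; last lra.
by rewrite ler_wsqrtr//; nra.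
Qed.

(** The negative power [1 - p] reverses [ball_const_le]. The factor [e^((1-p)ks)] stays apart
    because it later cancels the [e^(-kt)] of the weight [w]. *)
Lemma source_weight n p k r s : 1 < p -> 0 < r -> 0 <= s ->
  (ball_const n (r + 1) * expR (k * r)) `^ (1 - p) *
    expR ((1 - p) * (k * s)) * (1 + s) `^ (- ((p - 1) * (n%:R / 2))) <=
  (ball_const n (r + s) * expR (k * (r + s))) `^ (1 - p).
Proof.
move=> p1 r0 s0.
have b1 : 0 < @ball_const R n (r + 1) by apply: ball_const_gt0; lra.
have b2 : 0 < ball_const n (r + s) by apply: ball_const_gt0; lra.
have s1 : 0 < (1 + s) `^ (n%:R / 2) by apply: powR_gt0; lra.
have -> : (1 + s) `^ (- ((p - 1) * (n%:R / 2))) = ((1 + s) `^ (n%:R / 2)) `^ (1 - p).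
  by rewrite -powRrM; congr powR; ring.
have x1 : 0 < ball_const n (r + 1) * expR (k * r) by apply: mulr_gt0 => //; exact: expR_gt0.
have x2 : 0 < ball_const n (r + s) * expR (k * (r + s)).
  by apply: mulr_gt0 => //; exact: expR_gt0.
have x3 : 0 < ball_const n (r + 1) * expR (k * r) * expR (k * s).
  by apply: mulr_gt0 => //; exact: expR_gt0.
have x4 : 0 < ball_const n (r + 1) * expR (k * r) * expR (k * s) * (1 + s) `^ (n%:R / 2).
  exact: mulr_gt0.
rewrite -(expR_powR (k * s) (1 - p)) -powRM ?expR_ge0 ?(ltW x1)//.
rewrite -powRM ?(ltW x3) ?(ltW s1)//.
have -> : 1 - p = - (p - 1) by ring.
rewrite !powRN lef_pV2 ?posrE; [|exact: powR_gt0|exact: powR_gt0].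
apply: ge0_ler_powR; rewrite ?nnegrE ?(ltW x2) ?(ltW x4)//; first lra.
rewrite mulrDr expRD.
have := ball_const_le n r0 s0.
move=> /(ler_wpM2r (mulr_ge0 (expR_ge0 (k * r)) (expR_ge0 (k * s)))).
by lra.
Qed.

Lemma primB f g t : continuous f -> continuous g ->
  prim (fun s => f s - g s) t = prim f t - prim g t.
Proof. by move=> cf cg; rewrite /prim RintegralB//; exact: continuous_integrable_itv. Qed.

Lemma prim_itvB f tau s t : 0 <= s -> s <= t -> t <= tau ->
  lebesgue_measure.-integrable `[0, tau] (EFin \o f) ->
  prim f t - prim f s = \int[lebesgue_measure]_(x in `]s, t]) f x.
Proof.
move=> s0 st tt fi; rewrite /prim Rintegral_itvB//.
by apply: integrableS fi => //; apply: subset_itvl; rewrite bnd_simp.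
Qed.

Lemma prim_ae_le f g tau : continuous f ->
  lebesgue_measure.-integrable `[0, tau] (EFin \o g) ->
  {ae lebesgue_measure, forall s : R, 0 < s <= tau -> f s <= g s} ->
  forall s t, 0 <= s -> s <= t -> t <= tau ->
  prim f t - prim f s <= prim g t - prim g s.
Proof.
move=> cf gi fg s t s0 st tt.
have fi : lebesgue_measure.-integrable `[0, tau] (EFin \o f).
  exact: continuous_integrable_itv.
rewrite (prim_itvB s0 st tt fi) (prim_itvB s0 st tt gi).
have sub : `]s, t] `<=` `[0, tau].
  by move=> x /=; rewrite !in_itv/= => /andP[? ?]; apply/andP; split; lra.
have fi' : lebesgue_measure.-integrable `]s, t] (EFin \o f) by exact: integrableS fi.
have gi' : lebesgue_measure.-integrable `]s, t] (EFin \o g) by exact: integrableS gi.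
(* The maximum equals [g] almost everywhere and dominates [f] everywhere, as the pointwise
   comparison of integrals requires. *)
pose gf x := Order.max (g x) (f x).
have mgf : measurable_fun `]s, t] gf.
  apply: measurable_maxr; apply/measurable_EFinP.
    exact: (measurable_int _ gi').
  exact: (measurable_int _ fi').
have ae : {ae lebesgue_measure, forall x, `]s, t]%classic x -> (EFin \o g) x = (EFin \o gf) x}.
  apply: (@filterS _ _ (ae_filter_ringOfSetsType lebesgue_measure) _ _ _ fg) => x H.
  rewrite /= in_itv/= => /andP[sx xt].
  by rewrite /gf max_l//; apply: H; apply/andP; split; lra.
have -> : \int[lebesgue_measure]_(x in `]s, t]) g x = \int[lebesgue_measure]_(x in `]s, t]) gf x.
  rewrite /Rintegral; congr fine; apply: ae_eq_integral => //.
    exact: (measurable_int _ gi').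
  exact/measurable_EFinP.
apply: le_Rintegral => //.
  have I : lebesgue_measure.-integrable `]s, t]
      ((abse \o (EFin \o g)) \+ (abse \o (EFin \o f)))%E.
    by apply: integrableD => //; exact: integrable_abse.
  apply: le_integrable I => //.
  - exact/measurable_EFinP.
  - move=> x _; rewrite /= lee_fin /gf [leRHS]ger0_norm ?addr_ge0//.
    by rewrite ler_norml; case: (leP (g x) (f x)) => _;
      have := ler_norm (g x); have := ler_norm (f x); have := ler_normr (f x) 0;
      have := ler_norm (- g x); have := ler_norm (- f x); rewrite !normrN;
      have := normr_ge0 (f x); have := normr_ge0 (g x); move=> *; apply/andP; split; lra.
by move=> x _; rewrite /gf le_max lexx orbT.
Qed.

(** In dimension one the inverse of [+oo] is 0, in agreement with [n / 2 = 0]; otherwise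
    [p_Gla - 1 = 2 / n] in dimension [n+1]. *)
Lemma Gla_exponentE n p : Gla_exponent n.+1 p = (p - 1) * (n%:R / 2) :> R.
Proof.
rewrite /Gla_exponent /p_Gla; case: n => [|n].
  by rewrite eqxx addye// invey mule0/= mul0r mulr0.
have n0 : n.+1%:R != 0 :> R by rewrite pnatr_eq0.
have n1 : n.+2%:R - 1 = n.+1%:R :> R by rewrite -[n.+2%:R]natr1 addrK.
rewrite ifF; last by rewrite -subr_eq0 n1 (negbTE n0).
rewrite n1 -EFinB.
have -> : 1 + 2 / n.+1%:R - 1 = 2 / n.+1%:R :> R by ring.
rewrite inver ifF; last by rewrite mulf_eq0 invr_eq0 (negbTE n0) pnatr_eq0.
by rewrite -EFinM /= invf_div.
Qed.

End real_aux.

(** * The averaged solution *)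

Section functional.
Context {R : realType} {n : nat}.
Implicit Types s t : R.
Variables (p r eps : R) (b db m : R -> R) (u1 : 'rV[R]_n.+1 -> R).
Variables (T : \bar R) (u ut : R -> 'rV[R]_n.+1 -> R) (k tau Vtot : R).
Hypotheses (p1 : 1 < p) (r0 : 0 < r) (tau1 : 1 <= tau) (tauT : (tau%:E < T)%E).
Hypotheses (uH1 : in_C_H1 T u) (uC1 : in_C1_L2 T u ut) (uLp : in_Lp_loc p T ut).
Hypothesis usupp : forall t, time_dom T t -> ess_support (u t) `<=` eball (r + t).
Hypothesis uweak : forall t Phi, time_dom T t -> spacetime_test T Phi ->
  weak_form p eps b m u1 u ut t Phi.
Hypothesis b_quot : forall t, 0 <= t ->
  (b (t + h) - b t) / h @[h --> within [set h | 0 <= t + h] 0^'] --> db t.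
Hypothesis db_cont : {within `[0, +oo[, continuous db}.
Hypothesis m_cont : {within `[0, +oo[, continuous m}.
Hypotheses (k30 : 30 <= k) (bk : forall t, 0 <= t -> `|b t| <= k).
Let v t := m t - db t / 2 - b t ^+ 2 / 4.
Hypothesis vV : continuous (fun s => v (clamp tau s)) ->
  prim (fun s => `|v (clamp tau s)|) tau <= Vtot.
Hypothesis Vk : 25 * Vtot <= k.

Let Psi := bumpexp k (r + tau) : 'rV[R]_n.+1 -> R.
Let U t := pairing Psi (u t).
Let P t := pairing Psi (ut t).
Hypotheses (U0 : 0 <= U 0) (P0 : 0 <= P 0).
Hypothesis A0 : 0 < P 0 + (b 0 / 2 + k) * U 0.

Let tau0 : 0 < tau. Proof. exact: lt_le_trans tau1. Qed.

Let LPsi : L2 Psi.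
Proof. by apply: L2_bumpexp; rewrite addr_ge0// ltW. Qed.

Let within_le (f : R -> R) (D : set R) t (x : R) :
  `[0, tau]%classic `<=` D -> f s @[s --> within D (nbhs t)] --> x ->
  f s @[s --> within `[0, tau] (nbhs t)] --> x.
Proof.
move=> sub fx; apply: cvg_trans fx; apply: cvg_app => A DA.
have {}DA : nbhs t [set s | D s -> A s] by exact: DA.
suff : nbhs t [set s | `[0, tau]%classic s -> A s] by [].
by apply: filterS DA => s H st; apply: H; exact: sub.
Qed.

Let cl_cont (f : R -> R) : {within `[0, +oo[, continuous f} ->
  continuous (f \o clamp tau).
Proof.
move=> /subspace_continuousP cf; apply: continuous_comp_clamp; first exact: ltW.
move=> t /andP[t0 _]; apply: (within_le (D := `[0, +oo[%classic)).
  by move=> s /=; rewrite !in_itv/= andbT => /andP[].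
by apply: cf; rewrite /= in_itv/= t0.
Qed.

Let cb : continuous (b \o clamp tau).
Proof.
apply: continuous_comp_clamp; first exact: ltW.
move=> t /andP[t0 _]; apply: (within_le (D := [set s | 0 <= s])).
  by move=> s /=; rewrite !in_itv/= => /andP[].
exact: quotient_cvg (b_quot t0).
Qed.

Let cm := cl_cont m_cont.
Let cdb := cl_cont db_cont.

Let itv_dom : `[0, tau]%classic `<=` time_dom T.
Proof. by move=> s /=; rewrite in_itv/=; exact: time_dom_le. Qed.

Let cU : continuous (U \o clamp tau).
Proof.
apply: continuous_comp_clamp; first exact: ltW.
move=> t tt; apply: (within_le itv_dom).
apply: (@quotient_cvg _ _ _ _ (P t)).
by apply: (pair_quotient_cvg uC1) => //; exact: time_dom_le tauT _ tt.
Qed.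

Let cP : continuous (P \o clamp tau).
Proof.
apply: continuous_comp_clamp; first exact: ltW.
move=> t tt; apply: (within_le itv_dom).
by apply: (pair_ut_cvg uC1) => //; exact: time_dom_le tauT _ tt.
Qed.

Let nbhs_itv t : 0 < t < tau -> nbhs t (time_dom T).
Proof.
move=> /andP[t0 tt]; near=> s; apply: itv_dom; rewrite /= in_itv/=.
apply/andP; split; apply/ltW; near: s; [exact: lt_nbhsr|exact: lt_nbhsl].
Unshelve. all: by end_near. Qed.

Let dU t : 0 < t < tau -> is_derive t 1 (U \o clamp tau) ((P \o clamp tau) t).
Proof.
move=> tt; have tt' : 0 <= t <= tau by case/andP: tt => /ltW -> /ltW ->.
rewrite /= clamp_id//; apply: is_derive_comp_clamp => //.
apply: (quotient_derive (nbhs_itv tt)).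
by apply: (pair_quotient_cvg uC1) => //; exact: time_dom_le tauT _ tt'.
Qed.

Let vh t := (m \o clamp tau) t - (db \o clamp tau) t / 2 - (b \o clamp tau) t ^+ 2 / 4.

Let cv : continuous vh.
Proof.
move=> t; apply: cvgB.
  by apply: cvgB; [exact: cm|apply: cvgMl; exact: cdb].
by apply: cvgMl; rewrite expr2; under eq_fun do rewrite expr2; apply: cvgM; exact: cb.
Qed.

Let dbh t : 0 < t < tau -> is_derive t 1 (b \o clamp tau)
  (2 * ((m \o clamp tau) t - vh t) - (b \o clamp tau) t ^+ 2 / 2).
Proof.
move=> tt; have tt' : 0 <= t <= tau by case/andP: tt => /ltW -> /ltW ->.
have -> : 2 * ((m \o clamp tau) t - vh t) - (b \o clamp tau) t ^+ 2 / 2 = db t.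
  by rewrite /vh /= clamp_id//; field.
apply: is_derive_comp_clamp => //.
apply: (@quotient_derive _ _ [set s | 0 <= s]).
  near=> s; apply/ltW; near: s; apply: lt_nbhsr; by case/andP: tt.
by apply: b_quot; case/andP: tt'.
Unshelve. all: by end_near. Qed.

Let g : R := (p - 1) * (n%:R / 2).
Let c0 : R := (ball_const n (r + 1) * expR (k * r)) `^ (1 - p).
Let dec t : R := (1 + clamp tau t) `^ (- g).
(** The Jensen lower bound of the source, a continuous function of time; it replaces the source from
    here on, so that [S] and [I] are differentiable. *)
Let K t : R := `|(P \o clamp tau) t| `^ p * (c0 * expR ((1 - p) * (k * clamp tau t)) * dec t).

Let cdec : continuous dec.
Proof.
move=> t; apply: (@continuous_comp _ _ _ (fun t => 1 + clamp tau t) (fun y : R => y `^ (- g))).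
  by apply: cvgD; [exact: cvg_cst|exact: continuous_clamp].
apply: differentiable_continuous; apply/derivable1_diffP.
apply: derivable_powR; rewrite in_itv/= andbT.
by have /andP[? _] := clamp_itv t (ltW tau0); lra.
Qed.

Let cK : continuous K.
Proof.
move=> t; apply: cvgM.
  apply: (@continuous_comp _ _ _ (P \o clamp tau) (fun y : R => `|y| `^ p)); first exact: cP.
  by apply: continuous_norm_powR; exact: lt_trans p1.
apply: cvgM; last exact: cdec.
apply: cvgMr.
apply: (@continuous_comp _ _ _ (fun t => (1 - p) * (k * clamp tau t)) expR).
  by apply: cvgMr; apply: cvgMr; exact: continuous_clamp.
exact: continuous_expR.
Qed.

Let c0_gt0 : 0 < c0.
Proof.
by rewrite powR_gt0// mulr_gt0 ?expR_gt0// ball_const_gt0// addr_gt0.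
Qed.

Let dec_gt0 t : 0 < dec t.
Proof.
by apply: powR_gt0; have /andP[? _] := clamp_itv t (ltW tau0); lra.
Qed.

Let B := prim (b \o clamp tau).
Let w t := expR (B t / 2 - k * t).
Let alpha t := w t * ((P \o clamp tau) t + ((b \o clamp tau) t / 2 + k) * (U \o clamp tau) t).
Let S := prim (fun s => K s - ((b \o clamp tau) s * (P \o clamp tau) s +
  (m \o clamp tau) s * (U \o clamp tau) s) - (- (k ^+ 2 * (U \o clamp tau) s))).

Let cbPmU : continuous (fun s => (b \o clamp tau) s * (P \o clamp tau) s +
  (m \o clamp tau) s * (U \o clamp tau) s).
Proof.
by move=> t; apply: cvgD; apply: cvgM; [exact: cb|exact: cP|exact: cm|exact: cU].
Qed.

Let ckU : continuous (fun s => - (k ^+ 2 * (U \o clamp tau) s)).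
Proof. by move=> t; apply: cvgN; apply: cvgMr; exact: cU. Qed.

(** By the energy identity [P - S] is a constant plus the primitive of the source minus that of [K],
    and the source dominates [K] almost everywhere. *)
Let PS s t : 0 <= s -> s <= t -> t <= tau ->
  S t - S s <= (P \o clamp tau) t - (P \o clamp tau) s.
Proof.
move=> s0 st tt.
have id x : 0 <= x <= tau -> P x = eps * pairing Psi u1 -
    prim (fun s => - (k ^+ 2 * (U \o clamp tau) s)) x -
    prim (fun s => (b \o clamp tau) s * (P \o clamp tau) s +
      (m \o clamp tau) s * (U \o clamp tau) s) x +
    prim (fun s => \int[leb R n.+1]_x (`|ut s x| `^ p * Psi x)) x.
  move=> xt.
  have := energy_identity k r0 tau0 tauT uH1 uC1 usupp uweak xt.
  rewrite -/Psi => <-.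
  rewrite (@eq_prim _ (fun s => - (k ^+ 2 * (U \o clamp tau) s)) (fun s => - (k ^+ 2 * pairing Psi (u s))) x); last first.
    by move=> y yx; rewrite /= clamp_id//; case/andP: yx => -> /le_trans ->//; case/andP: xt.
  rewrite (@eq_prim _ (fun s => (b \o clamp tau) s * (P \o clamp tau) s + (m \o clamp tau) s * (U \o clamp tau) s) (fun s => b s * pairing Psi (ut s) + m s * pairing Psi (u s)) x); last first.
    by move=> y yx; rewrite /= clamp_id//; case/andP: yx => -> /le_trans ->//; case/andP: xt.
  by rewrite /P; ring.
have KN : {ae lebesgue_measure, forall x : R, 0 < x <= tau ->
    K x <= \int[leb R n.+1]_y (`|ut x y| `^ p * Psi y)}.
  have H := source_ge p1 r0 tau0 tauT uC1 uLp usupp k30.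
  apply: (@filterS _ _ (ae_filter_ringOfSetsType lebesgue_measure) _ _ _ H) => x Hx xt.
  apply: (le_trans _ (Hx xt)).
  have /andP[x0 xtau] := xt.
  rewrite /K /dec /= clamp_id; last by rewrite (ltW x0).
  apply: ler_wpM2l; first exact: powR_ge0.
  by apply: source_weight => //; exact: ltW.
have := prim_ae_le cK (source_integrable r k tauT uLp) KN s0 st tt.
have sE x : S x = prim K x - prim (fun s => (b \o clamp tau) s * (P \o clamp tau) s +
      (m \o clamp tau) s * (U \o clamp tau) s) x - prim (fun s => - (k ^+ 2 * (U \o clamp tau) s)) x.
  rewrite /S primB//; last first.
    by move=> y; apply: cvgB; [exact: cK|exact: cbPmU].
  by rewrite primB.
rewrite !sE /= [clamp _ t]clamp_id ?tt ?(le_trans s0)// [clamp _ s]clamp_id ?s0 ?(le_trans st)//.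
rewrite (id t) ?tt ?(le_trans s0)// (id s) ?s0 ?(le_trans st)//.
lra.
Qed.

Let h t : R := expR (- ((p - 1) / 2) * B t) * dec t.
Let I := prim (fun t => w t * K t - w t * vh t * (U \o clamp tau) t).
Let Ih := prim (fun t => h t * `|alpha t| `^ p).

Let cB : continuous B. Proof. exact: continuous_prim. Qed.

Let cw : continuous w.
Proof.
move=> t; apply: (@continuous_comp _ _ _ (fun t => B t / 2 - k * t) expR).
  apply: cvgB; first by apply: cvgMl; exact: cB.
  by apply: cvgMr; exact: cvg_id.
exact: continuous_expR.
Qed.

Let calpha : continuous alpha.
Proof.
move=> x; apply: cvgM; first exact: cw.
apply: cvgD; first exact: cP.
apply: cvgM; last exact: cU.
by apply: cvgD; [apply: cvgMl; exact: cb|exact: cvg_cst].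
Qed.

Let ch : continuous h.
Proof.
move=> t; apply: cvgM; last exact: cdec.
apply: (@continuous_comp _ _ _ (fun t => - ((p - 1) / 2) * B t) expR).
  by apply: cvgMr; exact: cB.
exact: continuous_expR.
Qed.

Let cdI : continuous (fun t => w t * K t - w t * vh t * (U \o clamp tau) t).
Proof.
move=> t; apply: cvgB; first by apply: cvgM; [exact: cw|exact: cK].
by apply: cvgM; [apply: cvgM; [exact: cw|exact: cv]|exact: cU].
Qed.

Let cdIh : continuous (fun t => h t * `|alpha t| `^ p).
Proof.
move=> t; apply: cvgM; first exact: ch.
apply: (@continuous_comp _ _ _ alpha (fun y : R => `|y| `^ p)); first exact: calpha.
by apply: continuous_norm_powR; exact: lt_trans p1.
Qed.

Let cnv : continuous (fun t => `|vh t|).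
Proof.
move=> t; apply: (@continuous_comp _ _ _ vh (fun y : R => `|y|)); first exact: cv.
exact: norm_continuous.
Qed.

Let dB t : 0 < t < tau -> is_derive t 1 B ((b \o clamp tau) t).
Proof. by move=> /andP[t0 _]; exact: is_derive_prim. Qed.

Let dw t : 0 < t < tau -> is_derive t 1 w (w t * ((b \o clamp tau) t / 2 - k)).
Proof.
move=> t0; have ? := dB t0.
rewrite /w; apply: is_derive_eq.
rewrite ?scaler0 /GRing.scale/=; ring.
Qed.

Let dS t : 0 < t < tau -> is_derive t 1 S
  (K t - (b \o clamp tau) t * (P \o clamp tau) t -
   ((m \o clamp tau) t - k ^+ 2) * (U \o clamp tau) t).
Proof.
move=> /andP[t0 _].
set l := (l in is_derive _ _ _ l).
have -> : l = K t - ((b \o clamp tau) t * (P \o clamp tau) t +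
  (m \o clamp tau) t * (U \o clamp tau) t) - (- (k ^+ 2 * (U \o clamp tau) t)).
  by rewrite /l; ring.
apply: (is_derive_prim (f := fun s => K s - ((b \o clamp tau) s * (P \o clamp tau) s +
  (m \o clamp tau) s * (U \o clamp tau) s) - (- (k ^+ 2 * (U \o clamp tau) s)))) => // x.
apply: cvgB; last exact: ckU.
by apply: cvgB; [exact: cK|exact: cbPmU].
Qed.

Let cS : continuous S.
Proof.
apply: continuous_prim => x; apply: cvgB; last exact: ckU.
by apply: cvgB; [exact: cK|exact: cbPmU].
Qed.

Let dI t : 0 < t < tau -> is_derive t 1 I (w t * K t - w t * vh t * (U \o clamp tau) t).
Proof. by move=> /andP[t0 _]; exact: (is_derive_prim cdI). Qed.

Let cI : continuous I. Proof. exact: continuous_prim. Qed.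

Let aI s t : 0 <= s -> s <= t -> t <= tau -> I t - I s <= alpha t - alpha s.
Proof.
by move=> s0 st tt; exact: (weighted_le cU cb cB cS cI dU dB dbh dS dI PS s0 st tt).
Qed.

Let w_gt0 t : 0 < w t. Proof. exact: expR_gt0. Qed.

Let B0 : B 0 = 0. Proof. exact: prim_le0. Qed.

(* The weights combine to [w^(1-p) e^((1-p)kt) = e^(-(p-1)B/2)]. *)
Let Kh t : 1 <= t < tau -> 0 <= alpha t -> alpha t / 10 <= w t * (P \o clamp tau) t ->
  c0 * 10 `^ (- p) * h t * `|alpha t| `^ p <= w t * K t.
Proof.
move=> /andP[t1 tt] a0 aw; have p1' := p1.
have ct : clamp tau t = t by rewrite clamp_id// (le_trans ler01 t1) ltW.
have Pw : alpha t / 10 / w t <= `|(P \o clamp tau) t|.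
  apply: le_trans (ler_norm _); rewrite ler_pdivrMr ?w_gt0//.
  by move: aw; rewrite [leRHS]mulrC.
have a10 : 0 <= alpha t / 10 by rewrite divr_ge0.
have aw0 : 0 <= alpha t / 10 / w t by rewrite divr_ge0 ?(ltW (w_gt0 _)).
have Pp : (alpha t / 10 / w t) `^ p <= `|(P \o clamp tau) t| `^ p.
  by apply: ge0_ler_powR; rewrite ?nnegrE//; lra.
have E : c0 * 10 `^ (- p) * h t * `|alpha t| `^ p =
    w t * ((alpha t / 10 / w t) `^ p * (c0 * expR ((1 - p) * (k * t)) * dec t)).
  rewrite ger0_norm// powRM ?invr_ge0 ?(ltW (w_gt0 _))// powRM ?invr_ge0//.
  rewrite -[10^-1]powR_inv1// -powRrM mulN1r.
  rewrite -[(w t)^-1]powR_inv1 ?(ltW (w_gt0 _))// -powRrM mulN1r.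
  rewrite {2}/w expR_powR /h.
  have -> : expR (- ((p - 1) / 2) * B t) =
      w t * expR (- p * (B t / 2 - k * t)) * expR ((1 - p) * (k * t)).
    by rewrite /w -!expRD; congr expR; field.
  by ring.
rewrite E ler_wpM2l ?(ltW (w_gt0 _))// /K ct.
apply: ler_wpM2r => //.
by rewrite mulr_ge0 ?(ltW (dec_gt0 _))// mulr_ge0 ?expR_ge0// ltW.
Qed.

(** [c0] involves only [p], [n], [r] and [k], so [tau] enters the right side through the initial
    pairings alone. *)
Lemma solution_bound :
  H_p n.+1 p b tau <= ((P 0 + (b 0 / 2 + k) * U 0) / 4) `^ (1 - p) /
    ((p - 1) * (c0 * 10 `^ (- p) / 2)).
Proof.
have cl0 : clamp tau 0 = 0 by rewrite clamp_id// lexx ltW.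
have w0 : w 0 = 1 by rewrite /w B0 mul0r mulr0 subrr expR0.
have a0E : alpha 0 = P 0 + (b 0 / 2 + k) * U 0.
  by rewrite /alpha w0 mul1r /= cl0.
have H0 : H_p n.+1 p b tau = prim h tau - prim h 1.
  rewrite (prim_itvB ler01 tau1 (lexx tau) (continuous_integrable_itv _ _ ch)).
  rewrite Rintegral_itv_obnd_cbnd; last first.
    apply: integrableS (continuous_integrable_itv 1 tau ch) => //.
    by apply: subset_itvr; rewrite bnd_simp.
  apply: eq_Rintegral => s; rewrite inE/= in_itv/= => /andP[s1 st].
  have cs : clamp tau s = s by rewrite clamp_id// st (le_trans ler01).
  rewrite /h /dec cs Gla_exponentE; congr (expR (_ * _) * _).
  apply: eq_Rintegral => x; rewrite inE/= in_itv/= => /andP[x0 xs].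
  by rewrite clamp_id// x0 (le_trans xs).
rewrite H0 -a0E.
apply: (@blowup_bound R (U \o clamp tau) (P \o clamp tau) (b \o clamp tau) vh w
  alpha K I h Ih (prim h) (prim (fun t => `|vh t|)) k p _ Vtot tau) => //.
- exact: continuous_prim.
- exact: continuous_prim.
- exact: continuous_prim.
- by rewrite mulr_gt0// powR_gt0.
- by move=> t tt /=; apply: bk; have /andP[] := clamp_itv t (ltW tau0).
- by move=> t /andP[t0 _]; exact: (is_derive_prim cdIh).
- by move=> t /andP[t0 _]; exact: is_derive_prim.
- by move=> t /andP[t0 _]; exact: (is_derive_prim cnv).
- by rewrite /= cl0.
- by rewrite /= cl0.
- by rewrite a0E.
- rewrite [prim _ 0]prim_le0// subr0; apply: le_trans (vV cv).
  by rewrite le_eqVlt; apply/orP; left; apply/eqP; apply: eq_prim => s _.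
- by move=> t _; rewrite mulr_ge0 ?expR_ge0// ltW.
- move=> t _; rewrite mulr_ge0 ?powR_ge0// mulr_ge0 ?(ltW (dec_gt0 _))//.
  by rewrite mulr_ge0 ?expR_ge0// ltW.
Qed.

End functional.

(** * Uniform bounds on the coefficients *)

Section coefficient_bounds.
Context {R : realType}.
Implicit Types (b db m : R -> R) (s t : R).

(** If [|b t|] exceeded the essential bound, continuity would make [|b|] exceed it on some []t, t +
    d[], a set of positive measure. An interval to the right of [t] also serves at [t = 0]. *)
Lemma Loo_bounded b :
  (forall t, 0 <= t -> b s @[s --> within [set s | 0 <= s] (nbhs t)] --> b t) ->
  b \_ `]0, +oo[ \in Lfun lebesgue_measure +oo%E ->
  exists2 L : R, 0 <= L & forall t, 0 <= t -> `|b t| <= L.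
Proof.
move=> cb /andP[_ /set_mem]; rewrite /= /finite_norm unlock /Lnorm ifT; last first.
  apply: (@lt_le_trans _ _ (lebesgue_measure (`[0, 1]%classic : set R))).
    by rewrite lebesgue_measure_itv/= lte_fin ltr01 sube0 lte_fin.
  by apply: le_measure => //; rewrite inE.
set g := _ \o _; set M := ess_sup _ _ => Moo.
have := ess_sup_ge lebesgue_measure g; rewrite -/M => -[N [mN N0 gN]].
exists (Order.max 0 (fine M)); first by rewrite le_max lexx.
move=> t t0; rewrite leNgt; apply/negP => bt.
have cn : `|b s| @[s --> within [set s | 0 <= s] (nbhs t)] --> `|b t|.
  by apply: cvg_norm; exact: cb.
have : \forall s \near within [set s | 0 <= s] (nbhs t), Order.max 0 (fine M) < `|b s|.
  exact: cn (lt_nbhsr bt).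
rewrite near_withinE => /nbhs_ballP[d /= d0 H].
have sub : `]t, t + d[ `<=` N.
  move=> s; rewrite /= in_itv/= => /andP[ts sd]; apply: gN => /= Hs.
  have s0 : 0 < s by exact: le_lt_trans ts.
  have := H s; rewrite /ball/= ltr0_norm ?subr_lt0// => /(_ _ (ltW s0)).
  rewrite opprB ltrBlDl => /(_ sd); rewrite gt_max => /andP[_ Ms].
  move: Hs; rewrite /g /= patchE ifT; last by rewrite inE/= in_itv/= s0.
  move=> Hs; have MR : (fine M)%:E = M.
    by rewrite fineK// fin_numElt Moo andbT; apply: lt_le_trans Hs; exact: ltNyr.
  by move: Hs; rewrite -MR lee_fin leNgt Ms.
have : (lebesgue_measure (`]t, (t + d)%R[%classic : set R) <= lebesgue_measure N)%E.
  by apply: le_measure => //; rewrite inE.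
by rewrite N0 lebesgue_measure_itv/= lte_fin ltrDl d0 -EFinB lee_fin addrAC subrr add0r leNgt d0.
Qed.

Lemma potential_bound b db m :
  (forall t, 0 <= t ->
     (b (t + h) - b t) / h @[h --> within [set h | 0 <= t + h] 0^'] --> db t) ->
  V_pot b m \_ `]0, +oo[ \in Lfun lebesgue_measure 1%:E ->
  exists2 V0 : R, 0 <= V0 & forall tau, 0 < tau ->
    continuous (fun s => m (clamp tau s) - db (clamp tau s) / 2 - b (clamp tau s) ^+ 2 / 4) ->
    prim (fun s => `|m (clamp tau s) - db (clamp tau s) / 2 - b (clamp tau s) ^+ 2 / 4|) tau <= V0.
Proof.
move=> bq /andP[/set_mem/= mV /set_mem/=]; rewrite /finite_norm Lnorm1.
set W := _ \_ _ in mV *.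
set J := (\int[_]_x _)%E => Joo.
have J0 : (0 <= J)%E by apply: integral_ge0.
have JE : (fine J)%:E = J by rewrite fineK// ge0_fin_numE.
exists (fine J); first exact: fine_ge0.
move=> tau tau0 cv.
set v := fun s => _ in cv.
have cnv : continuous (fun s => `|v s|).
  move=> t; apply: (@continuous_comp _ _ _ v (fun y : R => `|y|)); first exact: cv.
  exact: norm_continuous.
rewrite -lee_fin JE /prim /Rintegral fineK; last first.
  exact/integrable_fin_num/continuous_integrable_itv.
(* The endpoint 0 is removed because [V_pot] uses the two-sided derivative, which agrees with [db]
   for positive times. *)
rewrite -integral_itv_obnd_cbnd; last first.
  by apply: measurable_funTS; apply/measurable_EFinP; exact: measurable_realfun.continuous_measurable_fun.
rewrite integral_mkcond; apply: ge0_le_integral => //.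
- by move=> x _; apply: erestrict_ge0 => y _; rewrite lee_fin.
- apply/(measurable_restrictT _ _).1 => //; apply: measurable_funTS.
  by apply/measurable_EFinP; exact: measurable_realfun.continuous_measurable_fun.
- by apply: measurableT_comp => //; exact/measurable_EFinP.
- move=> s _; rewrite patchE; case: ifPn => [|_]; last exact: abse_ge0.
  rewrite inE/= in_itv/= => /andP[s0 st].
  rewrite /W patchE ifT; last by rewrite inE/= in_itv/= s0.
  have cs : clamp tau s = s by rewrite clamp_id// ltW.
  rewrite /v cs /V_pot derive1E.
  have dE : is_derive s 1 b (db s).
    apply: (@quotient_derive _ _ [set t | 0 <= t]); last by apply: bq; exact: ltW.
    by apply: filterS (lt_nbhsr s0) => t; exact: ltW.
  by rewrite derive_val.
Qed.

End coefficient_bounds.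

(** * The integral [H_p] and its inverse *)

Section glassey_integral.
Context {R : realType}.
Variables (n : nat) (p : R) (b : R -> R).
Hypothesis cb : forall t : R, 0 <= t ->
  b s @[s --> within [set s | 0 <= s] (nbhs t)] --> b t.
Hypothesis H_div : H_p n p b t @[t --> +oo] --> +oo.
Implicit Types s t : R.

Let cbh tau : 0 <= tau -> continuous (b \o clamp tau).
Proof.
move=> t0; apply: continuous_comp_clamp => // t /andP[tt _].
apply: cvg_trans (cb tt); apply: cvg_app => A DA.
have {}DA : nbhs t [set s | 0 <= s -> A s] by exact: DA.
suff : nbhs t [set s | `[0, tau]%classic s -> A s] by [].
by apply: filterS DA => s H; rewrite /= in_itv/= => /andP[s0 _]; exact: H.
Qed.

Let h tau s : R := expR (- ((p - 1) / 2) * prim (b \o clamp tau) s) *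
  (1 + clamp tau s) `^ (- Gla_exponent n p).

Let ch tau : 0 <= tau -> continuous (h tau).
Proof.
move=> tau0 t; have cB := continuous_prim (cbh tau0); apply: cvgM.
  apply: (@continuous_comp _ _ _ (fun t => - ((p - 1) / 2) * prim (b \o clamp tau) t) expR).
    by apply: cvgMr; exact: cB.
  exact: continuous_expR.
apply: (@continuous_comp _ _ _ (fun t => 1 + clamp tau t) (fun y : R => y `^ (- Gla_exponent n p))).
  by apply: cvgD; [exact: cvg_cst|exact: continuous_clamp].
apply: differentiable_continuous; apply/derivable1_diffP.
apply: derivable_powR; rewrite in_itv/= andbT.
by have /andP[? _] := clamp_itv t tau0; lra.
Qed.

Let h_gt0 tau s : 0 <= tau -> 0 < h tau s.
Proof.
move=> tau0; rewrite mulr_gt0 ?expR_gt0//; apply: powR_gt0.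
by have /andP[? _] := clamp_itv s tau0; lra.
Qed.

Lemma H_pE tau t : 1 <= t -> t <= tau ->
  H_p n p b t = prim (h tau) t - prim (h tau) 1.
Proof.
move=> t1 tt; have tau0 : 0 <= tau by lra.
rewrite (prim_itvB ler01 t1 tt (continuous_integrable_itv _ _ (ch tau0))).
rewrite Rintegral_itv_obnd_cbnd; last first.
  apply: integrableS (continuous_integrable_itv 1 t (ch tau0)) => //.
  by apply: subset_itvr; rewrite bnd_simp.
apply: eq_Rintegral => s; rewrite inE/= in_itv/= => /andP[s1 st].
have cs : clamp tau s = s by rewrite clamp_id//; apply/andP; split; lra.
rewrite /h cs; congr (expR (_ * _) * _).
apply: eq_Rintegral => x; rewrite inE/= in_itv/= => /andP[x0 xs].
by rewrite /= clamp_id//; apply/andP; split; lra.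
Qed.

Lemma H_p_lt s t : 1 <= s -> s < t -> H_p n p b s < H_p n p b t.
Proof.
move=> s1 st; have t0 : 0 <= t by lra.
rewrite (@H_pE t s)//; last exact: ltW.
rewrite (@H_pE t t)//; last by lra.
rewrite ltrD2r -subr_gt0.
have [||c _ ->] := @MVT R (prim (h t)) (h t) s t st.
- move=> x; rewrite in_itv/= => /andP[sx xt].
  by apply: is_derive_prim; [exact: ch|lra].
- by apply: continuous_subspaceT; apply: continuous_prim; exact: ch.
by rewrite mulr_gt0 ?h_gt0// subr_gt0.
Qed.

(** Divergence provides a time where [H_p] exceeds [y], and the intermediate value theorem starts
    from the value 0 at time 1. *)
Lemma H_p_surj : set_surj `[1, +oo[ `[0, +oo[ (H_p n p b).
Proof.
move=> y; rewrite /= in_itv/= andbT => y0.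
have [tau [tau1 tauy]] : exists tau, 1 <= tau /\ y <= H_p n p b tau.
  have H : \forall t \near +oo, y <= H_p n p b t by move/cvgryPge : H_div; exact.
  have : \forall t \near +oo, 1 <= t /\ y <= H_p n p b t.
    by near=> t; split; near: t; [exact: nbhs_pinfty_ge|exact: H].
  by move=> /filter_ex[t Ht]; exists t.
have tau0 : 0 <= tau by lra.
pose f t := prim (h tau) t - prim (h tau) 1.
have cf : {within `[1, tau], continuous f}.
  apply: continuous_subspaceT => x.
  by apply: cvgB; [exact: (continuous_prim (ch tau0))|exact: cvg_cst].
have f1 : f 1 = 0 by rewrite /f subrr.
have ft : f tau = H_p n p b tau by rewrite (@H_pE tau)//.
have [|c] := IVT tau1 cf (v := y).
  by rewrite f1 ft min_l ?(le_trans y0)// max_r ?(le_trans y0)// y0.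
rewrite in_itv/= => /andP[c1 ct] fc; exists c; first by rewrite /= in_itv/= c1.
by rewrite (@H_pE tau).
Unshelve. all: by end_near. Qed.

Lemma H_p_invK y : 0 <= y -> 1 <= H_p_inv n p b y /\ H_p n p b (H_p_inv n p b y) = y.
Proof.
move=> y0; have yB : `[0, +oo[%classic y by rewrite /= in_itv/= y0.
split; last by apply: (surjpK (fun=> 1) H_p_surj); rewrite inE.
have : `[1, +oo[%classic (H_p_inv n p b y).
  apply: (surjpinv_image_sub H_p_surj (dflt := fun=> 1)).
  by exists y.
by rewrite /= in_itv/= andbT.
Qed.

(** A time strictly between [H_p_inv y] and [T] would violate the bound, [H_p] being strictly
    increasing. Bounds for [t >= 1] are enough since [H_p_inv y >= 1]. *)
Lemma le_H_p_inv (T : \bar R) y : 0 <= y ->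
  (forall t, 1 <= t -> (t%:E < T)%E -> H_p n p b t <= y) ->
  (T <= (H_p_inv n p b y)%:E)%E.
Proof.
move=> y0 Hy; have [x1 xy] := H_p_invK y0.
set x := H_p_inv n p b y in x1 xy *.
rewrite leNgt; apply/negP => xT.
have [t xt tT] : exists2 t, x < t & (t%:E < T)%E.
  case: T xT {Hy} => [T'|_|//]; last by exists (x + 1); rewrite ?ltry// ltrDl.
  by rewrite lte_fin => ?; exists ((x + T') / 2); rewrite ?lte_fin; lra.
have := Hy t (le_trans x1 (ltW xt)) tT.
by rewrite -xy leNgt H_p_lt.
Qed.

End glassey_integral.

(** * Pairings with the initial data *)

Section initial_data.
Context {R : realType} {n : nat}.
Implicit Types (f w : 'rV[R]_n -> R).
Local Notation mu := (leb R n).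

Lemma pair_ae_r f w w' : measurable_fun setT f -> measurable_fun setT w ->
  measurable_fun setT w' -> {ae mu, forall x, w x = w' x} -> pairing f w = pairing f w'.
Proof.
move=> mf mw mw' ww'; rewrite /pairing /Rintegral; congr fine.
apply: ae_eq_integral => //; try by apply/measurable_EFinP; exact: measurable_funM.
by apply: filterS ww' => x /= -> _.
Qed.

Lemma pairZ f w (a : R) : L2 f -> L2 w -> pairing f (fun x => a * w x) = a * pairing f w.
Proof.
move=> Lf Lw; rewrite /pairing -RintegralZl//; last exact: L2M_integrable.
by apply: eq_Rintegral => x _; ring.
Qed.

Lemma pair_ge0 f w : measurable_fun setT f -> measurable_fun setT w ->
  (forall x, 0 <= f x) -> {ae mu, forall x, 0 <= w x} -> 0 <= pairing f w.
Proof.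
move=> mf mw f0 w0.
rewrite (@pair_ae_r f w (fun x => `|w x|))//.
- by apply: Rintegral_ge0 => x _; rewrite mulr_ge0.
- exact: measurableT_comp.
- by apply: filterS w0 => x wx; rewrite ger0_norm.
Qed.

(** A nonnegative integrand of zero integral vanishes almost everywhere; on [E] the factor [f] is
    positive, and off [E] the function [w] is already 0. *)
Lemma pair_eq0 f w (E : set 'rV[R]_n) : L2 f -> L2 w -> (forall x, 0 <= f x) ->
  (forall x, E x -> 0 < f x) -> {ae mu, forall x, ~ E x -> w x = 0} ->
  {ae mu, forall x, 0 <= w x} -> pairing f w = 0 -> {ae mu, forall x, w x = 0}.
Proof.
move=> Lf Lw f0 fE wE w0 fw0.
have iwf := L2M_integrable Lw Lf.
have m := measurable_int _ iwf.
have : (\int[mu]_x `|(w x * f x)%:E| = 0)%E.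
  transitivity (\int[mu]_x (w x * f x)%:E)%E.
    apply: ae_eq_integral => //; first exact: measurableT_comp.
    by apply: filterS w0 => x wx _; rewrite gee0_abs// lee_fin mulr_ge0.
  by rewrite -[LHS]fineK ?integrable_fin_num//; congr EFin.
move/(ae_eq_integral_abs mu measurableT m).
apply: filterS2 wE => x wx /(_ I)[] /eqP; rewrite mulf_eq0 => /orP[/eqP//|/eqP fx].
by apply: wx => /fE; rewrite fx ltxx.
Qed.

End initial_data.

Section bumpexp_initial.
Context {R : realType} {n : nat}.
Implicit Types (k r rho : R) (w : 'rV[R]_n.+1 -> R).

Lemma measurable_bumpexp k rho : measurable_fun setT (@bumpexp R n k rho).
Proof.
by apply: continuous_measurable_rV; apply: smooth_continuous; exact: smooth_bumpexp.
Qed.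

(** On the support of the data both truncations equal the plane wave, so the initial size is
    measured by one number independent of the time horizon. *)
Lemma pair_bumpexp_radius k r rho w : r <= rho -> measurable_fun setT w ->
  {ae leb R n.+1, forall x, ~ eball r x -> w x = 0} ->
  pairing (bumpexp k rho) w = pairing (bumpexp k r) w.
Proof.
move=> rrho mw w0; apply: pair_ae => //; try exact: measurable_bumpexp.
apply: filterS w0 => x wx.
have [xr|/wx->] := pselect (eball r x); last by rewrite !mul0r.
have xb : cbox r x by move=> i; exact/ltW/eball_coord.
rewrite !bumpexpE// => i; exact: le_trans (xb i) rrho.
Qed.

Lemma pair_initial k r rho (eps : R) w v : 0 < r -> r <= rho -> L2 w -> L2 v ->
  {ae leb R n.+1, forall x, ~ eball r x -> w x = 0} ->
  {ae leb R n.+1, forall x, v x = eps * w x} ->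
  pairing (bumpexp k rho) v = eps * pairing (bumpexp k r) w.
Proof.
move=> r0 rrho Lw Lv w0 vw.
have mw := L2_measurable Lw.
rewrite (@pair_ae_r _ _ _ v (fun x => eps * w x))//; last 3 first.
- exact: measurable_bumpexp.
- exact: L2_measurable.
- exact: measurable_funM.
have Lb : L2 (@bumpexp R n k rho) by apply: L2_bumpexp; exact: le_trans (ltW r0) rrho.
by rewrite (pairZ eps Lb Lw) (pair_bumpexp_radius k rrho mw w0).
Qed.

End bumpexp_initial.

Theorem theorem2p5 (R : realType) (n : nat) (p : R) (b m : R -> R)
    (u0 u1 : 'rV[R]_n -> R) (r : R)
    (n_ge1 : (1 <= n)%N) (p_gt1 : 1 < p)
    (b_C1 : C1_half_line b)
    (b_Loo : b \_ `]0, +oo[ \in Lfun lebesgue_measure +oo%E)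
    (m_cont : {within `[0, +oo[, continuous m})
    (V_L1 : V_pot b m \_ `]0, +oo[ \in Lfun lebesgue_measure 1%:E)
    (u0_H1 : H1 u0) (u1_L2 : L2 u1)
    (u0_ge0 : {ae leb R n, forall x, 0 <= u0 x})
    (u1_ge0 : {ae leb R n, forall x, 0 <= u1 x})
    (u0_cpt : compact (ess_support u0)) (u1_cpt : compact (ess_support u1))
    (u01_neq0 : ~ ({ae leb R n, forall x, u0 x = 0} /\
                   {ae leb R n, forall x, u1 x = 0}))
    (r_gt0 : 0 < r)
    (u01_supp : ess_support u0 `|` ess_support u1 `<=` eball r)
    (H_div : H_p n p b t @[t --> +oo] --> +oo) :
  exists C : R, 0 < C /\
    forall (eps : R) (T : \bar R) (u : R -> 'rV[R]_n -> R),
      0 < eps ->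
      energy_solution p r eps b m u0 u1 T u ->
      (lifespan p r eps b m u0 u1 T u < +oo)%E /\
      (lifespan p r eps b m u0 u1 T u <=
         (H_p_inv n p b (C * eps `^ (- (p - 1))))%:E)%E.
Proof.
(* Positive dimension supplies the coordinate [x_0] along which the plane wave travels. *)
case: n u0 u1 n_ge1 u0_H1 u1_L2 u0_ge0 u1_ge0 u0_cpt u1_cpt u01_neq0 u01_supp H_div => //.
move=> n u0 u1 _ [Lu0 _] Lu1 u0_ge0 u1_ge0 _ _ u01_neq0 u01_supp H_div.
have [db [bq cdb]] := b_C1.
have cb (t : R) : 0 <= t -> b s @[s --> within [set s | 0 <= s] (nbhs t)] --> b t.
  by move=> t0; exact: quotient_cvg (bq t t0).
have [L L0 bL] := Loo_bounded cb b_Loo.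
have [V V0 vV] := potential_bound bq V_L1.
(* The three summands serve the decay of [e^(-2kt)] for [t >= 1], the bound [|b| <= k], and the
   smallness of the potential term. *)
pose k := 30 + L + 25 * V.
have k30 : 30 <= k by rewrite /k; lra.
have kV : 25 * V <= k by rewrite /k; lra.
have bk (t : R) : 0 <= t -> `|b t| <= k by move=> /bL bt; rewrite /k; lra.
have bk0 : 0 < b 0 / 2 + k.
  by have := bk 0 (lexx _); rewrite ler_norml => /andP[]; lra.
have u0E : {ae leb R n.+1, forall x, ~ eball r x -> u0 x = 0}.
  by apply: ess_support_ae => x ux; apply: u01_supp; left.
have u1E : {ae leb R n.+1, forall x, ~ eball r x -> u1 x = 0}.
  by apply: ess_support_ae => x ux; apply: u01_supp; right.
pose phi := bumpexp k r : 'rV[R]_n.+1 -> R.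
have Lphi : L2 phi by apply: L2_bumpexp; exact: ltW.
have mphi : measurable_fun setT phi by exact: measurable_bumpexp.
have phi0 x : 0 <= phi x by exact: bumpexp_ge0.
have phiE x : eball r x -> 0 < phi x.
  move=> xr; rewrite /phi bumpexpE ?expR_gt0// => i.
  exact/ltW/eball_coord.
pose I0 := pairing phi u0; pose I1 := pairing phi u1.
have I0_ge0 : 0 <= I0 by apply: pair_ge0 => //; exact: L2_measurable.
have I1_ge0 : 0 <= I1 by apply: pair_ge0 => //; exact: L2_measurable.
pose A0 := I1 + (b 0 / 2 + k) * I0.
(* If [A0] were 0, both pairings would vanish and, by nonnegativity, both data would be zero almost
   everywhere. *)
have A0_gt0 : 0 < A0.
  rewrite lt_def /A0 addr_ge0 ?mulr_ge0 ?(ltW bk0)// andbT.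
  apply/negP; rewrite paddr_eq0 ?mulr_ge0 ?(ltW bk0)// mulf_eq0 (gt_eqF bk0) /=.
  move=> /andP[/eqP i1 /eqP i0]; apply: u01_neq0; split.
    exact: (pair_eq0 Lphi Lu0 phi0 phiE u0E u0_ge0 i0).
  exact: (pair_eq0 Lphi Lu1 phi0 phiE u1E u1_ge0 i1).
pose c := (ball_const n (r + 1) * expR (k * r)) `^ (1 - p) * 10 `^ (- p) / 2.
have c_gt0 : 0 < c.
  rewrite /c divr_gt0// mulr_gt0 ?powR_gt0// mulr_gt0 ?expR_gt0//.
  by apply: ball_const_gt0; rewrite addr_gt0.
(* The bound of [solution_bound] with [eps A0] as initial value and the power of [eps] taken out. *)
pose C := (A0 / 4) `^ (1 - p) / ((p - 1) * c).
have C_gt0 : 0 < C.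
  by rewrite /C divr_gt0 ?powR_gt0 ?divr_gt0// mulr_gt0// subr_gt0.
exists C; split => // eps T u eps0 _.
have y0 : 0 <= C * eps `^ (- (p - 1)) by rewrite mulr_ge0 ?powR_ge0// ltW.
have CE : (eps * A0 / 4) `^ (1 - p) / ((p - 1) * c) = C * eps `^ (- (p - 1)).
  rewrite -(mulrA eps) powRM; [|exact: ltW|by rewrite divr_ge0// ltW].
  by rewrite opprB -(mulrA (eps `^ _)) mulrC.
have key : (lifespan p r eps b m u0 u1 T u <=
    (H_p_inv n.+1 p b (C * eps `^ (- (p - 1))))%:E)%E.
  (* The lifespan is a supremum over continuations, so the bound is proved for each continuation [v]
     on [[0, T')] and each [t >= 1] below [T']. *)
  apply: ub_ereal_sup => T' [_ [v [[T'0 [vH1 [vt [vC1 [vLp [vsupp [v0 [vt0 vweak]]]]]]]] _]]].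
  apply: le_H_p_inv => // t t1 tT'.
  have T'dom0 : time_dom T' 0 by split => //; exact: T'0.
  have [Lv _ _] := vC1; have [Lv0 Lvt0] := Lv 0 T'dom0.
  have rt : r <= r + t by rewrite lerDl (le_trans ler01 t1).
  have E0 := pair_initial k r_gt0 rt Lu0 Lv0 u0E v0.
  have E1 := pair_initial k r_gt0 rt Lu1 Lvt0 u1E vt0.
  have eI0 : 0 <= pairing (bumpexp k (r + t)) (v 0) by rewrite E0; apply: mulr_ge0 I0_ge0; exact: ltW.
  have eI1 : 0 <= pairing (bumpexp k (r + t)) (vt 0) by rewrite E1; apply: mulr_ge0 I1_ge0; exact: ltW.
  have A0E : pairing (bumpexp k (r + t)) (vt 0) +
      (b 0 / 2 + k) * pairing (bumpexp k (r + t)) (v 0) = eps * A0.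
    by rewrite E0 E1 /A0 /I0 /I1 /phi; ring.
  have A0_gt0' : 0 < pairing (bumpexp k (r + t)) (vt 0) +
      (b 0 / 2 + k) * pairing (bumpexp k (r + t)) (v 0) by rewrite A0E; exact: mulr_gt0.
  have := @solution_bound R n p r eps b db m u1 T' v vt k t V p_gt1 r_gt0 t1 tT'
    vH1 vC1 vLp vsupp vweak bq cdb m_cont k30 bk (vV t (lt_le_trans ltr01 t1)) kV eI0 eI1 A0_gt0'.
  by rewrite A0E -/c CE.
split => //; apply: le_lt_trans key _; exact: ltry.
Qed.
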